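(* Let $(M,\mathcal{F})$ be a minimal compact lamination by hyperbolic surfaces. If no leaf of $\mathcal{F}$ is simply connected, then the horocycle flow on the unit tangent bundle $T^1\mathcal{F}$ is minimal, i.e. every orbit of the horocycle flow is dense in $T^1\mathcal{F}$.
   Context: A compact lamination by surfaces $(M,\mathcal{F})$ is a compact metrizable space $M$ with an open cover $\{U_\alpha\}$ and homeomorphisms $\varphi_\alpha:U_\alpha\to D\times T$, where $D$ is a disk in $\mathbb{R}^2$ and $T$ is a separable locally compact metrizable space (possibly depending on $\alpha$), such that the changes of coordinates have the form $\varphi_\alpha\circ\varphi_\beta^{-1}(x,t)=(\lambda^t_{\alpha\beta}(x),\tau_{\alpha\beta}(t))$ with $\lambda^t_{\alpha\beta}$ smooth and depending continuously on $t$ in the $C^\infty$ topology. The plaques $\varphi_\alpha^{-1}(D\times\{t\})$ glue together to form maximal connected surfaces called leaves. The lamination is minimal if all its leaves are dense in $M$. A hyperbolic surface is a quotient $S=\Gamma\backslash\mathbb{H}$ of the hyperbolic plane by a torsion-free discrete subgroup $\Gamma$ of $PSL(2,\mathbb{R})$ (so it is complete, oriented, of constant curvature $-1$). Its unit tangent bundle is identified with $\Gamma\backslash PSL(2,\mathbb{R})$. A (compact) lamination by hyperbolic surfaces is a compact lamination by surfaces whose leaves are endowed with Riemannian metrics, varying continuously in the $C^\infty$ topology from leaf to leaf, for which every leaf is a hyperbolic surface. The unit tangent bundle $T^1\mathcal{F}$ is the circle bundle over $M$ consisting of the unit vectors tangent to the leaves; it is a lamination whose leaves are the unit tangent bundles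 of the leaves of $\mathcal{F}$. There is a continuous right $PSL(2,\mathbb{R})$-action on $T^1\mathcal{F}$ which on the unit tangent bundle $\Gamma\backslash PSL(2,\mathbb{R})$ of each leaf is right translation. The horocycle flow $h_s$ on $T^1\mathcal{F}$ is the action of the one-parameter subgroup of matrices $\begin{pmatrix}1&s\\0&1\end{pmatrix}$, $s\in\mathbb{R}$. *)

(* Defs.v *)
From HB Require Import structures.
From mathcomp Require Import all_boot all_order all_algebra.
From mathcomp Require Import complex.
From mathcomp Require Import all_classical all_reals all_analysis.
Set Implicit Arguments.
Unset Strict Implicit.
Unset Printing Implicit Defensive.
Import Order.TTheory GRing.Theory Num.Theory.
Import numFieldNormedType.Exports.
Local Open Scope classical_set_scope.
Local Open Scope ring_scope.

Section General.
Context {R : realType}.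

Definition separable_space (T : topologicalType) :=
  exists2 B : set T, countable B & dense B.

Definition homeomorphism_between (X Y : topologicalType) (U : set X)
    (V : set Y) (f : X -> Y) (g : Y -> X) :=
  [/\ (forall x, U x -> V (f x) /\ g (f x) = x),
      (forall y, V y -> U (g y) /\ f (g y) = y),
      {within U, continuous f} & {within V, continuous g}].

Definition open_disk (c : 'rV[R]_2) (r : R) : set 'rV[R]_2 :=
  [set x | (x 0 0 - c 0 0) ^+ 2 + (x 0 1 - c 0 1) ^+ 2 < r ^+ 2].

Definition partial (W : normedModType R) (s : seq 'I_2) (f : 'rV[R]_2 -> W) :
    'rV[R]_2 -> W :=
  foldr (fun i g x => 'D_(delta_mx 0 i) g x) f s.

(* Only the germ of [f] at a point matters for its derivatives there, so for
   [O] open the values of [f] outside [O] are irrelevant. *)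
Definition smooth_on (W : normedModType R) (O : set 'rV[R]_2)
    (f : 'rV[R]_2 -> W) :=
  forall (s : seq 'I_2) x, O x -> differentiable (partial s f) x.

(* [f] is smooth in the first variable, and [f (., t)] depends continuously on
   [t] in the C^oo topology: uniform convergence on compact sets of all the
   partial derivatives. If [O] is open, a compact [K] with [K * {t0}] inside
   [O] satisfies [K * {t}] inside [O] for [t] close to [t0]. *)
Definition smooth_family (T : topologicalType) (W : normedModType R)
    (O : set ('rV[R]_2 * T)) (f : 'rV[R]_2 * T -> W) :=
  (forall t, smooth_on [set x | O (x, t)] (fun x => f (x, t))) /\
  (forall (t0 : T) (K : set 'rV[R]_2), compact K ->
     K `<=` [set x | O (x, t0)] ->
     forall (s : seq 'I_2) (e : R), 0 < e ->
     \forall t \near t0, forall x, K x ->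
       `|partial s (fun y => f (y, t)) x
         - partial s (fun y => f (y, t0)) x| < e).

Let I01 : set R := `[0, 1]%classic.

Definition path_connected (X : topologicalType) (A : set X) :=
  A !=set0 /\ forall x y, A x -> A y -> exists c : R -> X,
    [/\ {within I01, continuous c}, c @` I01 `<=` A, c 0 = x & c 1 = y].

Definition null_homotopic (X : topologicalType) (A : set X) (c : R -> X) :=
  exists H : R * R -> X,
    [/\ {within I01 `*` I01, continuous H}, H @` (I01 `*` I01) `<=` A,
        forall s, I01 s -> H (s, 0) = c s /\ H (s, 1) = c 0 &
        forall t, I01 t -> H (0, t) = c 0 /\ H (1, t) = c 0].

Definition simply_connected (X : topologicalType) (A : set X) :=
  path_connected A /\
  forall c : R -> X, {within I01, continuous c} -> c @` I01 `<=` A ->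
    c 0 = c 1 -> null_homotopic A c.

End General.

Arguments path_connected R {X} A.
Arguments simply_connected R {X} A.

Section HyperbolicPlane.
Context {R : realType}.

(* The hyperbolic plane is the upper half-plane in R^2, with the metric
   (dx^2 + dy^2) / y^2. *)
Definition half_plane : set 'rV[R]_2 := [set z | 0 < z 0 1].

Definition hyperbolic_metric (z : 'rV[R]_2) : 'M[R]_2 := (z 0 1 ^- 2)%:M.

Definition to_complex (z : 'rV[R]_2) : R[i] := Complex (z 0 0) (z 0 1).

Definition of_complex (w : R[i]) : 'rV[R]_2 :=
  \row_j if j == 0 then complex.Re w else complex.Im w.

Definition SL2 : set 'M[R]_2 := [set g | \det g = 1].

Definition moebius (g : 'M[R]_2) (z : 'rV[R]_2) : 'rV[R]_2 :=
  let w := to_complex z in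
  of_complex (((g 0 0)%:C * w + (g 0 1)%:C) / ((g 1 0)%:C * w + (g 1 1)%:C))%C.

(* A subgroup of PSL(2,R) is given by its full preimage in SL(2,R), which
   contains -1; [g] and [-g] are the same element of PSL(2,R). *)
Definition subgroup_PSL2 (G : set 'M[R]_2) :=
  [/\ G `<=` SL2, G 1, forall g h, G g -> G h -> G (g * h),
      forall g, G g -> G g^-1 & forall g, G g -> G (- g)].

Definition discrete_in_PSL2 (G : set 'M[R]_2) :=
  forall g, G g -> \forall h \near g, G h -> h = g.

Definition torsion_free_in_PSL2 (G : set 'M[R]_2) :=
  forall g n, G g -> (0 < n)%N -> g ^+ n = 1 \/ g ^+ n = -1 ->
    g = 1 \/ g = -1.

Definition horocycle_matrix (s : R) : 'M[R]_2 := 1 + s *: delta_mx 0 1.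

End HyperbolicPlane.

Record lamination (R : realType) := Lamination {
  lam_space :> metricType R;
  lam_compact : compact [set: lam_space];
  chart_index : Type;
  transverse_space : chart_index -> metricType R;
  transverse_separable : forall a, separable_space (transverse_space a);
  transverse_locally_compact :
    forall a, locally_compact [set: transverse_space a];
  disk_center : chart_index -> 'rV[R]_2;
  disk_radius : chart_index -> R;
  disk_radius_gt0 : forall a, 0 < disk_radius a;
  chart_dom : chart_index -> set lam_space;
  chart_dom_open : forall a, open (chart_dom a);
  chart_dom_cover : forall p, exists a, chart_dom a p;
  chart : forall a, lam_space -> 'rV[R]_2 * transverse_space a;
  chart_inv : forall a, 'rV[R]_2 * transverse_space a -> lam_space;
  chart_homeo : forall a, homeomorphism_between (chart_dom a)
    (open_disk (disk_center a) (disk_radius a) `*` [set: transverse_space a])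
    (chart a) (@chart_inv a);
  transition_tau : forall a b, exists tau : transverse_space b -> transverse_space a,
    forall z, open_disk (disk_center b) (disk_radius b) z.1 ->
      chart_dom a (chart_inv z) -> (chart a (chart_inv z)).2 = tau z.2;
  transition_smooth : forall a b, smooth_family
    [set z | open_disk (disk_center b) (disk_radius b) z.1 /\
             chart_dom a (chart_inv z)]
    (fun z : 'rV[R]_2 * transverse_space b => (chart a (chart_inv z)).1)
}.

Section Leaves.
Context {R : realType} (L : lamination R).

Definition chart_disk (a : chart_index L) : set 'rV[R]_2 :=
  open_disk (disk_center a) (disk_radius a).

Definition transition (a b : chart_index L) (z : 'rV[R]_2 * transverse_space b) :
    'rV[R]_2 * transverse_space a :=
  chart a (chart_inv z).

Definition transition_dom (a b : chart_index L) :
    set ('rV[R]_2 * transverse_space b) :=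
  [set z | chart_disk b z.1 /\ chart_dom a (chart_inv z)].

(* In row-vector convention: the coordinates of a tangent vector at [z] are
   multiplied on the right by this matrix. *)
Definition transition_jacobian (a b : chart_index L)
    (z : 'rV[R]_2 * transverse_space b) : 'M[R]_2 :=
  jacobian (fun x => (transition a (x, z.2)).1) z.1.

(* The set M with the leaf topology, for which the plaques, with the topology
   of the disk, are open. *)
Definition leaf_space : Type := lam_space L.

HB.instance Definition _ := Choice.on leaf_space.

Definition leaf_open (W : set leaf_space) :=
  forall p, W p -> forall a, chart_dom a p ->
    \forall x \near (chart a p).1, W (chart_inv (x, (chart a p).2)).

Lemma leaf_openT : leaf_open setT.
Proof. by move=> p _ a _; near=> x. Unshelve. all: by end_near. Qed.

Lemma leaf_openI : setI_closed leaf_open.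
Proof.
move=> A B oA oB p [Ap Bp] a pa.
by apply: filterI; [exact: oA | exact: oB].
Qed.

Lemma leaf_open_bigU (I : Type) (f : I -> set leaf_space) :
  (forall i, leaf_open (f i)) -> leaf_open (\bigcup_i f i).
Proof.
move=> of_ p [i _ fip] a pa.
by apply: filterS (of_ i p fip a pa) => x fx; exists i.
Qed.

HB.instance Definition _ :=
  isOpenTopological.Build leaf_space leaf_openT leaf_openI leaf_open_bigU.

Definition leaf (p : L) : set leaf_space :=
  @connected_component leaf_space setT p.

Definition minimal_lamination := forall p : L, dense (leaf p : set L).

(* [pi] induces an orientation-preserving isometry from the quotient of the
   hyperbolic plane by [G] onto the leaf [l]; the leaf carries the Riemannian
   metric with matrix [metric a] in the chart [a], and the orientation of the
   charts. *)
Definition uniformizes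
    (metric : forall a : chart_index L, 'rV[R]_2 * transverse_space a -> 'M[R]_2)
    (l : set leaf_space) (G : set 'M[R]_2) (pi : 'rV[R]_2 -> leaf_space) :=
  [/\ subgroup_PSL2 G /\ discrete_in_PSL2 G /\ torsion_free_in_PSL2 G,
      {within half_plane, continuous pi},
      pi @` half_plane = l,
      forall z w, half_plane z -> half_plane w ->
        (pi z = pi w <-> exists2 g, G g & w = moebius g z) &
      forall a,
        let O := half_plane `&` [set z | chart_dom a (pi z)] in
        let f := fun z => (chart a (pi z)).1 in
        smooth_on O f /\
        forall z, O z ->
          let J := jacobian f z in
          0 < \det J /\
          J *m metric a (chart a (pi z)) *m J^T = hyperbolic_metric z].

End Leaves.

Arguments uniformizes {R L}.

(* The leaves of a lamination by hyperbolic surfaces are oriented, continuously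
   from leaf to leaf; this is expressed by an oriented atlas. *)
Record hyperbolic_lamination (R : realType) := HyperbolicLamination {
  hyp_lam :> lamination R;
  hyp_oriented : forall (a b : chart_index hyp_lam)
    (z : 'rV[R]_2 * transverse_space b),
    transition_dom a z -> 0 < \det (transition_jacobian a z);
  riemannian_metric : forall a : chart_index hyp_lam,
    'rV[R]_2 * transverse_space a -> 'M[R]_2;
  riemannian_sym : forall (a : chart_index hyp_lam) z, chart_disk a z.1 ->
    (@riemannian_metric a z)^T = @riemannian_metric a z;
  riemannian_posdef : forall (a : chart_index hyp_lam) z, chart_disk a z.1 ->
    forall v : 'rV[R]_2, v != 0 -> 0 < (v *m @riemannian_metric a z *m v^T) 0 0;
  riemannian_smooth : forall a : chart_index hyp_lam,
    smooth_family (chart_disk a `*` [set: transverse_space a]) (@riemannian_metric a);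
  riemannian_compat : forall (a b : chart_index hyp_lam)
    (z : 'rV[R]_2 * transverse_space b), transition_dom a z ->
    let J := transition_jacobian a z in
    @riemannian_metric b z = J *m @riemannian_metric a (transition a z) *m J^T;
  leaves_hyperbolic : forall p : hyp_lam,
    exists G pi, uniformizes (@riemannian_metric) (leaf p) G pi
}.

Arguments riemannian_metric {R} h a z : rename.

(* A tangent vector at [foot] is the family of its coordinate representatives
   in all the charts around [foot] (and, for extensionality, 0 in the others). *)
Record unit_tangent (R : realType) (L : hyperbolic_lamination R) :=
  UnitTangent {
  foot : L;
  vec : chart_index L -> 'rV[R]_2;
  vec_out : forall a, ~ chart_dom a foot -> vec a = 0;
  vec_compat : forall a b, chart_dom a foot -> chart_dom b foot ->
    vec a = vec b *m transition_jacobian a (chart b foot);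
  vec_unit : forall a, chart_dom a foot ->
    (vec a *m riemannian_metric L a (chart a foot) *m (vec a)^T) 0 0 = 1
}.

Section UnitTangentBundle.
Context {R : realType} (L : hyperbolic_lamination R).
Local Notation T1 := (unit_tangent L).

HB.instance Definition _ := gen_eqMixin T1.
HB.instance Definition _ := gen_choiceMixin T1.

(* The topology for which the sets of unit vectors over the [chart_dom a] are
   open, and [xi |-> (foot xi, vec xi a)] is a homeomorphism from the set over
   [chart_dom a] onto its image. *)
Definition unit_tangent_open (W : set T1) :=
  forall xi, W xi -> forall a, chart_dom a (foot xi) ->
    \forall q \near foot xi & v \near vec xi a,
      forall eta : T1, foot eta = q -> vec eta a = v -> W eta.

Lemma unit_tangent_openT : unit_tangent_open setT.
Proof. by move=> xi _ a _; near=> q v. Unshelve. all: by end_near. Qed.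

Lemma unit_tangent_openI : setI_closed unit_tangent_open.
Proof.
move=> A B oA oB xi [Axi Bxi] a xia.
have := oB xi Bxi a xia; have := oA xi Axi a xia.
apply: filterS2 => -[q v] /= hA hB eta *.
by split; [exact: hA | exact: hB].
Qed.

Lemma unit_tangent_open_bigU (I : Type) (f : I -> set T1) :
  (forall i, unit_tangent_open (f i)) -> unit_tangent_open (\bigcup_i f i).
Proof.
move=> of_ xi [i _ fixi] a xia.
apply: filterS (of_ i xi fixi a xia) => -[q v] /= h eta *.
by exists i => //; exact: h.
Qed.

HB.instance Definition _ := isOpenTopological.Build T1
  unit_tangent_openT unit_tangent_openI unit_tangent_open_bigU.

(* Identification of PSL(2,R) with the unit tangent bundle of the hyperbolic
   plane: [g] corresponds to the image by [g] of the upward unit vector at the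
   complex number i. Here [xi] is the image of that vector under the
   differential of [pi]. *)
Definition represents (pi : 'rV[R]_2 -> leaf_space L) (g : 'M[R]_2)
    (xi : T1) :=
  let i0 : 'rV[R]_2 := delta_mx 0 1 in
  foot xi = pi (moebius g i0) /\
  forall a, chart_dom a (foot xi) ->
    vec xi a = 'D_(delta_mx 0 1) (fun z => (chart a (pi (moebius g z))).1) i0.

(* The right action of PSL(2,R): on the unit tangent bundle of a leaf,
   identified with G\PSL(2,R), it is the right translation by [h]. The result
   does not depend on the choice of [G], [pi] and [g]. *)
Definition PSL2_action (xi : T1) (h : 'M[R]_2) : T1 :=
  xget xi [set eta | exists G pi g,
    [/\ uniformizes (riemannian_metric L) (leaf (foot xi)) G pi, SL2 g,
        represents pi g xi & represents pi (g * h) eta]].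

Definition horocycle_flow (s : R) (xi : T1) : T1 :=
  PSL2_action xi (horocycle_matrix s).

Definition horocycle_orbit (xi : T1) : set T1 :=
  range (fun s => horocycle_flow s xi).

Definition minimal_horocycle_flow := forall xi : T1, dense (horocycle_orbit xi).

End UnitTangentBundle.

(* Main.v *)
Require Import Defs.
From mathcomp Require Import all_boot all_order all_algebra.
From mathcomp Require Import complex ring lra.
From mathcomp Require Import all_classical all_reals all_analysis.

(** The proof has a dynamical half and a geometric half.

    Dynamics. The unit tangent bundle is a compact Hausdorff space [X] with a
    continuous right action of [SL2] that has only dense orbits, since the
    leaves are dense. The stabilizer of a vector is conjugate to the deck group
    of its leaf: it is discrete and torsion-free, and it is not reduced to
    [1] and [-1], for the leaf would then be a plane. These properties imply
    that all the orbits of the upper unipotent group are dense, which is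
    [horocycles_dense].

    Compactness makes the discreteness uniform ([uniformly_free]); it follows
    that no stabilizer contains a parabolic or an elliptic element. The
    existence of nontrivial elements is also uniform: by the Baire property,
    those of bounded size suffice on some open set, and the density of the
    orbits spreads the bound to [X] ([uniformly_nontrivial]). Hence every
    stabilizer contains a hyperbolic element of bounded size, with a trace
    bounded away from 2 ([trace_gap]). Let [M] be a minimal closed set that is
    invariant under the unipotent group. Far along the geodesic of a point of
    [M], a bounded hyperbolic element fixes the point; seen from the origin of
    the geodesic, it is the product of a lower unipotent matrix close to 1, of
    a diagonal matrix, and of an upper unipotent matrix. In the limit, a
    diagonal matrix with first entry not of modulus 1 preserves [M]
    ([geodesic_return], [minimal_contraction]). Its powers contract the lower
    unipotent part of any element [g] of the stabilizer of a point of [M],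
    so that the diagonal matrix with first entry [g 0 0] also preserves [M]
    ([minimal_stab_Am]). This entry takes all the nonzero values when the point
    moves on its horocycle, because the stabilizer is not triangular
    ([stab_not_triangular]); thus [M] is invariant under the whole triangular
    group, and such a closed set is the whole space
    ([triangular_invariant_full]).

    Geometry. The action is described by developing maps, which are the local
    isometries from the hyperbolic plane to the leaves: [h] acts by
    precomposition with the Moebius transformation of [h] ([frames_action]).
    That the action is well defined and continuous amounts to the fact that a
    developing map is determined by the image of one vector, and depends
    continuously on this vector even from leaf to leaf. By the Koszul formula
    ([second_derivative]), the second derivatives of a local isometry are
    polynomials in its first derivatives and in those of the metric; as the
    metric varies smoothly from leaf to leaf, a comparison of differential
    equations ([jet_comparison]) shows that developing maps with close 1-jets
    at a point remain close on a disk ([local_convergence]), and then along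
    segments ([developing_convergence]). Finally, if the deck group of a leaf
    is trivial then its uniformization is a homeomorphism from the half-plane,
    and the leaf is simply connected ([leaf_simply_connected]). *)

Set Implicit Arguments.
Unset Strict Implicit.
Unset Printing Implicit Defensive.
Import Order.TTheory GRing.Theory Num.Theory.
Import numFieldNormedType.Exports.
Local Open Scope classical_set_scope.
Local Open Scope ring_scope.

(** * Limits and norms of matrices *)

Lemma near_pair1 (T U : Type) (F : set_system T) (G : set_system U)
    {FF : Filter F} {FG : Filter G} (P : set T) :
  F P -> filter_prod F G [set p | P p.1].
Proof. by move=> FP; exists (P, setT) => [|[x y] []//]; split => //; exact: filterT. Qed.

Lemma near_pair2 (T U : Type) (F : set_system T) (G : set_system U)
    {FF : Filter F} {FG : Filter G} (P : set U) :
  G P -> filter_prod F G [set p | P p.2].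
Proof. by move=> GP; exists (setT, P) => [|[x y] []//]; split => //; exact: filterT. Qed.

Lemma near_sym (T U : Type) (F : set_system T) (G : set_system U)
    (P : set (T * U)) :
  filter_prod F G P -> filter_prod G F [set p | P (p.2, p.1)].
Proof.
by move=> [[A B] [/= FA GB] AB]; exists (B, A) => // -[x y] [/= ? ?]; exact: AB.
Qed.

Section Matrices.
Context {R : realType}.

Lemma cvg_mx (T : Type) (F : set_system T) {FF : Filter F} m n
    (f : T -> 'M[R]_(m, n)) (M : 'M[R]_(m, n)) :
  (forall i j, (fun x => f x i j) @ F --> M i j) -> f @ F --> M.
Proof.
move=> h A [P MP sPA].
suff : \forall x \near F, forall i j, P i j (f x i j).
  by apply: filterS => x; exact: sPA.
by apply: filter_forall => i; apply: filter_forall => j; exact: h.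
Qed.

Lemma cvg_entry (T : Type) (F : set_system T) {FF : Filter F} m n
    (f : T -> 'M[R]_(m, n)) (M : 'M[R]_(m, n)) i j :
  f @ F --> M -> (fun x => f x i j) @ F --> M i j.
Proof.
move=> h; exact: (@cvg_comp _ _ _ f (fun N : 'M[R]_(m, n) => N i j) F (nbhs M)
  (nbhs (M i j)) h (@coord_continuous R m n i j M)).
Qed.

Lemma entry_le_norm m n (M : 'M[R]_(m, n)) i j : `|M i j| <= `|M|.
Proof.
by rewrite [leRHS]/Num.norm/= mx_normrE; exact: (le_bigmax _ _ (i, j)).
Qed.

Lemma norm_le_entries m n (M : 'M[R]_(m, n)) e :
  0 <= e -> (forall i j, `|M i j| <= e) -> `|M| <= e.
Proof.
by move=> e0 h; rewrite [leLHS]/Num.norm/= mx_normrE bigmax_le.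
Qed.

Lemma compact_entries_le m n (N : R) :
  compact [set M : 'M[R]_(m, n) | forall i j, `|M i j| <= N].
Proof.
pose f (v : 'rV[R]_(m * n)) : 'M[R]_(m, n) := vec_mx v.
have cf : continuous f.
  move=> v; apply: (@cvg_mx _ (nbhs v)) => i j; rewrite /f mxE.
  under eq_fun do rewrite mxE.
  exact: coord_continuous.
rewrite (_ : mkset _ = f @` [set v : 'rV[R]_(m * n) | forall i, v ord0 i \in `[-N, N]]).
  apply: continuous_compact.
    by apply: continuous_subspaceT.
  apply: (@rV_compact _ _ (fun=> `[- N, N]%classic)) => _.
  exact: segment_compact.
rewrite predeqE => M; split=> [MN|[v vN <-] i j].
  exists (mxvec M) => [i|]; last exact: mxvecK.
  by case/mxvec_indexP: i => i j; rewrite mxvecE in_itv/= -ler_norml MN.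
by rewrite /f mxE; have := vN (mxvec_index i j); rewrite in_itv/= -ler_norml.
Qed.

Lemma cvg_mulmx (T : Type) (F : set_system T) {FF : Filter F} m n p
    (f : T -> 'M[R]_(m, n)) (g : T -> 'M[R]_(n, p))
    (A : 'M[R]_(m, n)) (B : 'M[R]_(n, p)) :
  f @ F --> A -> g @ F --> B -> (fun x => f x *m g x) @ F --> A *m B.
Proof.
move=> fA gB; apply: cvg_mx => i j; rewrite mxE.
under eq_fun do rewrite mxE.
apply: cvg_big => //= [|k _]; first exact: add_continuous.
by apply: cvgM; apply: cvg_entry.
Qed.

Lemma cvg_trmx (T : Type) (F : set_system T) {FF : Filter F} m n
    (f : T -> 'M[R]_(m, n)) (A : 'M[R]_(m, n)) : f @ F --> A -> (fun x => (f x)^T) @ F --> A^T.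
Proof.
move=> fA; apply: cvg_mx => i j; rewrite mxE.
by under eq_fun do rewrite mxE; exact: cvg_entry.
Qed.

Definition mx2 (a b c d : R) : 'M[R]_2 :=
  \matrix_(i, j) if i == 0 then (if j == 0 then a else b)
                 else (if j == 0 then c else d).

Lemma mx2E a b c d : ((mx2 a b c d 0 0 = a) * (mx2 a b c d 0 1 = b) *
  (mx2 a b c d 1 0 = c) * (mx2 a b c d 1 1 = d))%type.
Proof. by rewrite /mx2 !mxE. Qed.

Lemma ord2P (P : 'I_2 -> Prop) : P 0 -> P 1 -> forall i, P i.
Proof.
move=> p0 p1 [[|[|//]] h].
  by rewrite (_ : Ordinal h = 0)//; exact: val_inj.
by rewrite (_ : Ordinal h = 1)//; exact: val_inj.
Qed.

Lemma big_ord2 (V : nmodType) (F : 'I_2 -> V) : \sum_i F i = F 0 + F 1.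
Proof.
rewrite big_ord_recl big_ord1; congr (F _ + F _); exact: val_inj.
Qed.

Lemma mx2P (M N : 'M[R]_2) : M 0 0 = N 0 0 -> M 0 1 = N 0 1 ->
  M 1 0 = N 1 0 -> M 1 1 = N 1 1 -> M = N.
Proof. by move=> ? ? ? ?; apply/matrixP; elim/ord2P; elim/ord2P. Qed.

Lemma mx2_eta (M : 'M[R]_2) : M = mx2 (M 0 0) (M 0 1) (M 1 0) (M 1 1).
Proof. by apply: mx2P; rewrite mx2E. Qed.

Lemma mx2M a b c d a' b' c' d' : mx2 a b c d * mx2 a' b' c' d' =
  mx2 (a * a' + b * c') (a * b' + b * d') (c * a' + d * c') (c * b' + d * d').
Proof. by apply: mx2P; rewrite !mxE big_ord2 !mx2E. Qed.

Lemma mx2_1 : 1 = mx2 1 0 0 1.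
Proof. by apply: mx2P; rewrite mx2E !mxE. Qed.

Lemma mx2N a b c d : - mx2 a b c d = mx2 (- a) (- b) (- c) (- d).
Proof. by apply: mx2P; rewrite mx2E mxE mx2E. Qed.

Lemma det_mx2 a b c d : \det (mx2 a b c d) = a * d - b * c.
Proof.
rewrite (expand_det_row _ 0) big_ord2 /cofactor !det_mx11 !mxE /=; ring.
Qed.

Lemma SL2P (g : 'M[R]_2) : SL2 g <-> g 0 0 * g 1 1 - g 0 1 * g 1 0 = 1.
Proof. by rewrite /SL2/= {1}(mx2_eta g) det_mx2. Qed.

Lemma SL2_mx2 a b c d : SL2 (mx2 a b c d) <-> a * d - b * c = 1.
Proof. by rewrite /SL2/= det_mx2. Qed.

Lemma SL2M (g h : 'M[R]_2) : SL2 g -> SL2 h -> SL2 (g * h).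
Proof. by rewrite /SL2/= det_mulmx => -> ->; rewrite mulr1. Qed.

Lemma SL2_1 : SL2 (1 : 'M[R]_2). Proof. exact: det1. Qed.

Lemma SL2N (g : 'M[R]_2) : SL2 g -> SL2 (- g).
Proof. by move/SL2P => h; apply/SL2P; rewrite !mxE !mulrNN. Qed.

Definition adj2 (g : 'M[R]_2) : 'M[R]_2 :=
  mx2 (g 1 1) (- g 0 1) (- g 1 0) (g 0 0).

Lemma SL2_adj (g : 'M[R]_2) : SL2 g -> SL2 (adj2 g).
Proof. by move/SL2P => h; apply/SL2_mx2; rewrite mulrNN mulrC. Qed.

Lemma mul_adj2 (g : 'M[R]_2) : SL2 g -> g * adj2 g = 1.
Proof.
move/SL2P => h; rewrite {1}(mx2_eta g) mx2M mx2_1.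
by congr mx2; rewrite -?h; ring.
Qed.

Lemma adj2_mul (g : 'M[R]_2) : SL2 g -> adj2 g * g = 1.
Proof.
move/SL2P => h; rewrite [X in _ * X](mx2_eta g) mx2M mx2_1.
by congr mx2; rewrite -?h; ring.
Qed.

Lemma cvg_mx2 (T : Type) (F : set_system T) {FF : Filter F}
    (f1 f2 f3 f4 : T -> R) a b c d :
  f1 @ F --> a -> f2 @ F --> b -> f3 @ F --> c -> f4 @ F --> d ->
  (fun x => mx2 (f1 x) (f2 x) (f3 x) (f4 x)) @ F --> mx2 a b c d.
Proof.
move=> ? ? ? ?; apply: cvg_mx; elim/ord2P; elim/ord2P; rewrite !mx2E;
  by under eq_fun do rewrite !mx2E.
Qed.

Lemma norm_mul2 (A B : 'M[R]_2) : `|A * B| <= 2 * (`|A| * `|B|).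
Proof.
apply: norm_le_entries => [|i j]; first by rewrite !mulr_ge0.
rewrite mxE big_ord2 mulr2n mulrDl mul1r (le_trans (ler_normD _ _))//.
by rewrite lerD// normrM ler_pM// entry_le_norm.
Qed.

End Matrices.

(** The homography of matrix [(a, L b; c / L, e)] cannot map the ends of an
    interval into this interval: since the images are bounded, [b] is of order
    [1 / L], so that [a e] is close to 1; as [a] is expanding, the denominators
    at [p] and [q] are smaller than 1, and the length increases. *)
Lemma no_expansion (R : realType) (a b c e L d N B p q : R) :
  a * e = 1 + b * c -> 1 + d / 2 <= `|a| -> 0 < d ->
  `|a| <= N -> `|b| <= N -> `|c| <= N -> `|e| <= N ->
  0 <= N -> 0 <= B -> 1 <= L ->
  1 + (N * (B * (N * B + N) + N * B) + N * B) * (2 / d + 1) < L ->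
  p < q -> `|p| <= B -> `|q| <= B ->
  c / L * p + e != 0 -> c / L * q + e != 0 ->
  p <= (a * p + L * b) / (c / L * p + e) -> (a * p + L * b) / (c / L * p + e) <= q ->
  p <= (a * q + L * b) / (c / L * q + e) -> (a * q + L * b) / (c / L * q + e) <= q ->
  False.
Proof.
move=> ae ga d0 aN bN cN eN N0 B0 L1 LK pq pB qB; set dp := _ + e; set dq := _ + e.
move=> dp0 dq0 pp' p'q pq' q'q.
set C := B * (N * B + N) + N * B in LK.
have L0 : 0 < L by lra.
have Ln0 : L != 0 by rewrite gt_eqF.
have cr r : `|r| <= B -> `|c / L * r| <= N * B / L.
  move=> rB; rewrite !normrM normfV (gtr0_norm L0) mulrAC ler_pM2r ?invr_gt0//.
  exact: ler_pM.
have crN r : `|r| <= B -> `|c / L * r| <= N * B.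
  move=> /cr h; apply: le_trans h _; rewrite ler_pdivrMr// ler_peMr// mulr_ge0//.
have p'B : `|(a * p + L * b) / dp| <= B.
  move: pB qB; rewrite !ler_norml => /andP[? ?] /andP[? ?]; apply/andP; split; lra.
have LbC : `|L * b| <= C.
  have -> : L * b = (a * p + L * b) / dp * dp - a * p by rewrite divfK//; ring.
  apply: le_trans (ler_normB _ _) _; rewrite /C lerD//.
    rewrite normrM ler_pM//; apply: le_trans (ler_normD _ _) _.
    by rewrite lerD// crN.
  by rewrite normrM ler_pM.
have bC : `|b| <= C / L by rewrite ler_pdivlMr// mulrC -{1}(gtr0_norm L0) -normrM.
have C0 : 0 <= C by apply: le_trans LbC.
have K : (N * C + N * B) / L * (2 / d + 1) < 1.
  by rewrite mulrAC ltr_pdivrMr// mul1r; lra.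
set S := (N * C + N * B) / L in K.
have e1 : `|e| * (1 + d / 2) <= 1 + N * C / L.
  apply: (@le_trans _ _ `|a * e|).
    by rewrite normrM mulrC ler_wpM2r.
  rewrite ae; apply: le_trans (ler_normD _ _) _; rewrite normr1 lerD2l normrM mulrC -mulrA.
  by rewrite ler_pM.
have den r : `|r| <= B -> `|c / L * r + e| < 1.
  move=> rB; have h1 := cr _ rB; have h2 := ler_normD (c / L * r) e.
  have h3 : (`|c / L * r| + `|e|) * (1 + d / 2) < 1 + d / 2.
    have h4 : `|c / L * r| * (1 + d / 2) <= N * B / L * (1 + d / 2).
      by rewrite ler_wpM2r//; lra.
    have SE : S = N * C / L + N * B / L by rewrite /S; ring.
    have NC0 : 0 <= N * C / L by rewrite divr_ge0 ?mulr_ge0// ltW.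
    have Sd : S * (1 + d / 2) < d / 2.
      have -> : 1 + d / 2 = (2 / d + 1) * (d / 2) by field; rewrite gt_eqF.
      by rewrite mulrA gtr_pMl// divr_gt0.
    have h5 : N * C / L <= N * C / L * (1 + d / 2) by rewrite ler_peMr//; lra.
    by move: Sd; rewrite SE !mulrDl; lra.
  by apply: le_lt_trans h2 _; move: h3; rewrite gtr_pMl//; lra.
have dpq : `|dp * dq| < 1.
  by rewrite normrM -[ltRHS]mulr1 ltr_pM// den.
have dpq0 : 0 < `|dp * dq| by rewrite normr_gt0 mulf_neq0.
have : ((a * q + L * b) / dq - (a * p + L * b) / dp) * (dp * dq) = q - p.
  have div1 (x u v : R) : v != 0 -> x / v * (u * v) = x * u by move=> v0; field.
  rewrite mulrBl div1// [dp * dq]mulrC div1//.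
  transitivity ((q - p) * (a * e - b * c)); last by rewrite ae; ring.
  by rewrite /dp /dq; field.
set D := _ - _ => DE.
have DB : `|D| <= q - p by rewrite ler_norml /D; apply/andP; split; lra.
have : `|D * (dp * dq)| < q - p.
  rewrite normrM; apply: (@le_lt_trans _ _ ((q - p) * `|dp * dq|)).
    by rewrite ler_wpM2r.
  by rewrite gtr_pMr//; lra.
by rewrite DE gtr0_norm ?ltxx//; lra.
Qed.

(** * Minimality of the unipotent flow for actions with hyperbolic stabilizers *)

Section Dynamics.
Context {R : realType} {X : topologicalType} (act : X -> 'M[R]_2 -> X).
Definition stab (x : X) (g : 'M[R]_2) := SL2 g /\ act x g = x.

Context
  (act1 : forall x, act x 1 = x)
  (actM : forall x g h, SL2 g -> SL2 h -> act (act x g) h = act x (g * h))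
  (actN : forall x g, SL2 g -> act x (- g) = act x g)
  (act_cont : forall x g W, SL2 g -> nbhs (act x g) W ->
     \forall y \near x & h \near g, SL2 h -> W (act y h))
  (Xcompact : compact [set: X]) (Xhausdorff : hausdorff_space X)
  (act_dense : forall x, dense [set act x g | g in SL2])
  (stab_discrete : forall x, exists2 e : R, 0 < e &
     forall g, stab x g -> `|g - 1| < e -> g = 1)
  (stab_torsion_free : forall x g n, stab x g -> (0 < n)%N ->
     g ^+ n = 1 -> g = 1 \/ g = -1)
  (stab_nontrivial : forall x, exists g, [/\ stab x g, g <> 1 & g <> -1]).

Definition Um (w : R) := mx2 1 w 0 1.
Definition Vm (z : R) := mx2 1 0 z 1.
Definition Am (a : R) := mx2 a 0 0 a^-1.

Lemma SL2_Um w : SL2 (Um w). Proof. by apply/SL2_mx2; rewrite mulr1 mulr0 subr0. Qed.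
Lemma SL2_Vm z : SL2 (Vm z). Proof. by apply/SL2_mx2; rewrite mulr1 mul0r subr0. Qed.
Lemma SL2_Am a : a != 0 -> SL2 (Am a).
Proof. by move=> a0; apply/SL2_mx2; rewrite divff// mulr0 subr0. Qed.
#[local] Hint Resolve SL2_Um SL2_Vm SL2_Am : core.

Lemma stabM x g h : stab x g -> stab x h -> stab x (g * h).
Proof. by move=> [sg xg] [sh xh]; split; [exact: SL2M | rewrite -actM// xg]. Qed.

Lemma stabN x g : stab x g -> stab x (- g).
Proof. by move=> [sg xg]; split; [exact: SL2N | rewrite actN]. Qed.

Lemma stab_adj x g : stab x g -> stab x (adj2 g).
Proof.
move=> [sg xg]; split; first exact: SL2_adj.
by rewrite -{1}xg actM ?mul_adj2//; exact: SL2_adj.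
Qed.

Lemma stab_conj x g h : SL2 h -> stab (act x h) g -> stab x (h * g * adj2 h).
Proof.
move=> sh [sg xg]; split; first by apply: SL2M (SL2_adj sh); exact: SL2M.
rewrite -!actM//; try exact: SL2_adj; try exact: SL2M.
rewrite xg actM//; last exact: SL2_adj.
by rewrite mul_adj2.
Qed.

Lemma stab_conjV x g h : SL2 h -> stab x g -> stab (act x h) (adj2 h * g * h).
Proof.
move=> sh [sg xg]; have sh' := SL2_adj sh.
have e : act (act x h) (adj2 h) = x by rewrite actM// mul_adj2.
split; first by apply: SL2M sh; exact: SL2M.
by rewrite -!actM// ?e ?xg//; exact: SL2M.
Qed.

Lemma SL2_closed : closed (@SL2 R).
Proof.
rewrite (_ : @SL2 R = (fun g : 'M[R]_2 => g 0 0 * g 1 1 - g 0 1 * g 1 0) @^-1`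
  [set 1]); last by rewrite predeqE => g; exact: SL2P.
apply: closed_comp; last exact: closed_eq.
by move=> g _; apply: (@cvgB _ _ _ (nbhs g)); apply: (@cvgM _ _ (nbhs g));
  exact: coord_continuous.
Qed.

Lemma near_moved x g : SL2 g -> act x g <> x ->
  \forall y \near x & h \near g, SL2 h -> act y h <> y.
Proof.
move=> sg /eqP gx.
move: Xhausdorff; rewrite open_hausdorff => /(_ _ _ gx)[[A B]/= [gA xB] [oA oB AB]].
have nA : nbhs (act x g) A by apply: open_nbhs_nbhs; split => //; exact: set_mem.
have nB : nbhs x B by apply: open_nbhs_nbhs; split => //; exact: set_mem.
have nB' : \forall y \near x & h \near g, B y by exact: (cvg_fst nB).
apply: filterS2 (act_cont sg nA) nB' => -[y h]/= Ay By sh yh.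
by move/eqP: AB; rewrite -subset0 => /(_ y); apply; split => //; rewrite -yh; exact: Ay.
Qed.

Lemma compact_shell (N r r' : R) : compact [set g : 'M[R]_2 |
  [/\ SL2 g, forall i j, `|g i j| <= N, r <= `|g - 1| & r' <= `|g + 1|] ].
Proof.
pose K := [set g : 'M[R]_2 | forall i j, `|g i j| <= N].
have cK : compact K := @compact_entries_le R 2 2 N.
apply: (@subclosed_compact _ _ K); last by move=> g [].
  rewrite (_ : mkset _ = (@SL2 R `&` K) `&`
    ((fun g : 'M[R]_2 => `|g - 1|) @^-1` [set t | r <= t] `&`
     (fun g : 'M[R]_2 => `|g + 1|) @^-1` [set t | r' <= t])); last first.
    by rewrite predeqE => g; split=> [[]|[[] ? ? []]].
  apply: closedI; first by apply: closedI; [exact: SL2_closed|exact: compact_closed].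
  apply: closedI; (apply: closed_comp; last exact: closed_ge) => g _;
    apply: (@cvg_norm _ _ _ (nbhs g)).
    by apply: (@cvgB _ _ _ (nbhs g)); [exact: cvg_id|exact: cvg_cst].
  by apply: (@cvgD _ _ _ (nbhs g)); [exact: cvg_id|exact: cvg_cst].
exact: cK.
Qed.

Lemma norm_square_sub1 (g : 'M[R]_2) : `|g - 1| <= 1 / 4 ->
  3 / 2 * `|g - 1| <= `|g * g - 1| <= 5 / 2 * `|g - 1|.
Proof.
move=> h; set e : 'M[R]_2 := g - 1.
have -> : g * g - 1 = (e + e) + e * e.
  have -> : g = e + 1 by rewrite subrK.
  by rewrite mulrDl mulrDr !mulr1 mul1r addrA addrK -addrA addrC.
have h1 := norm_mul2 e e.
have h2 : `|e| * `|e| <= 1 / 4 * `|e| by rewrite ler_wpM2r.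
have h3 : `|e + e| = 2 * `|e| by rewrite -mulr2n normrMn mulr_natl.
have := ler_normD (e + e) (e * e); have := lerB_normD (e + e) (e * e).
rewrite h3; lra.
Qed.

Lemma stab_iter_sqr x g k : stab x g -> stab x (iter k (fun h => h * h) g).
Proof. by move=> xg; elim: k => //= k; exact: (fun h => stabM h h). Qed.

(** The shell of the [g] with [r <= |g - 1| <= 5 r / 2] is compact and does not
    meet the stabilizer of [x], hence not those of the points close to [x]. An
    element of such a stabilizer closer to 1 would enter the shell after some
    squarings, since squaring multiplies the distance to 1 by a factor between
    3/2 and 5/2. *)
Lemma locally_free_near (x : X) : exists2 r : R, 0 < r &
  nbhs x [set y | forall g, stab y g -> `|g - 1| < r -> g = 1].
Proof.
have [e e0 he] := stab_discrete x.
pose r := Num.min (e / 3) (1 / 4).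
have r0 : 0 < r by rewrite lt_min; apply/andP; split; lra.
have re : r <= e / 3 by rewrite ge_min lexx.
have r4 : r <= 1 / 4 by rewrite ge_min lexx orbT.
exists r => //.
pose N : R := 5 / 2 * r + 1.
have moved : \forall y \near nbhs x, forall g, SL2 g -> r <= `|g - 1| ->
    `|g - 1| <= 5 / 2 * r -> act y g <> y.
  have cK := @compact_shell N r 0.
  move/compact_near_coveringP : cK => /(_ X (nbhs x)
    (fun y g => `|g - 1| <= 5 / 2 * r -> SL2 g -> act y g <> y) _) cov.
  have : \forall y \near nbhs x, [set g : 'M[R]_2 |
    [/\ SL2 g, forall i j, `|g i j| <= N, r <= `|g - 1| & 0 <= `|g + 1|] ] `<=`
    (fun g => `|g - 1| <= 5 / 2 * r -> SL2 g -> act y g <> y).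
    apply: cov => g [sg gN rg _].
    have [gr|gr] := leP `|g - 1| (5 / 2 * r); last first.
      have hn : nbhs (g : 'M[R]_2) [set h : 'M[R]_2 | 5 / 2 * r < `|h - 1|].
        apply: (@cvgr_gt _ _ (nbhs (g : 'M[R]_2)) _ (fun h : 'M[R]_2 => `|h - 1|) `|g - 1|) => //.
        apply: (@cvg_norm _ _ _ (nbhs (g : 'M[R]_2))).
        by apply: (@cvgB _ _ _ (nbhs (g : 'M[R]_2))); [exact: cvg_id|exact: cvg_cst].
      have hn' : filter_prod (nbhs (g : 'M[R]_2)) (nbhs x)
        [set p : 'M[R]_2 * X | 5 / 2 * r < `|p.1 - 1| ] by exact: (near_pair1 hn).
      by apply: filterS hn' => -[h y]/= ?; rewrite leNgt => /negP.
    have gx : act x g <> x.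
      move=> gx; have g1 : g = 1 by apply: he => //; lra.
      by move: rg; rewrite g1 subrr normr0; lra.
    by apply: filterS (near_sym (near_moved sg gx)) => -[h y]/= ? _.
  apply: filterS => y hy g sg rg gr; apply: hy => //; split => // i j.
  have -> : g = (g - 1) + 1 by rewrite subrK.
  rewrite mxE (le_trans (ler_normD _ _))// lerD//.
    exact: le_trans (entry_le_norm _ _ _) gr.
  by rewrite !mxE; case: (i == j); rewrite ?normr1 ?normr0.
apply: filterS moved => y hy g yg gr; apply/eqP/negPn/negP => /eqP g1.
have e0g : 0 < `|g - 1| by rewrite normr_gt0 subr_eq0; exact/eqP.
pose u k := iter k (fun h : 'M[R]_2 => h * h) g.
have hu k : (3 / 2) ^+ k * `|g - 1| <= `|u k - 1| /\ `|u k - 1| < r.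
  elim: k => [|k [IH1 IH2]]; first by rewrite expr0 mul1r.
  have /norm_square_sub1/andP[s1 s2] : `|u k - 1| <= 1 / 4 by lra.
  split; first by rewrite exprS -mulrA; apply: le_trans s1; rewrite ler_pM2l.
  rewrite ltNge; apply/negP => ru.
  have [su yu] := stab_iter_sqr k.+1 yg.
  by apply: (hy (u k.+1)) => //; rewrite /u/= -/(u k); lra.
have b k : k%:R / 2 <= (3 / 2 : R) ^+ k.
  suff : 1 + k%:R / 2 <= (3 / 2 : R) ^+ k.
    by apply: le_trans; rewrite lerDr.
  elim: k => [|k IH]; first by rewrite expr0; lra.
  have k0 : 0 <= k%:R :> R by [].
  rewrite exprS -natr1; move: IH; move: ((3 / 2) ^+ k) => p IH; lra.
pose k := Num.truncn (2 * r / `|g - 1|).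
have kb : 2 * r / `|g - 1| < k.+1%:R by exact: truncnS_gt.
have [u1 u2] := hu k.+1.
have := b k.+1; rewrite ltr_pdivrMr// in kb.
move=> /(ler_wpM2r (ltW e0g)) b'.
have : r < r.
  apply: le_lt_trans u2; apply: le_trans u1; apply: le_trans b'.
  by rewrite mulrAC ler_pdivlMr// mulrC ltW.
by rewrite ltxx.
Qed.

Lemma uniformly_free : exists2 r : R, 0 < r &
  forall x g, stab x g -> `|g - 1| < r -> g = 1.
Proof.
have /compact_near_coveringP cov := Xcompact.
have : \forall r \near (0:R)^'+, [set: X] `<=`
    [set x | forall g, stab x g -> `|g - 1| < r -> g = 1].
  apply: cov => x _; have [r r0 hr] := locally_free_near x.
  have h : \forall y \near x & r' \near (0:R)^'+, r' <= r.
    by apply: (@near_pair2 _ _ (nbhs x)); exact: nbhs_right_le.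
  have h' : \forall y \near x & r' \near (0:R)^'+,
      forall g, stab y g -> `|g - 1| < r -> g = 1.
    exact: (@near_pair1 _ _ (nbhs x) _ _ _ _ hr).
  apply: filterS2 h h' => -[y r']/= r'r hy g yg gr.
  by apply: hy => //; exact: lt_le_trans r'r.
have p0 : \forall r \near (0:R)^'+, 0 < r by exact: nbhs_right_gt.
move=> h; have [r [r0 hr]] := filter_ex (filterI p0 h).
by exists r => // x g; exact: hr.
Qed.

(** A parabolic element is conjugate to an upper unipotent matrix, which
    diagonal conjugations bring arbitrarily close to 1. *)
Lemma no_parabolic x g : stab x g -> g 0 0 + g 1 1 = 2 -> g = 1.
Proof.
have [r r0 free] := uniformly_free.
(* an upper unipotent element is contracted to [1] by the diagonal group *)
have unip y w : stab y (Um w) -> w = 0.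
  move=> yw; pose s := `|w| / r + 1.
  have s0 : 0 < s by rewrite ltr_wpDl// divr_ge0// ltW.
  have sn0 : s != 0 by rewrite gt_eqF.
  have := stab_conjV (SL2_Am sn0) yw.
  have -> : adj2 (Am s) * Um w * Am s = Um (w / s ^+ 2).
    rewrite /adj2 /Am !mx2E !mx2M /Um; congr mx2; field => //.
  move=> /free h; suff /h : `|Um (w / s ^+ 2) - 1| < r.
    rewrite mx2_1 => /matrixP/(_ 0 1); rewrite !mx2E => /eqP.
    by rewrite mulf_eq0 invr_eq0 expf_eq0/= (negbTE sn0) orbF => /eqP.
  apply: le_lt_trans (_ : `|w| / s ^+ 2 < r); last first.
    rewrite ltr_pdivrMr ?exprn_gt0//.
    have : `|w| = (s - 1) * r by rewrite /s addrK divfK// gt_eqF.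
    move=> ->; rewrite [ltRHS]mulrC ltr_pM2r//.
    have : 1 <= s by rewrite lerDr divr_ge0// ltW.
    by nra.
  apply: norm_le_entries; first by rewrite divr_ge0// sqr_ge0.
  by elim/ord2P; elim/ord2P; rewrite mx2_1 !mxE/= ?subrr ?normr0 ?subr0
    ?normrM ?normfV ?(ger0_norm (sqr_ge0 _)) ?divr_ge0 ?sqr_ge0.
move=> xg tr; have [sg _] := xg; have dg := (SL2P g).1 sg.
have dE : g 1 1 = 2 - g 0 0 by lra.
have [c0|c0] := eqVneq (g 1 0) 0.
  have a1 : g 0 0 = 1.
    apply/eqP; rewrite -subr_eq0 -sqrf_eq0; apply/eqP.
    by move: dg; rewrite c0 dE; lra.
  have gU : g = Um (g 0 1).
    by rewrite {1}(mx2_eta g) c0 a1 dE a1 /Um; congr mx2; lra.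
  by move: xg; rewrite gU => /unip ->; rewrite /Um mx2_1.
pose h := mx2 (g 0 0 - 1) (- (g 1 0)^-1) (g 1 0) 0.
have sh : SL2 h by apply/SL2_mx2; field.
have := stab_conjV sh xg.
have -> : adj2 h * g * h = Um (- (g 1 0)^-1).
  have bE : g 0 1 = (g 0 0 * (2 - g 0 0) - 1) / g 1 0.
    by apply: (mulIf c0); rewrite divfK//; rewrite dE in dg; lra.
  have gE := mx2_eta g; rewrite bE dE in gE.
  rewrite [X in _ * X * _]gE /adj2 /h !mx2E !mx2M /Um; congr mx2; field => //.
move=> /unip/eqP; rewrite oppr_eq0 invr_eq0 => /eqP c0'.
by rewrite c0' eqxx in c0.
Qed.

Lemma powers_bounded (g : 'M[R]_2) : SL2 g -> `|g 0 0 + g 1 1| < 2 ->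
  exists N : R, forall n i j, `|(g ^+ n) i j| <= N.
Proof.
move=> sg; set t := g 0 0 + g 1 1 => tr; have dg := (SL2P g).1 sg.
(* by Cayley-Hamilton, the powers of [g] are of the form [a * g + b], and the
   form [det (a * g + b)] is definite *)
have CH n : exists a b : R, [/\ (g ^+ n) 0 0 = a * g 0 0 + b,
    (g ^+ n) 0 1 = a * g 0 1, (g ^+ n) 1 0 = a * g 1 0 &
    (g ^+ n) 1 1 = a * g 1 1 + b] /\ a ^+ 2 + a * b * t + b ^+ 2 = 1.
  elim: n => [|n [a [b [[e1 e2 e3 e4] q]]]].
    by exists 0, 1; rewrite expr0 !mxE/=; split; [split; ring | ring].
  exists (a * t + b), (- a); split; last by rewrite -q; ring.
  rewrite exprSr !mxE !big_ord2 e1 e2 e3 e4.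
  have bc : g 0 1 * g 1 0 = g 0 0 * g 1 1 - 1 by rewrite -dg; ring.
  split; rewrite /t; [|ring|ring|].
    by rewrite mulrDl mulrDl -!mulrA bc; ring.
  by rewrite mulrDl mulrDl -!mulrA (mulrC (g 1 0)) bc; ring.
have t2 : 0 < 1 - t ^+ 2 / 4.
  by move: tr; rewrite ltr_norml => /andP[? ?]; nra.
pose Q := (1 - t ^+ 2 / 4)^-1 + 1.
have Q0 : 0 < (1 - t ^+ 2 / 4)^-1 by rewrite invr_gt0.
have aQ (a b : R) : a ^+ 2 + a * b * t + b ^+ 2 = 1 -> `|a| <= Q.
  move=> q; have h : a ^+ 2 * (1 - t ^+ 2 / 4) <= 1.
    by move: q; have := sqr_ge0 (b + a * t / 2); nra.
  have {}h : a ^+ 2 <= (1 - t ^+ 2 / 4)^-1 by rewrite -[leRHS]mul1r ler_pdivlMr.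
  have : `|a| ^+ 2 <= Q ^+ 2 by rewrite real_normK ?num_real// /Q; nra.
  by rewrite ler_pXn2r// nnegrE /Q; lra.
exists (Q * `|g| + Q) => n.
have [a [b [[e1 e2 e3 e4] q]]] := CH n.
have Qa := aQ _ _ q; have Qb : `|b| <= Q.
  by apply: (aQ b a); rewrite -q; ring.
have ag i j : `|a * g i j| <= Q * `|g|.
  by rewrite normrM ler_pM// entry_le_norm.
have agb i j : `|a * g i j + b| <= Q * `|g| + Q.
  by rewrite (le_trans (ler_normD _ _))// lerD.
have Q1 : 0 <= Q by rewrite /Q; lra.
elim/ord2P; elim/ord2P; rewrite ?e1 ?e2 ?e3 ?e4//;
  by rewrite (le_trans (ag _ _))// lerDl.
Qed.

Lemma stabX x g n : stab x g -> stab x (g ^+ n).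
Proof.
move=> xg; elim: n => [|n IH]; last by rewrite exprS; exact: stabM.
by rewrite expr0; split; [exact: SL2_1 | exact: act1].
Qed.

(** The powers of an elliptic element are bounded, so that two of them are
    close; their quotient is then 1 by [uniformly_free], and the element has
    finite order. *)
Lemma no_elliptic x g : stab x g -> 2 <= `|g 0 0 + g 1 1|.
Proof.
move=> xg; rewrite leNgt; apply/negP => tr; have [sg _] := xg.
have [N hN] := powers_bounded sg tr.
have [r r0 free] := uniformly_free.
have cK := @compact_entries_le R 2 2 N.
pose u n : 'M[R]_2 := g ^+ n.
have [c [_ clc]] : [set M : 'M[R]_2 | forall i j, `|M i j| <= N] `&`
    cluster (u @ \oo) !=set0.
  by apply: cK; apply: (@filterE _ \oo) => n i j; exact: hN.
pose d := r / (4 * (N + 1)).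
have N0 : 0 <= N by apply: le_trans (hN 0%N 0 0).
have d0 : 0 < d by rewrite divr_gt0// mulr_gt0// ltr_wpDl.
have pick n0 : exists2 n, (n0 <= n)%N & `|c - u n| < d.
  have A : (u @ \oo) [set u n | n in [set n | (n0 <= n)%N]].
    by exists n0 => // n /= n0n; exists n.
  have B : nbhs (c : 'M[R]_2) (ball (c : 'M[R]_2) d) by exact: nbhsx_ballx.
  by have [_ [[n n0n <-]]] := clc _ _ A B; rewrite -ball_normE; exists n.
have [n _ hn] := pick 0%N; have [m nm hm] := pick n.+1.
have hnm : `|u m - u n| < 2 * d.
  rewrite -[u m](subrK c) -addrA (le_lt_trans (ler_normD _ _))//.
  by rewrite distrC in hm; lra.
have [sn yn] := stabX n xg.
have dif : g ^+ (m - n) - 1 = adj2 (u n) * (u m - u n).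
  rewrite mulrBr adj2_mul//; congr (_ - _).
  by rewrite /u -{2}(subnKC (ltnW nm)) exprD mulrA adj2_mul// mul1r.
have : g ^+ (m - n) = 1.
  apply: (free x); first exact: stabX.
  rewrite dif; apply: le_lt_trans (norm_mul2 _ _) _.
  have : `|adj2 (u n)| <= N.
    apply: norm_le_entries => //.
    by elim/ord2P; elim/ord2P; rewrite /adj2 mx2E ?normrN hN.
  move=> aN; apply: (@le_lt_trans _ _ (2 * (N * (2 * d)))).
    by rewrite ler_pM2l// ler_pM// ltW.
  have dE : d * (4 * (N + 1)) = r by rewrite /d divfK// gt_eqF// mulr_gt0// ltr_wpDl.
  by move: dE d0; lra.
move=> /(stab_torsion_free xg); rewrite subn_gt0 => /(_ nm)[] gE;
  move: tr; rewrite gE !mxE/=; first by rewrite ger0_norm; lra.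
by rewrite ler0_norm; lra.
Unshelve. all: by end_near. Qed.

Lemma hyperbolic x g : stab x g -> g <> 1 -> g <> -1 -> 2 < `|g 0 0 + g 1 1|.
Proof.
move=> xg g1 gN1; rewrite lt_neqAle (no_elliptic xg) andbT.
apply/eqP => t2; have [t0|t0] := leP 0 (g 0 0 + g 1 1).
  by apply: g1; apply: no_parabolic xg _; rewrite t2 ger0_norm.
apply: gN1; rewrite -[g]opprK; congr (- _).
apply: no_parabolic (stabN xg) _; rewrite !mxE t2 ltr0_norm//; ring.
Qed.

Lemma closed_ball_inside (V : set X) (x : X) : open V -> V x ->
  exists O : set X, [/\ open O, O x & closure O `<=` V].
Proof.
move=> oV Vx.
have nV : nbhs x V by apply: open_nbhs_nbhs.
have [W nW cW] := @compact_regular X x setT Xhausdorff Xcompact filterT _ nV.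
exists W°; split; [exact: open_interior| exact: nW |].
by apply: subset_trans cW; apply: closure_subset; exact: interior_subset.
Qed.

(** A point outside all the [F n] would be found in nested closures of open
    sets that avoid the [F n] one after the other. *)
Lemma baire_compact (F : nat -> set X) (x0 : X) : (forall n, closed (F n)) ->
  \bigcup_n F n = setT -> exists n, (F n)° !=set0.
Proof.
move=> cF UF; apply: contrapT => noint.
have dns n (V : set X) : open V -> V !=set0 ->
    exists O, [/\ open O, O !=set0 & closure O `<=` V `\` F n].
  move=> oV [x Vx].
  have [y [Vy Fy]] : (V `\` F n) !=set0.
    apply: contrapT => /set0P/negP/negPn/eqP; rewrite setD_eq0 => VF.
    apply: noint; exists n; exists x.
    exact: (@filterS _ (nbhs x) _ _ _ VF (open_nbhs_nbhs (conj oV Vx))).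
  have oVF : open (V `\` F n) by apply: openI => //; exact: closed_openC.
  have [W [oW Wy cW]] := closed_ball_inside oVF (conj Vy Fy).
  by exists W; split => //; exists y.
pose T := {O : set X | open O /\ O !=set0}.
have step n (V : T) : {O : T | closure (sval O) `<=` sval V `\` F n}.
  case: V => V [oV V0]; apply: cid.
  have [W [oW W0 cW]] := dns n V oV V0.
  by exists (exist _ W (conj oW W0)).
have T0 : T by exists setT; split; [exact: openT | exists x0].
pose On := fix On n : T := if n is m.+1 then sval (step m (On m)) else T0.
have OS n : closure (sval (On n.+1)) `<=` sval (On n) `\` F n.
  exact: (svalP (step n (On n))).
have Odec n m : (n <= m)%N -> sval (On m) `<=` sval (On n).
  elim: m => [|m IH]; first by rewrite leqn0 => /eqP ->.
  rewrite leq_eqVlt => /orP[/eqP->//|]; rewrite ltnS => /IH.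
  apply: subset_trans; apply: subset_trans (@subset_closure _ _) _.
  by move=> y /(OS m)[].
pose FF := filter_from setT (fun n => sval (On n)).
have FFP : ProperFilter FF.
  apply: filter_from_proper; last by move=> n _; case: (svalP (On n)).
  apply: filter_from_filter; first by exists 0%N.
  move=> n m _ _; exists (maxn n m) => // y Oy.
  by split; apply: Odec Oy; rewrite leq_max leqnn ?orbT.
have [y [_ cly]] : [set: X] `&` cluster FF !=set0.
  by apply: Xcompact; exact: filterT.
have [n _ Fy] : (\bigcup_n F n) y by rewrite UF.
have : closure (sval (On n.+1)) y.
  by move=> B nB; apply: cly => //; exists n.+1.
by move/OS => -[].
Qed.

Lemma entries_conj (g h : 'M[R]_2) (N : R) : (forall i j, `|g i j| <= N) ->
  forall i j, `|(h * g * adj2 h) i j| <= 4 * (`|h| * N * `|adj2 h|).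
Proof.
move=> gN i j; have N0 : 0 <= N := le_trans (normr_ge0 _) (gN 0 0).
have {}gN : `|g| <= N by exact: norm_le_entries.
apply: le_trans (entry_le_norm _ _ _) _; apply: le_trans (norm_mul2 _ _) _.
have h1 : `|h * g| <= 2 * (`|h| * N).
  by apply: le_trans (norm_mul2 _ _) _; rewrite ler_pM2l// ler_wpM2l.
have := ler_wpM2r (normr_ge0 (adj2 h)) h1; lra.
Qed.

Lemma conj_eq (g h c : 'M[R]_2) : SL2 h -> h * c = c * h ->
  h * g * adj2 h = c -> g = c.
Proof.
move=> sh hc e; rewrite -[g]mulr1 -(adj2_mul sh) -[g]mul1r -(adj2_mul sh).
rewrite -[adj2 h * h * g]mulrA mulrA -[adj2 h * _ * _]mulrA e.
by rewrite -mulrA -hc mulrA adj2_mul// mul1r.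
Qed.

(** The points fixed by some element of size at most [n], away from 1 and -1,
    form a closed set; these sets cover [X], so that one of them has a nonempty
    interior. Every orbit meets this interior, and conjugation by a given
    element multiplies the sizes by a bounded factor, so that the compactness
    of [X] gives a common bound. *)
Lemma uniformly_nontrivial (x0 : X) : exists N : R, forall x, exists g,
  [/\ stab x g, forall i j, `|g i j| <= N, g <> 1 & g <> -1].
Proof.
have [r r0 free] := uniformly_free.
have freeN x g : stab x g -> `|g + 1| < r -> g = -1.
  move=> xg gr; rewrite -[g]opprK; congr (- _); apply: (free x).
    exact: stabN.
  by rewrite -opprD normrN.
pose F n := [set x | exists2 g, act x g = x & [/\ SL2 g,
  forall i j, `|g i j| <= n%:R, r <= `|g - 1| & r <= `|g + 1|] ].
have cF n : closed (F n).
  rewrite -[F n]setCK; apply: open_closedC; rewrite openE => x Fx.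
  have /compact_near_coveringP cov := @compact_shell n%:R r r.
  have : \forall y \near nbhs x, [set g : 'M[R]_2 |
      [/\ SL2 g, forall i j, `|g i j| <= n%:R, r <= `|g - 1| & r <= `|g + 1|] ] `<=`
      (fun g => SL2 g -> act y g <> y).
    apply: cov => g hg; have [sg _ _ _] := hg.
    have gx : act x g <> x by move=> gx; apply: Fx; exists g.
    exact: (near_sym (near_moved sg gx)).
  by apply: filterS => y hy [g gy hg]; apply: (hy g) => //; case: hg.
have UF : \bigcup_n F n = setT.
  apply/seteqP; split => // x _; have [g [xg g1 gN1]] := stab_nontrivial x.
  have [sg gx] := xg.
  exists (Num.truncn `|g|).+1 => //; exists g => //; split => //.
  - by move=> i j; rewrite (le_trans (entry_le_norm _ _ _))// ltW// truncnS_gt.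
  - by rewrite leNgt; apply/negP => /(free _ _ xg).
  - by rewrite leNgt; apply/negP => /(freeN _ _ xg).
have [n [y0 Fy0]] := baire_compact x0 cF UF.
have /compact_near_coveringP cov := Xcompact.
have : \forall N \near +oo, [set: X] `<=` [set x | exists g,
    [/\ stab x g, forall i j, `|g i j| <= N, g <> 1 & g <> -1] ].
  apply: cov => x _.
  have [z [Fz [h sh hz]]] := act_dense x (ex_intro _ y0 Fy0) (@open_interior _ (F n)).
  have near_h : nbhs x [set y | F n (act y h)].
    have nz : nbhs (act x h) (F n) by rewrite hz; exact: Fz.
    have [[A B] [/= xA hB] AB] := act_cont sh nz.
    apply: filterS xA => y Ay; apply: (AB (y, h)) => //; split => //=.
    exact: nbhs_singleton hB.
  pose M : R := 4 * (`|h| * n%:R * `|adj2 h|).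
  have hM : \forall y \near nbhs x & N \near +oo, M <= N.
    by apply: near_pair2; apply: nbhs_pinfty_ge; exact: num_real.
  apply: filterS2 (near_pair1 near_h) hM => -[y N]/= [g gy [sg gn g1 gN1]] MN.
  exists (h * g * adj2 h); split.
  - exact: stab_conj.
  - by move=> i j; exact: le_trans (entries_conj h gn i j) MN.
  - move=> /(conj_eq sh) e; move: g1; rewrite e ?mulr1 ?mul1r// subrr normr0; lra.
  - move=> /(conj_eq sh) e; move: gN1.
    by rewrite e ?mulrN1 ?mulN1r// addNr normr0; lra.
move=> h; have [N hN] := filter_ex h.
by exists N => x; exact: hN.
Qed.

(** The elements of size at most [N] that are away from 1 and -1 form a compact
    set, and the elements close to a hyperbolic one have a trace bounded away
    from 2. *)
Lemma trace_gap (N : R) : exists2 d : R, 0 < d & forall x g, stab x g ->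
  (forall i j, `|g i j| <= N) -> g <> 1 -> g <> -1 -> 2 + d <= `|g 0 0 + g 1 1|.
Proof.
have [r r0 free] := uniformly_free.
have freeN x g : stab x g -> `|g + 1| < r -> g = -1.
  move=> xg gr; rewrite -[g]opprK; congr (- _); apply: (free x).
    exact: stabN.
  by rewrite -opprD normrN.
pose K := [set g : 'M[R]_2 |
  [/\ SL2 g, forall i j, `|g i j| <= N, r <= `|g - 1| & r <= `|g + 1|] ].
have /compact_near_coveringP covX := Xcompact.
have /compact_near_coveringP covK := @compact_shell N r r.
have : \forall d \near (0:R)^'+, [set: X] `<=` [set x | K `<=` [set g |
    stab x g -> 2 + d <= `|g 0 0 + g 1 1| ] ].
  apply: covX => x _.
  have : \forall p \near filter_prod (nbhs x) (0:R)^'+, K `<=` [set g |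
      stab p.1 g -> 2 + p.2 <= `|g 0 0 + g 1 1| ].
    apply: covK => g [sg gN g1 gN1].
    have [gx|gx] := pselect (act x g = x); last first.
      have [[A B] [/= xA gB] AB] := near_moved sg gx.
      exists (B, [set p | A p.1]); first by split => //; exact: near_pair1.
      move=> [h [y d]] [/= Bh Ay] [sh yh]; have := AB (y, h).
      by move=> /(_ (conj Ay Bh) sh).
    have t2 : 2 < `|g 0 0 + g 1 1|.
      apply: (@hyperbolic x) => //.
        by move=> e; move: g1; rewrite e subrr normr0; lra.
      by move=> e; move: gN1; rewrite e addNr normr0; lra.
    pose m := (2 + `|g 0 0 + g 1 1|) / 2.
    have cg : nbhs (g : 'M[R]_2) [set h : 'M[R]_2 | m < `|h 0 0 + h 1 1| ].
      apply: (@cvgr_gt _ _ (nbhs (g : 'M[R]_2)) _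
        (fun h : 'M[R]_2 => `|h 0 0 + h 1 1|) `|g 0 0 + g 1 1|) => //; last first.
        by rewrite /m; lra.
      apply: (@cvg_norm _ _ _ (nbhs (g : 'M[R]_2))).
      apply: (@cvgD _ _ _ (nbhs (g : 'M[R]_2))); exact: coord_continuous.
    have cd : \forall d \near (0:R)^'+, d <= m - 2.
      by apply: nbhs_right_le; rewrite /m; lra.
    exists ([set h : 'M[R]_2 | m < `|h 0 0 + h 1 1| ], [set p | p.2 <= m - 2]).
      by split; [exact: cg|exact: (@near_pair2 X R (nbhs x) (0:R)^'+ _ _ _ cd)].
    by move=> [h [y d]] [/= hm dm] _; lra.
  by apply: filterS => -[y d].
move=> h; have p0 : \forall d \near (0:R)^'+, 0 < d by exact: nbhs_right_gt.
have [d [d0 hd]] := filter_ex (filterI p0 h).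
exists d => // x g xg gN g1 gN1; have [sg _] := xg; have := hd x I g; apply => //.
by split => //; rewrite leNgt; apply/negP; [move/(free _ _ xg)|move/(freeN _ _ xg)].
Qed.

(** Every point of [X] is at bounded distance from a closed geodesic of bounded
    length. *)
Definition bounded_hyperbolic (N d : R) := forall x, exists g,
  [/\ stab x g, forall i j, `|g i j| <= N & 2 + d <= `|g 0 0 + g 1 1| ].

Lemma bounded_hyperbolicP (x0 : X) :
  exists N d : R, 0 < d /\ bounded_hyperbolic N d.
Proof.
have [N hN] := uniformly_nontrivial x0; have [d d0 hd] := trace_gap N.
exists N, d; split => // x; have [g [xg gN g1 gN1]] := hN x.
by exists g; split => //; exact: hd xg gN g1 gN1.
Qed.

Section BoundedHyperbolic.
Context (N d : R) (d0 : 0 < d) (bhyp : bounded_hyperbolic N d).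

Lemma bound_ge0 (x0 : X) : 0 <= N.
Proof. by have [g [_ gN _]] := bhyp x0; exact: le_trans (gN 0 0). Qed.

Lemma expanding_stab x : exists g,
  [/\ stab x g, forall i j, `|g i j| <= N & 1 + d / 2 <= `|g 0 0| ].
Proof.
have d0' := d0; have [g [xg gN tr]] := bhyp x.
have [h|h] := leP (1 + d / 2) `|g 0 0|; first by exists g.
exists (adj2 g); split; first exact: stab_adj.
  by elim/ord2P; elim/ord2P; rewrite /adj2 mx2E ?normrN gN.
by rewrite mx2E; have := ler_normD (g 0 0) (g 1 1); lra.
Qed.

(** If the stabilizer is triangular, a suitable conjugation gives a point whose
    stabilizer is triangular too, and contains an element with an off-diagonal
    entry much larger than the difference of its eigenvalues. It also contains
    a bounded hyperbolic element, which cannot commute with the first one; but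
    their commutator is parabolic. *)
Lemma stab_not_triangular x : exists2 g, stab x g & g 1 0 != 0.
Proof.
have d0' := d0; apply: contrapT => tri.
have {}tri g : stab x g -> g 1 0 = 0.
  by move=> xg; apply/eqP/negPn/negP => g10; apply: tri; exists g.
have [g [xg gN tr]] := bhyp x.
have g10 := tri g xg; have [sg _] := xg.
have dg : g 0 0 * g 1 1 = 1 by have := (SL2P g).1 sg; rewrite g10 mulr0 subr0.
pose D := g 0 0 - g 1 1.
have trgap (a a' : R) : 2 + d <= `|a + a'| -> a * a' = 1 -> 4 * d <= (a - a') ^+ 2.
  move=> h aa; have : (2 + d) ^+ 2 <= `|a + a'| ^+ 2 by rewrite ler_pXn2r// nnegrE; lra.
  rewrite real_normK ?num_real// => h'.
  have -> : (a - a') ^+ 2 = (a + a') ^+ 2 - 4 * (a * a') by ring.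
  by rewrite aa; nra.
have D0 : D != 0.
  by apply/eqP => D0; have := trgap _ _ tr dg; rewrite -/D D0 expr0n/=; lra.
have N0 := bound_ge0 x.
pose s := 1 + N ^+ 2 / d.
have s1 : 1 <= s by rewrite lerDl divr_ge0 ?sqr_ge0// ltW.
have s0 : s != 0 by rewrite gt_eqF; lra.
(* conjugating by [h], the off-diagonal entry of [g] becomes large compared
   with the difference [D] of its eigenvalues *)
pose h := Um (1 - g 0 1 / D) * Am s^-1.
have sh : SL2 h by apply: SL2M => //; apply: SL2_Am; rewrite invr_eq0.
have hE : h = mx2 s^-1 ((1 - g 0 1 / D) * s) 0 s.
  by rewrite /h /Um /Am invrK mx2M; congr mx2; ring.
have g1E : adj2 h * g * h = mx2 (g 0 0) (D * s ^+ 2) 0 (g 1 1).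
  rewrite hE [X in _ * X * _](mx2_eta g) g10 /adj2 !mx2E !mx2M; congr mx2; rewrite /D in D0 *; field => //;
    by rewrite ?D0 ?s0.
have yg1 := stab_conjV sh xg; set y := act x h in yg1 *; rewrite g1E in yg1.
have triy k : stab y k -> k 1 0 = 0.
  move=> /(stab_conj sh)/tri; rewrite hE [X in _ * X * _](mx2_eta k) /adj2 !mx2E !mx2M mx2E.
  rewrite oppr0 !(mul0r, mulr0, add0r, addr0) => /eqP.
  by rewrite !mulf_eq0 (negbTE s0) orbF/= => /eqP.
have [k [yk kN trk]] := bhyp y.
have k10 := triy k yk; have [sk _] := yk.
have dk : k 0 0 * k 1 1 = 1 by have := (SL2P k).1 sk; rewrite k10 mulr0 subr0.
set g1 := mx2 _ _ _ _ in yg1; have [sg1 _] := yg1.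
have comm : g1 * k * (adj2 g1 * adj2 k) = 1.
  apply: (@no_parabolic y).
    by do 2 apply: stabM => //; apply: stab_adj.
  rewrite (mx2_eta k) k10 /adj2 /g1 !mx2E !mx2M !mx2E.
  rewrite !(mul0r, mulr0, add0r, addr0, oppr0).
  have -> : g 0 0 * k 0 0 * (g 1 1 * k 1 1) = (g 0 0 * g 1 1) * (k 0 0 * k 1 1) by ring.
  have -> : g 1 1 * k 1 1 * (g 0 0 * k 0 0) = (g 0 0 * g 1 1) * (k 0 0 * k 1 1) by ring.
  by rewrite dg dk; ring.
have {}comm : g1 * k = k * g1.
  have e : adj2 g1 * adj2 k * (k * g1) = 1.
    by rewrite mulrA -[_ * adj2 k * k]mulrA adj2_mul// mulr1 adj2_mul.
  by rewrite -[LHS]mulr1 -e mulrA comm mul1r.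
have : k 0 1 = s ^+ 2 * (k 0 0 - k 1 1).
  move: comm; rewrite (mx2_eta k) k10 /g1 !mx2M => /matrixP/(_ 0 1).
  rewrite !mx2E => e; apply: (mulIf D0).
  have -> : k 0 1 * D = g 0 0 * k 0 1 + D * s ^+ 2 * k 1 1 - k 0 1 * g 1 1
    - D * s ^+ 2 * k 1 1 by rewrite /D; ring.
  by rewrite e; ring.
move=> k01; have := kN 0 1; rewrite k01 normrM => bnd.
have : (`|s ^+ 2| * `|k 0 0 - k 1 1|) ^+ 2 <= N ^+ 2.
  by rewrite ler_pXn2r// nnegrE mulr_ge0.
rewrite exprMn !real_normK ?num_real// leNgt => /negP; apply.
have := trgap _ _ trk dk; set E := (k 0 0 - k 1 1) ^+ 2 => hE4.
have sd : s * d = d + N ^+ 2 by rewrite /s mulrDl mul1r divfK// gt_eqF.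
have s2 : s <= s ^+ 2 by rewrite expr2 ler_peMr//; lra.
have s4 : s <= (s ^+ 2) ^+ 2.
  have t1 : 1 <= s ^+ 2 by apply: le_trans s2.
  by apply: le_trans s2 _; move: t1; move: (s ^+ 2) => t t1; nra.
apply: lt_le_trans (_ : s * (4 * d) <= _).
  by have := sqr_ge0 N; nra.
by apply: ler_pM => //; nra.
Qed.

Let cl (x : X) : set X := closure (range (fun w => act x (Um w))).
Definition Uinv (M : set X) := forall y w, M y -> M (act y (Um w)).

Lemma act_near1 (x : X) (g : 'M[R]_2) (W : set X) : SL2 g -> nbhs (act x g) W ->
  \forall y \near nbhs x, W (act y g).
Proof.
move=> sg /(act_cont sg)[[A B] [/= xA gB] AB].
by apply: filterS xA => y Ay; apply: (AB (y, g)) => //; split => //=; exact: nbhs_singleton.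
Qed.

Lemma act_near2 (x : X) (g : 'M[R]_2) (W : set X) : SL2 g -> nbhs (act x g) W ->
  \forall h \near (g : 'M[R]_2), SL2 h -> W (act x h).
Proof.
move=> sg /(act_cont sg)[[A B] [/= xA gB] AB].
by apply: filterS gB => h Bh; apply: (AB (x, h)) => //; split => //=; exact: nbhs_singleton.
Qed.

Lemma closed_act (M : set X) g : SL2 g -> closed M -> closed [set y | M (act y g)].
Proof.
move=> sg cM y cy; apply: cM => W /(act_near1 sg)/cy [z [Mz Wz]].
by exists (act z g).
Qed.

Lemma UmM v w : Um v * Um w = Um (v + w).
Proof. by rewrite /Um mx2M; congr mx2; ring. Qed.

Lemma AmM a b : Am a * Am b = Am (a * b).
Proof. by rewrite /Am mx2M invfM; congr mx2; ring. Qed.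

Lemma closure_Uinv x : Uinv (closure (range (fun w => act x (Um w)))).
Proof.
move=> y w cy W /(act_near1 (SL2_Um w))/cy [_ [[v _ <-] Wv]].
exists (act x (Um (v + w))); split; first by exists (v + w).
by rewrite -UmM -actM.
Qed.

(** An expanding element [g] of bounded size fixes the image of [x] by [Am l].
    Conjugated back to [x], it is the product of a lower unipotent matrix,
    which tends to 1 with [1 / l], of the diagonal matrix with first entry
    [g 0 0], and of an upper unipotent matrix, which moves along the
    horocycle. *)
Lemma geodesic_return x : exists2 a : R, 1 + d / 2 <= `|a| &
  closure (range (fun w => act x (Um w))) (act x (Am a)).
Proof.
have d0' := d0; have N0 := bound_ge0 x.
have /choice[f hf] (n : nat) : exists a : R, [/\ 1 + d / 2 <= `|a|, `|a| <= N &
    exists2 z, `|z| <= N / n.+1%:R &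
      range (fun w => act x (Um w)) (act x (Vm z * Am a))].
  have [l lE] : exists l : R, l = n.+1%:R by exists n.+1%:R.
  have l1 : 1 <= l by rewrite lE ler1n.
  have l0 : l != 0 by rewrite gt_eqF; lra.
  have [g [xg gN ga]] := expanding_stab (act x (Am l)).
  have a0 : g 0 0 != 0 by rewrite -normr_gt0; lra.
  exists (g 0 0); split => //.
  exists (g 1 0 / (g 0 0 * l ^+ 2)).
    rewrite normrM normfV ler_pdivrMr ?normr_gt0 ?mulf_neq0 ?expf_neq0//.
    rewrite normrM normrX [ `|l| ]ger0_norm; last by lra.
    rewrite -lE; apply: le_trans (gN 1 0) _.
    have -> : N / l * (`|g 0 0| * l ^+ 2) = N * (`|g 0 0| * l) by field.
    by rewrite ler_peMr//; nra.
  have [sk xk] := stab_conj (SL2_Am l0) xg.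
  set k := Am l * g * adj2 (Am l) in sk xk.
  pose w := l ^+ 2 * g 0 1 / g 0 0.
  have dg : g 1 1 = (1 + g 0 1 * g 1 0) / g 0 0.
    have [sg _] := xg; have e := (SL2P g).1 sg.
    by apply: (mulIf a0); rewrite divfK//; lra.
  have kE : Vm (g 1 0 / (g 0 0 * l ^+ 2)) * Am (g 0 0) = k * Um (- w).
    rewrite /k [X in Am l * X * _](mx2_eta g) dg /Vm /Am /Um /adj2 !mx2E !mx2M /w.
    congr mx2; field => //; by rewrite ?a0 ?l0.
  exists (- w) => //; rewrite kE -actM// xk //.
have [c [/= hc clc]] : [set t : R | t \in `[- N, N]] `&` cluster (f @ \oo) !=set0.
  apply: (@segment_compact R (- N) N); apply: (@filterE _ \oo) => n /=.
  by rewrite in_itv/= -ler_norml; have [] := hf n.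
have c1 : 1 + d / 2 <= `|c|.
  rewrite leNgt; apply/negP => h.
  have B : nbhs (c : R) (ball (c : R) (1 + d / 2 - `|c|)).
    by apply: nbhsx_ballx; lra.
  have A : (f @ \oo) [set t | 1 + d / 2 <= `|t|].
    by apply: (@filterE _ \oo) => n; have [] := hf n.
  have [t [/= t1]] := clc _ _ A B; rewrite -ball_normE/= => t2.
  have := lerB_dist t c; rewrite distrC; lra.
exists c => //; have c0 : c != 0 by rewrite -normr_gt0; lra.
move=> W /(act_near2 (SL2_Am c0)) hW.
have : \forall z \near (0 : R) & a \near (c : R), W (act x (Vm z * Am a)) \/ a = 0.
  have lim : (fun p : R * R => Vm p.1 * Am p.2) @ filter_prod (nbhs (0:R)) (nbhs (c:R))
      --> Vm 0 * Am c.
    apply: cvg_mulmx; apply: cvg_mx2; try exact: cvg_cst; try exact: cvg_fst.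
    - exact: cvg_snd.
    - by apply: cvgV => //; exact: cvg_snd.
  have V0 : Vm 0 * Am c = Am c by rewrite /Vm -mx2_1 mul1r.
  rewrite V0 in lim.
  have hlim : filter_prod (nbhs (0:R)) (nbhs (c:R))
    [set p | SL2 (Vm p.1 * Am p.2) -> W (act x (Vm p.1 * Am p.2))] := lim _ hW.
  apply: filterS hlim => -[z a]/= h.
  have [->|a0] := eqVneq a 0; [by right|left; apply: h].
  by apply: SL2M => //; exact: SL2_Am.
case=> -[A B] [/= A0 Bc] AB.
have hA : \forall n \near \oo, forall z : R, `|z| <= N / n.+1%:R -> A z.
  have /nbhs_ballP[e /= e0 eA] := A0.
  near=> n => z hz; apply: eA; rewrite -ball_normE/= sub0r normrN.
  apply: le_lt_trans hz _; rewrite ltr_pdivrMr// mulrC -ltr_pdivrMr//.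
  apply: lt_trans (truncnS_gt _) _; rewrite ltr_nat ltnS.
  by near: n; exact: nbhs_infty_gt.
have [t [[n hn <-] Bt]] : [set f n | n in [set n |
    forall z : R, `|z| <= N / n.+1%:R -> A z]] `&` B !=set0.
  apply: clc Bc; apply: filterS hA => n /= hn; by exists n.
have [f1 fN [z zN [w _ hw]]] := hf n.
exists (act x (Vm z * Am (f n))); split; first by exists w.
have [//|f0] : W (act x (Vm z * Am (f n))) \/ f n = 0.
  by apply: (AB (z, f n)); split => //=; exact: hn.
by move: f1; rewrite f0 normr0; lra.
Unshelve. all: by end_near. Qed.

(** Zorn's lemma, applied to the complements of the invariant closed sets;
    compactness keeps the intersection of a chain nonempty. *)
Lemma minimal_Uinv (C : set X) : closed C -> C !=set0 -> Uinv C ->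
  exists M, [/\ closed M, M !=set0, Uinv M, M `<=` C & forall M',
    closed M' -> M' !=set0 -> Uinv M' -> M' `<=` M -> M `<=` M'].
Proof.
move=> clC C0 UC.
have cC : compact C by apply: (subclosed_compact clC Xcompact).
pose P (V : set X) := [/\ open V, ~` V `&` C !=set0 & Uinv (~` V)].
have [] := @Zorn_bigcup _ P.
  move=> F FP Ftot; split.
  - by apply: bigcup_open => V /FP[].
  - apply: contrapT => no.
    have Ccov : C `<=` \bigcup_(V in F) V.
      by move=> y Cy; apply: contrapT => nF; apply: no; exists y.
    have [V0 FV0] : F !=set0.
      by have [y /Ccov[V FV _]] := C0; exists V.
    pose G := filter_from F (fun V => [set W | F W /\ V `<=` W]).
    have FG : ProperFilter G.
      apply: filter_from_proper; last by move=> V FV; exists V; split.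
      apply: filter_from_filter; first by exists V0.
      move=> V W FV FW; have [VW|WV] := Ftot V W FV FW.
        by exists W => // Z [FZ WZ]; split; split => //; apply: subset_trans WZ.
      by exists V => // Z [FZ VZ]; split; split => //; apply: subset_trans VZ.
    have /compact_near_coveringP cov := cC.
    have : \forall W \near G, C `<=` [set y | W y].
      apply: cov => y /Ccov[V FV Vy]; have [oV _ _] := FP V FV.
      exists (V, [set W | F W /\ V `<=` W]).
        by split; [exact: open_nbhs_nbhs | exists V].
      by move=> [z W] [/= Vz [_ VW]]; exact: VW.
    have hF : G F by exists V0 => // W [].
    move=> h; have [W [FW CW]] := filter_ex (filterI hF h).
    by have [_ [y [Wy Cy]] _] := FP W FW; apply: Wy; exact: CW.
  - move=> y w ny [V FV Vyw]; have [_ _ UV] := FP V FV.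
    by apply: (UV y w) Vyw => Vy; apply: ny; exists V.
move=> V [[oV V0 UV] Vmax].
exists (~` V `&` C); split => //.
- by apply: closedI => //; exact: open_closedC.
- by move=> y w [Vy Cy]; split; [exact: UV|exact: UC].
move=> M' cM' M0 UM' M'V.
have VM' : V `<=` ~` M' by move=> y Vy /M'V[].
apply: contrapT => no; apply: (Vmax (~` M')).
  split => //; move=> M'V'; apply: no => y [Vy Cy].
  by apply: contrapT => nM; apply: Vy; exact: M'V'.
split; rewrite ?setCK//; first exact: closed_openC.
by have [y M'y] := M0; exists y; split => //; have [] := M'V y M'y.
Qed.

Section Minimal.
Context (M : set X) (cM : closed M) (M0 : M !=set0) (UM : Uinv M)
  (Mmin : forall M', closed M' -> M' !=set0 -> Uinv M' -> M' `<=` M -> M `<=` M').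

(** The diagonal group normalizes the unipotent group, so that the points of
    [M] sent to [M] by [Am a] form an invariant closed subset. *)
Lemma minimal_Am a x : a != 0 -> M x -> M (act x (Am a)) ->
  forall y, M y -> M (act y (Am a)).
Proof.
move=> a0 Mx Mxa; pose M' := M `&` [set y | M (act y (Am a))].
suff MM' : M `<=` M' by move=> y /MM'[].
apply: Mmin; last by move=> y [].
- by apply: closedI => //; apply: closed_act => //; exact: SL2_Am.
- by exists x.
- move=> y w [My Mya]; split; rewrite /=; first exact: UM.
  have -> : act (act y (Um w)) (Am a) = act (act y (Am a)) (Um (w / a ^+ 2)).
    rewrite !actM//; try exact: SL2_Am; congr act.
    by rewrite /Um /Am !mx2M; congr mx2; field.
  exact: UM.
Qed.

Lemma minimal_AmV a : a != 0 -> (forall y, M y -> M (act y (Am a))) ->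
  forall y, M y -> M (act y (Am a^-1)).
Proof.
move=> a0 Ma; have [x Mx] := M0.
apply: (@minimal_Am _ (act x (Am a))); rewrite ?invr_eq0//; first exact: Ma.
rewrite actM ?AmM ?divff//; try (apply: SL2_Am; rewrite ?invr_eq0//).
by rewrite /Am invr1 -mx2_1 act1.
Qed.

Lemma minimal_AmX a n : a != 0 -> (forall y, M y -> M (act y (Am a))) ->
  forall y, M y -> M (act y (Am (a ^+ n))).
Proof.
move=> a0 Ma y My; elim: n => [|n IH].
  by rewrite expr0 /Am invr1 -mx2_1 act1.
rewrite exprSr -AmM -actM; first exact: Ma.
  by apply: SL2_Am; rewrite expf_neq0.
exact: SL2_Am.
Qed.

(** The inverse of the matrix given by [geodesic_return] also preserves [M], by
    minimality. *)
Lemma minimal_contraction : exists s : R,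
  [/\ s != 0, `|s| < 1 & forall y, M y -> M (act y (Am s))].
Proof.
have d0' := d0; have [x Mx] := M0; have [a a1 hx] := geodesic_return x.
have a0 : a != 0 by rewrite -normr_gt0; lra.
exists a^-1; split; first by rewrite invr_eq0.
  by rewrite normfV invf_lt1 ?normr_gt0//; lra.
apply: minimal_AmV => //; apply: (@minimal_Am _ x) => //.
move: hx; rewrite -[X in _ -> X]/(M (act x (Am a))).
suff : closure (range (fun w => act x (Um w))) `<=` M by apply.
rewrite [X in _ `<=` X](closure_id M).1//; apply: closure_subset.
by move=> _ [w _ <-]; exact: UM.
Qed.

(** If [g] fixes [x], then [x] and [x * V * A] lie in [M], with [V] lower
   unipotent; the diagonal elements that preserve [M] contract [V]. *)
Lemma minimal_stab_Am x g : M x -> stab x g -> g 0 0 != 0 ->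
  forall y, M y -> M (act y (Am (g 0 0))).
Proof.
move=> Mx [sg xg] a0; set a := g 0 0 in a0 *.
have [s [s0 s1 Ms]] := minimal_contraction.
pose z := g 1 0 / a.
have dg : g 1 1 = (1 + g 0 1 * g 1 0) / a.
  have e := (SL2P g).1 sg.
  by apply: (mulIf a0); rewrite divfK// mulrC -e /a; ring.
have VA : M (act x (Vm z * Am a)).
  have -> : Vm z * Am a = g * Um (- (g 0 1 / a)).
    rewrite [X in _ = X * _](mx2_eta g) dg /Vm /Am /Um /z !mx2M -/a.
    by congr mx2; field.
  by rewrite -actM// xg; exact: UM.
pose u n := act x (Am (s ^+ n)).
have sn0 n : s ^+ n != 0 by rewrite expf_neq0.
have uM n : M (u n) by exact: minimal_AmX.
have uV n : M (act (u n) (Vm (s ^+ n ^+ 2 * z) * Am a)).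
  rewrite /u actM; [|exact: SL2_Am|by apply: SL2M => //; exact: SL2_Am].
  have -> : Am (s ^+ n) * (Vm (s ^+ n ^+ 2 * z) * Am a) = Vm z * Am a * Am (s ^+ n).
    by rewrite /Am /Vm !mx2M; congr mx2; field; rewrite ?a0 ?sn0.
  rewrite -actM//; [exact: minimal_AmX| |exact: SL2_Am].
  by apply: SL2M => //; exact: SL2_Am.
have [y [My cly]] : M `&` cluster (u @ \oo) !=set0.
  apply: (subclosed_compact cM Xcompact) => //.
  by apply: (@filterE _ \oo).
apply: (@minimal_Am _ y) => //; apply: cM => W /(act_cont (SL2_Am a0)).
case=> -[A B] [/= Ay BA] AB.
have lim : (fun n => Vm (s ^+ n ^+ 2 * z) * Am a) @ \oo --> Am a.
  have V0a : Vm 0 * Am a = Am a by rewrite /Vm -mx2_1 mul1r.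
  rewrite -[X in _ --> X]V0a.
  apply: cvg_mulmx; last exact: cvg_cst.
  apply: cvg_mx2; try exact: cvg_cst.
  rewrite -[X in _ --> X](mul0r z); apply: cvgM; last exact: cvg_cst.
  rewrite -[X in _ --> X](mul0r 0); under eq_fun do rewrite expr2.
  by apply: cvgM; exact: cvg_expr.
have [t [[n hn <-] At]] : [set u n | n in [set n | B (Vm (s ^+ n ^+ 2 * z) * Am a)]]
    `&` A !=set0.
  have hlim : \oo [set n | B (Vm (s ^+ n ^+ 2 * z) * Am a)] := lim _ BA.
  have hu : \oo [set n | [set u n | n in [set n | B (Vm (s ^+ n ^+ 2 * z) * Am a)]] (u n)].
    by apply: filterS hlim => n /= hn; exists n.
  exact: (cly _ _ hu Ay).
exists (act (u n) (Vm (s ^+ n ^+ 2 * z) * Am a)); split; first exact: uV.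
by apply: (AB (u n, _)) => //=; apply: SL2M => //; exact: SL2_Am.
Qed.

(** Replacing [x] by its image by [Um w] changes the entry [g 0 0] of an
    element [g] of the stabilizer into [g 0 0 - w * g 1 0], which takes every
    value. *)
Lemma minimal_diagonal a y : a != 0 -> M y -> M (act y (Am a)).
Proof.
move=> a0; have [x Mx] := M0; have [g xg c0] := stab_not_triangular x.
pose w := (g 0 0 - a) / g 1 0.
have xwg := stab_conjV (SL2_Um w) xg.
have e : (adj2 (Um w) * g * Um w) 0 0 = a.
  rewrite [X in _ * X * _](mx2_eta g) /adj2 /Um !mx2E !mx2M mx2E /w; field.
  exact: c0.
have := minimal_stab_Am (UM w Mx) xwg; rewrite e => h.
by apply: h.
Qed.

End Minimal.

(** A closed set that is invariant under the upper triangular group is given,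
    in the orbit of [y], by a closed subset [P] of the projective line that is
    invariant under the stabilizer of [y]. If [P] misses the point at infinity,
    it is a compact subset of the real line, with extremities [p] and [q]. Far
    out on the geodesic of [y], a bounded hyperbolic element of the stabilizer
    must preserve the contracted [P], which is close to the origin, while
    expanding it, which is impossible. *)
Lemma triangular_invariant_full (M : set X) : closed M -> M !=set0 ->
  (forall y w, M y -> M (act y (Um w))) ->
  (forall y a, a != 0 -> M y -> M (act y (Am a))) -> M = setT.
Proof.
move=> cM [x Mx] UM AM; have d0' := d0; have N0 := bound_ge0 x.
have [all|/existsNP[h0 /not_implyP[sh0 nMy]]] :=
    pselect (forall h, SL2 h -> M (act x h)).
  apply/seteqP; split => // z _; apply: cM => W nW.
  have [|t [Wt [h sh ht]]] := act_dense x (O := W°) _ (@open_interior _ W).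
    by exists z.
  exists t; split; last exact: interior_subset Wt.
  by rewrite -ht; exact: all.
have [y yE] : exists y, y = act x h0 by eexists.
rewrite -yE in nMy.
pose nm (r : R) : 'M[R]_2 := mx2 r (-1) 1 0.
have snm r : SL2 (nm r) by apply/SL2_mx2; ring.
pose P := [set r | M (act y (nm r))].
have AV a z : a != 0 -> M (act z (Am a)) -> M z.
  move=> a0 /(AM _ a^-1); rewrite invr_eq0 a0 actM ?AmM ?divff//; last 2 first.
    exact: SL2_Am.
    by apply: SL2_Am; rewrite invr_eq0.
  by rewrite {1}/Am invr1 -mx2_1 act1; apply.
have UV z w : M (act z (Um w)) -> M z.
  by move=> /(UM _ (- w)); rewrite actM ?UmM ?subrr// /Um -mx2_1 act1.
have col h : SL2 h -> M (act y h) -> h 1 0 != 0 /\ P (h 0 0 / h 1 0).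
  move=> sh My; have dh := (SL2P h).1 sh.
  have [c0|c0] := eqVneq (h 1 0) 0.
    have dd : h 0 0 * h 1 1 = 1 by move: dh; rewrite c0 mulr0 subr0.
    have h00 : h 0 0 != 0.
      by apply/eqP => e; move: dd; rewrite e mul0r => /eqP; rewrite eq_sym oner_eq0.
    exfalso; apply: nMy; apply: (AV (h 0 0)) => //; apply: (UV _ (h 0 1 / h 0 0)).
    rewrite !actM//; try exact: SL2_Am; try (apply: SL2M => //; exact: SL2_Am).
    rewrite (_ : _ * _ = h)//; rewrite [RHS]mx2_eta c0 /Am /Um mx2M.
    have -> : h 1 1 = (h 0 0)^-1 by apply: (mulfI h00); rewrite dd divff.
    by congr mx2; field.
  split => //; rewrite /P/=.
  apply: (AV (h 1 0)) => //; apply: (UV _ (h 1 1 / h 1 0)).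
  rewrite !actM//; try exact: SL2_Am; try (apply: SL2M => //; exact: SL2_Am).
  rewrite (_ : _ * _ = h)//; rewrite [RHS]mx2_eta /Am /Um /nm !mx2M.
  have -> : h 0 1 = (h 0 0 * h 1 1 - 1) / h 1 0.
    by apply: (mulIf c0); rewrite divfK// -dh; ring.
  by congr mx2; field.
have P0 : P !=set0.
  have [|_ Pr] := col (adj2 h0) (SL2_adj sh0).
    by rewrite yE actM ?mul_adj2 ?act1//; exact: SL2_adj.
  by eexists; exact: Pr.
have [B B0 hB] : exists2 B : R, 0 < B & forall r, P r -> `|r| <= B.
  have V1 : SL2 (1 : 'M[R]_2) := SL2_1.
  have nW : nbhs (act y 1) (~` M).
    by rewrite act1; apply: open_nbhs_nbhs; split => //; exact: closed_openC.
  have := act_near2 V1 nW => hn.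
  have lim : (fun z : R => Vm z) @ nbhs (0:R) --> (1 : 'M[R]_2).
    by rewrite mx2_1; apply: cvg_mx2; try exact: cvg_cst; exact: cvg_id.
  have /nbhs_ballP[e /= e0 eV] := lim _ hn.
  exists e^-1; first by rewrite invr_gt0.
  move=> r Pr; rewrite leNgt; apply/negP => er.
  have r0 : r != 0 by rewrite -normr_gt0; apply: lt_trans er; rewrite invr_gt0.
  have := eV r^-1; rewrite -ball_normE/= sub0r normrN normfV.
  rewrite invf_plt ?posrE ?normr_gt0// => /(_ er (SL2_Vm _)); apply.
  apply: (AV r) => //; apply: (UV _ (- r^-1)).
  rewrite !actM//; try exact: SL2_Am; try (apply: SL2M => //; exact: SL2_Am).
  rewrite (_ : _ * _ = nm r)// /Am /Um /Vm /nm !mx2M; congr mx2; field => //.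
have inv g r : stab y g -> P r -> P ((g 0 0 * r + g 0 1) / (g 1 0 * r + g 1 1)) /\
    g 1 0 * r + g 1 1 != 0.
  move=> [sg yg] Pr; have [] := col (g * nm r).
  - exact: SL2M.
  - by rewrite -actM// yg.
  - by rewrite [X in X * _](mx2_eta g) /nm mx2M !mx2E !mulr1.
have cP : compact P.
  apply: (@subclosed_compact _ _ `[- B, B]%classic).
  - move=> r cr; rewrite /P /=; apply: cM => W /(act_near2 (snm r)) hW.
    have lim : (fun t : R => nm t) @ nbhs (r:R) --> nm r.
      by apply: cvg_mx2; try exact: cvg_cst; exact: cvg_id.
    have [t [Pt Wt]] := cr _ (lim _ hW).
    by exists (act y (nm t)); split => //; exact: Wt.
  - exact: segment_compact.
  - by move=> r /hB; rewrite /= in_itv/= ler_norml.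
have idc : {within P, continuous (fun t : R => t)}.
  by apply: continuous_subspaceT => t; exact: cvg_id.
have [q Pq maxq] := compact_EVT_max P0 cP idc.
have idcN : {within P, continuous (fun t : R => - t)}.
  by apply: continuous_subspaceT => t; apply: cvgN; exact: cvg_id.
have [p Pp minp] := compact_EVT_max P0 cP idcN.
have {}minp t : P t -> p <= t by move=> Pt; rewrite -lerN2; apply: minp; exact: mem_set.
have {}maxq t : P t -> t <= q by move=> Pt; apply: maxq; exact: mem_set.
have {}Pp : P p by exact: set_mem.
have {}Pq : P q by exact: set_mem.
have pq : p < q.
  rewrite lt_neqAle minp// andbT; apply/eqP => epq.
  have [g yg g10] := stab_not_triangular (act y (nm p)).
  have := stab_conj (snm p) yg => ygc.
  have [Pg gp] := inv _ _ ygc Pp.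
  move: Pg gp; rewrite [X in nm p * X * _](mx2_eta g) /nm /adj2 !mx2E !mx2M !mx2E.
  set n := (X in P (X / _)); set m := (X in P (_ / X)) => Pg m0.
  have mxn := maxq _ Pg; rewrite -epq in mxn.
  have e : n / m = p by apply/eqP; rewrite eq_le mxn minp.
  have {}e : n = p * m by rewrite -e divfK.
  by move/eqP: g10; apply; move: e; rewrite /n /m; lra.
(* the constant [C] bounds the matrix entry [b] below, and [l] is the length
   of the contraction *)
pose C := B * (N * B + N) + N * B.
have C0 : 0 <= C by rewrite /C; nra.
pose K := 1 + (N * C + N * B) * (2 / d + 1).
have K1 : 1 <= K.
  rewrite lerDl; apply: mulr_ge0.
    by apply: addr_ge0; apply: mulr_ge0 => //; exact: ltW.
  by apply: addr_ge0 => //; apply: divr_ge0 => //; exact: ltW.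
have [l l1 lK] : exists2 l : R, 1 <= l & K < l ^+ 2 by exists (K + 1); [lra | rewrite expr2; nra].
have l0 : l != 0 by rewrite gt_eqF; lra.
have [g [yg gN ga]] := expanding_stab (act y (Am l)).
have dg : g 0 0 * g 1 1 = 1 + g 0 1 * g 1 0.
  by have [sg _] := yg; have := (SL2P g).1 sg; lra.
have := stab_conj (SL2_Am l0) yg.
pose L := l ^+ 2.
have L0 : 0 < L by rewrite exprn_gt0//; lra.
have -> : Am l * g * adj2 (Am l) = mx2 (g 0 0) (L * g 0 1) (g 1 0 / L) (g 1 1).
  rewrite [X in Am l * X * _](mx2_eta g) /Am /adj2 !mx2E !mx2M /L.
  by congr mx2; field.
move=> yk; have [] := (inv _ _ yk Pp, inv _ _ yk Pq); rewrite !mx2E.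
have := (gN 0 0, gN 0 1, gN 1 0, gN 1 1).
move=> [[[aN bN] cN] eN] [Pp' dp0] [Pq' dq0].
exfalso; apply: (@no_expansion _ (g 0 0) (g 0 1) (g 1 0) (g 1 1) L d N B p q dg ga d0
  aN bN cN eN N0 (ltW B0) _ lK pq (hB _ Pp) (hB _ Pq) dp0 dq0
  (minp _ Pp') (maxq _ Pp') (minp _ Pq') (maxq _ Pq')).
by rewrite /L exprn_ege1.
Qed.

End BoundedHyperbolic.

Theorem horocycles_dense x : dense (range (fun w => act x (Um w))).
Proof.
have [N [d [d0 bhyp]]] := bounded_hyperbolicP x.
set C := closure (range (fun w => act x (Um w))).
have [M [cM M0 UM MC Mmin]] := @minimal_Uinv C (@closed_closure _ _)
  (ex_intro _ (act x (Um 0)) (@subset_closure _ _ _ (imageT _ 0)))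
  (@closure_Uinv x).
have MT : M = setT.
  apply: (triangular_invariant_full d0 bhyp cM M0) => [y w|y a a0]; first exact: UM.
  exact: (minimal_diagonal d0 bhyp cM M0 UM Mmin).
move=> W [z Wz] oW.
have [t [Ut Wt]] : range (fun w => act x (Um w)) `&` W !=set0.
  by have : C z by [apply: MC; rewrite MT]; apply; exact: open_nbhs_nbhs.
by exists t.
Qed.

End Dynamics.

(** * Second derivatives and induction on an interval *)

Section Calculus.
Context {R : realType}.

Lemma is_derive_line (V W : normedModType R) (f : V -> W) (z e : V) (s : R) :
  derivable f (z + s *: e) e ->
  is_derive s (1 : R) (fun t : R => f (z + t *: e)) ('D_e f (z + s *: e)).
Proof.
move=> df.
have E : (fun h : R => h^-1 *: (f (z + (h *: (1 : R) + s) *: e) - f (z + s *: e)))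
    = (fun h : R => h^-1 *: (f (h *: e + (z + s *: e)) - f (z + s *: e))).
  apply/funext => h; congr (_ *: (f _ - _)).
  by rewrite scalerDl /GRing.scale/= mulr1 addrCA.
apply: DeriveDef; first by rewrite /derivable /= E.
by rewrite /derive /= E.
Qed.

Lemma derive_translate (V W : normedModType R) (f : V -> W) (a c u : V) :
  'D_u (fun x => f (x + c)) a = 'D_u f (a + c).
Proof.
have E : (fun h : R => h^-1 *: (f (h *: u + a + c) - f (a + c)))
    = (fun h : R => h^-1 *: (f (h *: u + (a + c)) - f (a + c))).
  by apply/funext => h; rewrite addrA.
by rewrite /derive /= E.
Qed.

Lemma increment_line (V : normedModType R) (f : V -> R) (z e : V) (h : R) :
  0 < h -> (forall s, s \in `[0, h] -> differentiable f (z + s *: e)) ->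
  exists2 s, s \in `]0, h[ & f (z + h *: e) - f z = 'D_e f (z + s *: e) * h.
Proof.
move=> h0 df.
have [||s sh E] := @MVT R (fun t : R => f (z + t *: e)) (fun s => 'D_e f (z + s *: e))
  0 h h0; last first.
- by exists s; rewrite // -[h in RHS](subr0 h) -E scale0r addr0.
- apply: derivable_within_continuous => s sh.
  have D : derivable f (z + s *: e) e by apply: diff_derivable; exact: df.
  by have [] := is_derive_line D.
- move=> s /subset_itv_oo_cc sh; apply: is_derive_line; apply: diff_derivable; exact: df.
Qed.

(** By the mean value theorem in the direction [u], the second difference is an
    increment of the derivative along [u], to which the differentiability at
    [z] applies. *)
Lemma second_difference (V : normedModType R) (f : V -> R) (z u v : V) :
  (\forall z' \near z, differentiable f z') -> differentiable ('D_u f) z ->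
  forall eps, 0 < eps -> \forall h \near (0 : R)^'+,
    `|f (z + h *: v + h *: u) - f (z + h *: v) - (f (z + h *: u) - f z)
      - h ^+ 2 * 'D_v ('D_u f) z| <= eps * h ^+ 2.
Proof.
move=> df dg eps eps0; set g := 'D_u f.
pose N := `|u| + `|v| + 1; have N0 : 0 < N by rewrite ltr_wpDl// addr_ge0.
have /eqaddoP gE := diff_locally dg.
have [d1 /= d10 hd1] := (nbhs_ballP _ _).1 df.
have e0 : 0 < eps / (2 * N) by rewrite divr_gt0// mulr_gt0.
have [d2 /= d20 hd2] := (nbhs_ballP _ _).1 (gE _ e0).
pose d := Num.min d1 d2 / N.
have d0 : 0 < d by rewrite divr_gt0// lt_min d10.
near=> h.
have h0 : 0 < h by near: h; exact: nbhs_right_gt.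
have hd : h < d by near: h; exact: nbhs_right_lt.
have small s b : 0 <= s -> s <= h -> b \in [:: 0; h] ->
    `|s *: u + b *: v| <= h * N /\ `|s *: u + b *: v| < Num.min d1 d2.
  move=> s0 sh bh; suff le : `|s *: u + b *: v| <= h * N.
    split => //; apply: le_lt_trans le _.
    by rewrite -ltr_pdivlMr.
  apply: le_trans (ler_normD _ _) _; rewrite !normrZ (ger0_norm s0).
  have b0 : `|b| <= h.
    by move: bh; rewrite !inE => /orP[]/eqP ->; rewrite ?normr0 ?gtr0_norm// ltW.
  have := ler_wpM2r (normr_ge0 u) sh; have := ler_wpM2r (normr_ge0 v) b0.
  by rewrite /N !mulrDr mulr1; lra.
have dif s b : 0 <= s -> s <= h -> b \in [:: 0; h] ->
    differentiable f (z + (s *: u + b *: v)).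
  move=> s0 sh bh; apply: hd1; rewrite -ball_normE/= opprD addNKr normrN.
  by have [_] := small s b s0 sh bh; rewrite lt_min => /andP[].
have gd s b : 0 <= s -> s <= h -> b \in [:: 0; h] ->
    `|g (z + (s *: u + b *: v)) - (g z + 'd g z (s *: u + b *: v))|
      <= eps / 2 * h.
  move=> s0 sh bh; have [sN] := small s b s0 sh bh.
  rewrite lt_min => /andP[_ s2].
  have := hd2 (s *: u + b *: v); rewrite -ball_normE/= sub0r normrN => /(_ s2).
  rewrite !fctE /= [_ + z]addrC => /le_trans; apply.
  have -> : eps / 2 * h = eps / (2 * N) * (h * N) by field; rewrite gt_eqF.
  by rewrite ler_pM2l.
pose phi (w : V) := f (w + h *: v) - f w.
have dphi s : 0 <= s -> s <= h -> differentiable phi (z + s *: u).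
  move=> s0 sh; apply: differentiableB; last first.
    by have := dif s 0 s0 sh; rewrite scale0r addr0; apply; rewrite !inE eqxx.
  apply: (@differentiable_comp _ _ _ _ (fun w => w + h *: v) f).
    by apply: differentiableD.
  by rewrite -addrA; apply: dif => //; rewrite !inE eqxx orbT.
have [|s shI E] := @increment_line V phi z u h h0.
  by move=> s; rewrite in_itv/= => /andP[? ?]; exact: dphi.
move: shI; rewrite in_itv/= => /andP[/ltW s0 /ltW sh].
have D : 'D_u phi (z + s *: u) = g (z + (s *: u + h *: v)) - g (z + (s *: u + 0 *: v)).
  rewrite /phi deriveB; last 2 first.
  - apply: diff_derivable.
    apply: (@differentiable_comp _ _ _ _ (fun w => w + h *: v) f).
      by apply: differentiableD.
    by rewrite -addrA; apply: dif => //; rewrite !inE eqxx orbT.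
  - apply: diff_derivable.
    by have := dif s 0 s0 sh; rewrite scale0r addr0; apply; rewrite !inE eqxx.
  rewrite scale0r addr0 /g; congr (_ - _).
  by rewrite derive_translate addrA.
have h1 := gd s h s0 sh; have h2 := gd s 0 s0 sh.
move: h1 h2; rewrite !inE !eqxx/= orbT => /(_ isT) h1 /(_ isT) h2.
have -> : f (z + h *: v + h *: u) - f (z + h *: v) - (f (z + h *: u) - f z)
    = phi (z + h *: u) - phi z.
  by rewrite /phi [z + h *: v + h *: u]addrAC; ring.
rewrite E D deriveE//.
have lind : 'd g z (s *: u + h *: v) - 'd g z (s *: u + 0 *: v) = h * 'd g z v.
  by rewrite -linearB/= opprD addrACA subrr add0r scale0r subr0 linearZ.
rewrite expr2.
set A := g (z + (s *: u + h *: v)) in h1 *.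
set B := g (z + (s *: u + 0 *: v)) in h2 *.
have -> : (A - B) * h - h * h * 'd g z v =
  h * ((A - (g z + 'd g z (s *: u + h *: v)))
     - (B - (g z + 'd g z (s *: u + 0 *: v)))).
  rewrite -mulrA -lind; ring.
rewrite normrM gtr0_norm// [leRHS]mulrCA ler_pM2l//.
by apply: le_trans (ler_normB _ _) _; lra.
Unshelve. all: by end_near. Qed.

(** The second difference is symmetric in [u] and [v]. *)
Lemma derive_comm (V : normedModType R) (f : V -> R) (z u v : V) :
  (\forall z' \near z, differentiable f z') ->
  differentiable ('D_u f) z -> differentiable ('D_v f) z ->
  'D_v ('D_u f) z = 'D_u ('D_v f) z.
Proof.
move=> df du dv; apply/eqP; rewrite -subr_eq0 -normr_le0; apply/ler_addgt0Pl => eps eps0.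
rewrite addr0.
have e2 : 0 < eps / 2 by rewrite divr_gt0.
have h1 := second_difference v df du e2; have h2 := second_difference u df dv e2.
have p0 : \forall h \near (0:R)^'+, 0 < h by exact: nbhs_right_gt.
have [h [[h1' h2'] h0]] := filter_ex (filterI (filterI h1 h2) p0).
have hh : 0 < h ^+ 2 by rewrite exprn_gt0.
rewrite -(ler_pM2l hh) -{1}(gtr0_norm hh) -normrM.
move: h2'; rewrite [z + h *: u + _]addrAC => h2'.
move: h1' h2'; move: ('D_v _ z) ('D_u _ z) (f z) (f (_ + _)) (f (_ + _)) (f (_ + _)).
move: (h ^+ 2) => H a b c p q r.
by rewrite !ler_norml => /andP[? ?] /andP[? ?]; apply/andP; split; lra.
Qed.

(** The supremum of the initial segments on which [P] holds satisfies [P] by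
    the second hypothesis, and it is 1 by the third one. *)
Lemma real_induction (P : R -> Prop) : P 0 ->
  (forall s, 0 < s -> s <= 1 -> (forall t, 0 <= t -> t < s -> P t) -> P s) ->
  (forall s, 0 <= s -> s < 1 -> (forall t, 0 <= t -> t <= s -> P t) ->
     \forall t \near s, P t) ->
  forall s, 0 <= s -> s <= 1 -> P s.
Proof.
move=> P0 Plim Popen.
pose A := [set s | 0 <= s <= 1 /\ forall t, 0 <= t -> t <= s -> P t].
have A0 : A 0.
  by split; [rewrite lexx ler01|move=> t ? ?; rewrite (_ : t = 0)//; lra].
have supA : has_sup A.
  by split; [exists 0|exists 1 => s [/andP[]]].
pose S := sup A.
have S0 : 0 <= S by apply: ub_le_sup => //; case: supA.
have S1 : S <= 1 by apply: ge_sup; [exists 0|move=> s [/andP[]]].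
have belowS t : 0 <= t -> t < S -> P t.
  move=> t0 tS; have [] := @sup_adherent _ A (S - t) _ supA; first by rewrite subr_gt0.
  move=> s [_ As]; rewrite -/S subKr => ts.
  by apply: As => //; exact: ltW.
have PS : P S.
  have [e|S0'] := eqVneq S 0; first by rewrite e.
  by apply: Plim => //; rewrite lt_neqAle eq_sym S0'.
have toS t : 0 <= t -> t <= S -> P t.
  by move=> t0; rewrite le_eqVlt => /orP[/eqP->//|]; exact: belowS.
suff S1' : S = 1 by move=> s s0 s1; apply: toS => //; rewrite S1'.
apply/eqP; rewrite eq_le S1/= leNgt; apply/negP => Slt.
have /nbhs_ballP[e /= e0 he] := Popen S S0 Slt toS.
pose s := S + Num.min (e / 2) (1 - S).
have m0 : 0 < Num.min (e / 2) (1 - S) by rewrite lt_min; apply/andP; split; lra.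
have m1 : Num.min (e / 2) (1 - S) <= 1 - S by rewrite ge_min lexx orbT.
have m2 : Num.min (e / 2) (1 - S) <= e / 2 by rewrite ge_min lexx.
have As : A s.
  split; first by rewrite /s; apply/andP; split; lra.
  move=> t t0 ts; have [tS|St] := leP t S; first exact: toS.
  apply: he; rewrite -ball_normE/= ltr_norml; apply/andP.
  by move: ts; rewrite /s => ts; split; lra.
have : s <= S by apply: ub_le_sup => //; case: supA.
by rewrite /s; lra.
Qed.

End Calculus.

(** * Local isometries of the hyperbolic plane and the Koszul formula *)

Notation bv i := (delta_mx (0 : 'I_1) i : 'rV_2).

Section PlaneCalculus.
Context {R : realType}.
Local Notation V := 'rV[R]_2.

Lemma compact_cball (x : V) (r : R) : compact [set y : V | `|y - x| <= r].
Proof.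
apply: bounded_closed_compact.
  exists (`|x| + r); split; first exact: num_real.
  move=> M hM y /= yx; apply: le_trans (ltW hM).
  by rewrite -[y](subrK x) addrC (le_trans (ler_normD _ _))// lerD2l.
apply: (@closed_comp _ _ (fun y : V => `|y - x|) [set t | t <= r]); last exact: closed_le.
move=> y _; apply: (@cvg_norm _ _ _ (nbhs y)).
by apply: (@cvgB _ _ _ (nbhs y)); [exact: cvg_id|exact: cvg_cst].
Qed.

Lemma cball_segment (x y z : V) (r s : R) : `|y - x| <= r -> `|z - x| <= r ->
  0 <= s -> s <= 1 -> `|y + s *: (z - y) - x| <= r.
Proof.
move=> yr zr s0 s1.
have -> : y + s *: (z - y) - x = (1 - s) *: (y - x) + s *: (z - x).
  by rewrite scalerBl scale1r !scalerBr; apply/rowP => j; rewrite !mxE; ring.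
apply: le_trans (ler_normD _ _) _; rewrite !normrZ !ger0_norm ?subr_ge0//.
by have := ler_wpM2l s0 zr; have := @ler_wpM2l _ (1 - s) _ _ _ yr;
   rewrite subr_ge0 => /(_ s1); lra.
Qed.

Lemma rV2_basis (v : V) : v = v 0 0 *: bv 0 + v 0 1 *: bv 1.
Proof.
apply/rowP; elim/ord2P; rewrite !mxE/= ?mulr1 ?mulr0 ?addr0 ?add0r//.
Qed.

Lemma derive_basis (W : normedModType R) (f : V -> W) x v : differentiable f x ->
  'D_v f x = v 0 0 *: 'D_(bv 0) f x + v 0 1 *: 'D_(bv 1) f x.
Proof.
by move=> df; rewrite !deriveE// {1}(rV2_basis v) linearD !linearZ.
Qed.

Lemma jacobianE (f : V -> V) z i j : differentiable f z ->
  jacobian f z i j = 'D_(bv i) f z 0 j.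
Proof.
by move=> df; rewrite deriveEjacobian// -rowE [RHS]mxE.
Qed.

Lemma jacobian_entry (f : V -> V) z i j : differentiable f z ->
  jacobian f z i j = 'D_(bv i) (fun w => f w 0 j) z.
Proof.
by move=> df; rewrite jacobianE// derive_mx ?mxE//; exact: diff_derivable.
Qed.

Lemma differentiable_entry (U : normedModType R) m n (f : U -> 'M[R]_(m, n)) z i j :
  differentiable f z -> differentiable (fun w => f w i j) z.
Proof.
move=> df; apply: (@differentiable_comp _ _ _ _ f (fun M : 'M[R]_(m, n) => M i j)) => //.
exact: differentiable_coord.
Qed.

(** The second derivative is that of the entries of the Jacobian matrix, which
    avoids bilinear maps. *)
Definition twice_diff (f : V -> V) z := (\forall w \near z, differentiable f w) /\
  forall i j, differentiable (fun w => jacobian f w i j) z.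

Lemma near_eq_differentiable (U W : normedModType R) (f g : U -> W) a :
  (\near a, f a = g a) -> differentiable f a -> differentiable g a.
Proof.
move=> fg df; have cdf := diff_continuous df.
have E : g \o shift a = cst (g a) + 'd f a +o_ 0 id.
  apply/eqaddoP => eps eps0.
  have /eqaddoP/(_ eps eps0) := diff_locally df.
  have fg' : \forall h \near 0, f (h + a) = g (h + a).
    have := fg; rewrite {1}(near_shift 0 a)/= subr0; apply: filterS => h /=.
    by [].
  by apply: filterS2 fg' => h /= e; rewrite !fctE /= e (nbhs_singleton fg).
have dE := diff_unique cdf E.
by apply/diff_locallyP; rewrite dE.
Qed.

Lemma smooth_twice_diff (A : set V) (f : V -> V) z :
  open A -> A z -> smooth_on A f -> twice_diff f z.
Proof.
move=> oA Az sf; have nA : nbhs z A by exact: open_nbhs_nbhs.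
have df : \forall w \near z, differentiable f w.
  by apply: filterS nA => w Aw; exact: (sf [::]).
split => // i j.
apply: near_eq_differentiable (differentiable_entry 0 j (sf [:: i] z Az)).
by apply: filterS df => w dw; rewrite jacobianE.
Qed.

Lemma is_derive_mul (U : normedModType R) (f g : U -> R) x v df dg :
  is_derive x v f df -> is_derive x v g dg ->
  is_derive x v (fun w => f w * g w) (f x * dg + g x * df).
Proof. exact: is_deriveM. Qed.

Lemma is_derive_sum2 (U : normedModType R) (f : 'I_2 -> U -> R) x v df :
  (forall i, is_derive x v (f i) (df i)) ->
  is_derive x v (fun w => \sum_i f i w) (\sum_i df i).
Proof.
move=> h; have := is_derive_sum h.
by rewrite (_ : \sum_(i < 2) f i = fun w => \sum_i f i w)//; apply/funext => w; rewrite fct_sumE.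
Qed.

Lemma bvE i k : (bv i : V) 0 k = (k == i)%:R.
Proof. by rewrite mxE. Qed.

Lemma is_derive_coord (v x : V) j : is_derive x v (fun w : V => w 0 j) (v 0 j).
Proof.
have d : differentiable (fun w : V => w 0 j) x by exact: differentiable_coord.
apply: DeriveDef; first exact: diff_derivable.
have E : 'D_v (@id V) x = \matrix_(i, j) 'D_v (fun t : V => t i j) x.
  by apply: derive_mx; exact: derivable_id.
by rewrite derive_id in E; rewrite [in RHS]E mxE.
Qed.

Lemma second_derivative_sym (f : V -> V) z i k p : twice_diff f z ->
  'D_(bv k) (fun w => jacobian f w i p) z = 'D_(bv i) (fun w => jacobian f w k p) z.
Proof.
move=> [df dJ]; pose g w := f w 0 p.
have dg : \forall w \near z, differentiable g w.
  by apply: filterS df => w; exact: differentiable_entry.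
have E l : \near z, jacobian f z l p = 'D_(bv l) g z.
  by apply: filterS df => w dw; rewrite jacobian_entry.
rewrite (near_eq_derive _ (E i)) (near_eq_derive _ (E k)).
apply: derive_comm => //; apply: near_eq_differentiable (dJ _ p); exact: E.
Qed.

(** The derivative along the row [k] of [J] of a metric with partial
    derivatives [dm], evaluated on the rows [i] and [l]. *)
Definition metric_term (J : 'M[R]_2) (dm : 'I_2 -> 'M[R]_2) (k i l : 'I_2) : R :=
  \sum_r \sum_p \sum_q J k r * dm r p q * (J i p * J l q).

(** The derivative along the coordinate [k] of the coefficient [(i, l)] of the
    hyperbolic metric, at height [y]. *)
Definition hyp_term (y : R) (k i l : 'I_2) : R :=
  if (k == 1) && (i == l) then - 2 * (y^-1) ^+ 3 else 0.

(** The coordinates of the second derivatives of a map with Jacobian matrix [J]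
    that pulls back the metric to the hyperbolic one. *)
Definition koszul (y : R) (J : 'M[R]_2) (dm : 'I_2 -> 'M[R]_2) (i k p : 'I_2) : R :=
  y ^+ 2 / 2 * \sum_l (hyp_term y k i l + hyp_term y i k l - hyp_term y l i k
    - (metric_term J dm k i l + metric_term J dm i k l - metric_term J dm l i k))
    * J l p.

(** As for the Levi-Civita connection, the cyclic permutations of the
    differentiated isometry condition give the scalar products [B i k l] of
    [F i k] with the rows of [J], which form a basis that is orthogonal for
    [m], of vectors of squared length [y^-2]. *)
Lemma koszul_unique (y : R) (J m : 'M[R]_2) dm (F : 'I_2 -> 'I_2 -> 'I_2 -> R) :
  y != 0 -> m^T = m -> J *m m *m J^T = (y ^- 2)%:M ->
  (forall i k p, F i k p = F k i p) ->
  (forall k i l, \sum_p \sum_q (F i k p * m p q * J l q + J i p * m p q * F l k q)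
    + metric_term J dm k i l = hyp_term y k i l) ->
  forall i k p, F i k p = koszul y J dm i k p.
Proof.
move=> y0 mT JmJ Fsym EQ i k p.
have msym a b : m a b = m b a by rewrite -{1}mT mxE.
pose B i k l := \sum_p \sum_q F i k p * m p q * J l q.
have EB a b c : B b a c + B c a b = hyp_term y a b c - metric_term J dm a b c.
  rewrite -EQ addrK /B !big_ord2 (msym 1 0); ring.
have Bsym a b c : B a b c = B b a c.
  by rewrite /B; under eq_bigr do under eq_bigr do rewrite Fsym.
have inv : (y ^+ 2 *: (m *m J^T)) *m J = 1%:M.
  apply: mulmx1C; rewrite -scalemxAr mulmxA JmJ scale_scalar_mx divff//.
  by rewrite expf_neq0.
have FE : F i k p = y ^+ 2 * \sum_l B i k l * J l p.
  pose v : 'rV[R]_2 := \row_q F i k q.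
  have : v *m (y ^+ 2 *: (m *m J^T) *m J) = v by rewrite inv mulmx1.
  move/matrixP/(_ 0 p); rewrite [RHS]mxE => <-.
  rewrite /v /B !mxE !big_ord2 !mxE !big_ord2 !mxE !big_ord2 !mxE; ring.
rewrite FE /koszul -mulrA; congr (_ * _).
rewrite mulr_sumr; apply: eq_bigr => l _ /=; rewrite mulrA; congr (_ * _).
have := EB k i l; have := EB i k l; have := EB l i k.
by rewrite (Bsym k i l) (Bsym l k i) (Bsym l i k); lra.
Qed.

Lemma mulmx3E (A M : 'M[R]_2) i l :
  (A *m M *m A^T) i l = \sum_p \sum_q A i p * M p q * A l q.
Proof. by rewrite !mxE big_ord2 !mxE !big_ord2; ring. Qed.

Lemma metric_leibniz (J m : 'M[R]_2) (dm : 'I_2 -> 'M[R]_2)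
    (F : 'I_2 -> 'I_2 -> 'I_2 -> R) k i l :
  \sum_p \sum_q (J i p * m p q * F l k q + J l q *
    (J i p * (\sum_r J k r * dm r p q) + m p q * F i k p)) =
  \sum_p \sum_q (F i k p * m p q * J l q + J i p * m p q * F l k q)
    + metric_term J dm k i l.
Proof. by rewrite /metric_term !big_ord2; ring. Qed.

Lemma second_derivative (f : V -> V) (m : V -> 'M[R]_2) (z : V) i k p :
  z 0 1 != 0 -> twice_diff f z -> differentiable m (f z) -> (m (f z))^T = m (f z) ->
  (\forall w \near z, jacobian f w *m m (f w) *m (jacobian f w)^T
     = hyperbolic_metric w) ->
  'D_(bv k) (fun w => jacobian f w i p) z
    = koszul (z 0 1) (jacobian f z) (fun r => 'D_(bv r) m (f z)) i k p.
Proof.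
move=> y0 tdf dm mT conf; have [df dJ] := tdf.
apply: (@koszul_unique (z 0 1) (jacobian f z) (m (f z)) _
  (fun i k p => 'D_(bv k) (fun w => jacobian f w i p) z)) => //.
- exact: (nbhs_singleton conf).
- by move=> a b c; exact: second_derivative_sym.
move=> {}k {}i l.
have dfz : differentiable f z by exact: (nbhs_singleton df).
pose F a b c := 'D_(bv b) (fun w => jacobian f w a c) z.
have D1 a c : is_derive z (bv k : V) (fun w => jacobian f w a c) (F a k c).
  by apply: DeriveDef => //; exact: diff_derivable.
have D2 a c : is_derive z (bv k : V) (fun w => m (f w) a c)
    (\sum_r jacobian f z k r * 'D_(bv r) m (f z) a c).
  have dmac : differentiable (fun x => m x a c) (f z) by exact: differentiable_entry.
  have dc : differentiable (fun w => m (f w) a c) z.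
    exact: (@differentiable_comp _ _ _ _ f (fun x => m x a c)).
  apply: DeriveDef; first exact: diff_derivable.
  rewrite deriveE// (_ : (fun w => m (f w) a c) = (fun x => m x a c) \o f)//.
  rewrite diff_comp//= -!deriveE// derive_basis// big_ord2 /= /GRing.scale/=.
  rewrite !jacobianE//.
  have de r : 'D_(bv r) m (f z) a c = 'D_(bv r) (fun x => m x a c) (f z).
    by rewrite derive_mx ?mxE//; exact: diff_derivable.
  by rewrite !de.
have D : is_derive z (bv k : V)
    (fun w => \sum_p \sum_q jacobian f w i p * m (f w) p q * jacobian f w l q)
    (\sum_p \sum_q (F i k p * m (f z) p q * jacobian f z l q
      + jacobian f z i p * m (f z) p q * F l k q) + metric_term (jacobian f z)
        (fun r => 'D_(bv r) m (f z)) k i l).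
  pose dpq p q := jacobian f z i p * m (f z) p q * F l k q + jacobian f z l q *
   (jacobian f z i p * (\sum_r jacobian f z k r * 'D_(bv r) m (f z) p q)
     + m (f z) p q * F i k p).
  have : is_derive z (bv k : V)
    (fun w => \sum_p \sum_q jacobian f w i p * m (f w) p q * jacobian f w l q)
    (\sum_p \sum_q dpq p q).
    by do 2 (apply: is_derive_sum2 => ?); do 2 apply: is_derive_mul.
  move=> h; apply: is_derive_eq h _.
  exact: metric_leibniz (jacobian f z) (m (f z)) (fun r => 'D_(bv r) m (f z)) F k i l.
have E : \forall w \near z, \sum_p \sum_q jacobian f w i p * m (f w) p q * jacobian f w l q
    = (i == l)%:R * ((w : V) 0 1)^-1 ^+ 2.
  apply: filterS conf => w /matrixP/(_ i l); rewrite mulmx3E => ->.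
  by rewrite /hyperbolic_metric !mxE mulr_natl exprVn.
have <- := @derive_val _ _ _ _ _ _ _ D.
rewrite (near_eq_derive _ E) /hyp_term.
have dy := is_derive_coord (bv k) z 1.
have dyV : is_derive z (bv k : V) (fun w : V => (w 0 1)^-1) (- (z 0 1) ^- 2 * (k == 1)%:R).
  have der := @ex_derive _ _ _ _ _ _ _ dy.
  apply: DeriveDef; first exact: derivableV.
  by rewrite deriveV// derive_val bvE eq_sym.
have dyV2 := is_derive_mul dyV dyV.
have dF := is_derive_mul (is_derive_cst ((i == l)%:R : R) z (bv k : V)) dyV2.
rewrite (_ : (fun w : V => _) = (fun w : V => (i == l)%:R * ((w 0 1)^-1 * (w 0 1)^-1))).
  rewrite (@derive_val _ _ _ _ _ _ _ dF) mulr0 addr0.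
  case: (k == 1); case: (i == l) => /=; rewrite ?mulr0 ?mul0r ?addr0 ?mul1r ?mulr1 //.
  by field.
by apply/funext => w; rewrite expr2.
Qed.

End PlaneCalculus.

(** * Lipschitz estimates for polynomials *)

Section LipschitzComparison.
Context {R : realType}.
Local Notation V := 'rV[R]_2.

Lemma compact_bound (X : topologicalType) (K : set X) (h : X -> R) : compact K ->
  (forall x, K x -> {for x, continuous h}) -> exists2 C, 0 <= C & forall x, K x -> `|h x| <= C.
Proof.
move=> cK ch; have ch' : {within K, continuous h}.
  by apply: continuous_in_subspaceT => x xK; apply: ch; exact: set_mem.
have /compact_bounded[N [_ hN]] := continuous_compact ch' cK.
exists (`|N| + 1); first by rewrite addr_ge0.
move=> x Kx; apply: (hN (`|N| + 1)); last by exists x.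
by apply: le_lt_trans (ler_norm N) _; rewrite ltrDl.
Qed.

Lemma lipschitz_cball (g : V -> R) (x1 : V) (r : R) :
  (forall x, `|x - x1| <= r -> differentiable g x) ->
  (forall i x, `|x - x1| <= r -> differentiable ('D_(bv i) g) x) ->
  exists2 C, 0 <= C & forall x y, `|x - x1| <= r -> `|y - x1| <= r ->
    `|g x| <= C /\ `|g x - g y| <= C * `|x - y|.
Proof.
move=> dg dDg.
have [C C0 hC] := compact_bound (@compact_cball R x1 r)
  (fun x xK => differentiable_continuous (dg x xK)).
have [C1 C10 hC1] := compact_bound (@compact_cball R x1 r)
  (fun x xK => differentiable_continuous (dDg 0 x xK)).
have [C2 C20 hC2] := compact_bound (@compact_cball R x1 r)
  (fun x xK => differentiable_continuous (dDg 1 x xK)).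
exists (C + C1 + C2); first by rewrite !addr_ge0.
move=> x y xr yr; split; first by apply: le_trans (hC x xr) _; lra.
have [|s] := @increment_line R V g y (x - y) 1 ltr01.
  move=> s; rewrite in_itv/= => /andP[s0 s1]; apply: dg; exact: cball_segment.
rewrite in_itv/= => /andP[/ltW s0 /ltW s1]; rewrite scale1r subrKC mulr1 => ->.
have sr := cball_segment yr xr s0 s1.
rewrite derive_basis; last exact: dg.
apply: le_trans (ler_normD _ _) _; rewrite /GRing.scale/= !normrM.
have n0 := entry_le_norm (x - y) 0 0; have n1 := entry_le_norm (x - y) 0 1.
have h1 := hC1 _ sr; have h2 := hC2 _ sr.
rewrite !mulrDl; apply: (@le_trans _ _ (C1 * `|x - y| + C2 * `|x - y|)).
  by rewrite lerD// mulrC ler_pM.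
by rewrite -addrA lerDr mulr_ge0.
Qed.

(** [u] and [v] are uniformly bounded on [D], and their difference is
    controlled by [d]; this is stable under the operations of polynomials, so
    that a polynomial is Lipschitz in a family of such variables. *)
Definition lipbd (I : Type) (D : set I) (d u v : I -> R) :=
  exists2 K, 0 <= K & forall i, D i ->
    [/\ `|u i| <= K, `|v i| <= K & `|u i - v i| <= K * d i].

Section Lipbd.
Context (I : Type) (D : set I) (d : I -> R) (d0 : forall i, D i -> 0 <= d i).

Lemma lipbd_same (u : I -> R) (K : R) : (forall i, D i -> `|u i| <= K) -> lipbd D d u u.
Proof.
move=> uK; exists `|K| => // i Di; have uK' := le_trans (uK i Di) (ler_norm K).
by split => //; rewrite subrr normr0 mulr_ge0// d0.
Qed.

Lemma lipbdD u v u' v' : lipbd D d u v -> lipbd D d u' v' ->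
  lipbd D d (fun i => u i + u' i) (fun i => v i + v' i).
Proof.
move=> [K K0 hK] [K' K'0 hK']; exists (K + K'); first exact: addr_ge0.
move=> i Di; have [a b c] := hK i Di; have [a' b' c'] := hK' i Di; split.
- by rewrite (le_trans (ler_normD _ _))// lerD.
- by rewrite (le_trans (ler_normD _ _))// lerD.
- by rewrite opprD addrACA mulrDl (le_trans (ler_normD _ _))// lerD.
Qed.

Lemma lipbdN u v : lipbd D d u v -> lipbd D d (fun i => - u i) (fun i => - v i).
Proof.
move=> [K K0 hK]; exists K => // i Di; have [a b c] := hK i Di.
by rewrite !normrN; split => //; rewrite -opprD normrN.
Qed.

Lemma lipbdM u v u' v' : lipbd D d u v -> lipbd D d u' v' ->
  lipbd D d (fun i => u i * u' i) (fun i => v i * v' i).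
Proof.
move=> [K K0 hK] [K' K'0 hK']; exists (K * K' + K * K'); first by rewrite addr_ge0 ?mulr_ge0.
have KK : K * K' <= K * K' + K * K' by rewrite lerDl mulr_ge0.
move=> i Di; have [a b c] := hK i Di; have [a' b' c'] := hK' i Di; split.
- by rewrite normrM (le_trans _ KK)// ler_pM.
- by rewrite normrM (le_trans _ KK)// ler_pM.
- have -> : u i * u' i - v i * v' i = u i * (u' i - v' i) + (u i - v i) * v' i by ring.
  rewrite (le_trans (ler_normD _ _))// !normrM mulrDl lerD//.
    by rewrite -mulrA ler_pM.
  by rewrite mulrAC ler_pM.
Qed.

Lemma lipbd_sum (u v : 'I_2 -> I -> R) : (forall k, lipbd D d (u k) (v k)) ->
  lipbd D d (fun i => \sum_k u k i) (fun i => \sum_k v k i).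
Proof.
move=> h; rewrite (_ : (fun i => \sum_k u k i) = (fun i => u 0 i + u 1 i)); last first.
  by apply/funext => i; rewrite big_ord2.
rewrite (_ : (fun i => \sum_k v k i) = (fun i => v 0 i + v 1 i)); last first.
  by apply/funext => i; rewrite big_ord2.
exact: lipbdD.
Qed.

End Lipbd.

Lemma lipbd_koszul (I : Type) (D : set I) (d y : I -> R) (J J' : I -> 'M[R]_2)
    (dm dm' : I -> 'I_2 -> 'M[R]_2) (y0 y1 : R) :
  (forall i, D i -> 0 <= d i) -> 0 < y0 -> (forall i, D i -> y0 <= y i <= y1) ->
  (forall a b, lipbd D d (fun i => J i a b) (fun i => J' i a b)) ->
  (forall r a b, lipbd D d (fun i => dm i r a b) (fun i => dm' i r a b)) ->
  forall a b c, lipbd D d (fun i => koszul (y i) (J i) (dm i) a b c)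
    (fun i => koszul (y i) (J' i) (dm' i) a b c).
Proof.
move=> d0 y00 hy hJ hdm a b c.
have yb i : D i -> [/\ 0 < y i, `|y i| <= y1 & `|(y i)^-1| <= y0^-1].
  move=> /hy/andP[h1 h2]; have y0' : 0 < y i by exact: lt_le_trans h1.
  by rewrite !gtr0_norm ?invr_gt0// lef_pV2 ?posrE.
have hyp k i l : lipbd D d (fun t => hyp_term (y t) k i l) (fun t => hyp_term (y t) k i l).
  rewrite /hyp_term; case: ((k == 1) && (i == l)); last by apply: (@lipbd_same _ _ _ d0 _ 0); rewrite normr0.
  apply: (@lipbd_same _ _ _ d0 _ (2 * y0^-1 ^+ 3)) => t /yb[_ _ h].
  by rewrite normrM normrN normr_nat ler_pM2l// normrX lerXn2r ?nnegrE// invr_ge0 ltW.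
have met k i l : lipbd D d (fun t => metric_term (J t) (dm t) k i l)
    (fun t => metric_term (J' t) (dm' t) k i l).
  do 3 (apply: lipbd_sum => // ?).
  by apply: lipbdM; apply: lipbdM.
rewrite /koszul; apply: lipbdM.
  apply: (@lipbd_same _ _ _ d0 _ (y1 ^+ 2 / 2)) => t /yb[h0 h _].
  rewrite normrM normfV normr_nat ler_pM2r ?invr_gt0// normrX lerXn2r ?nnegrE//.
  exact: le_trans h.
apply: lipbd_sum => // l; apply: lipbdM => //.
apply: lipbdD; first by apply: lipbdD; [exact: lipbdD|exact: lipbdN].
by apply: lipbdN; apply: lipbdD; [exact: lipbdD|exact: lipbdN].
Qed.

End LipschitzComparison.

(** * Comparison of the 1-jets of two isometries *)

Section JetComparison.
Context {R : realType}.
Local Notation V := 'rV[R]_2.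

(** The coordinates of the 1-jet of [f]: its values for [k.1 = None], and its
    partial derivatives along the basis vector [i] for [k.1 = Some i]. *)
Definition jet (f : V -> V) (k : option 'I_2 * 'I_2) (z : V) : R :=
  if k.1 is Some i then jacobian f z i k.2 else f z 0 k.2.

Definition jet_dist (f g : V -> V) (z : V) : R := \sum_k `|jet f k z - jet g k z|.

(** [f] is near [z] a local isometry from the hyperbolic plane to the plane
    with the metric [m]. *)
Definition isometric_at (f : V -> V) (m : V -> 'M[R]_2) (z : V) :=
  [/\ twice_diff f z, differentiable m (f z), (m (f z))^T = m (f z) &
    \forall w \near z, jacobian f w *m m (f w) *m (jacobian f w)^T
      = hyperbolic_metric w].

Lemma jet_differentiable f k z : twice_diff f z -> differentiable (jet f k) z.
Proof.
move=> [df dJ]; case: k => [[i|] p]; rewrite /jet /=; first exact: dJ.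
by apply: differentiable_entry; exact: (nbhs_singleton df).
Qed.

(** The right-hand side of the first-order system that the 1-jet of an isometry
    satisfies. *)
Definition jet_rhs (f : V -> V) (m : V -> 'M[R]_2) (l : 'I_2) (k : option 'I_2 * 'I_2)
    (z : V) : R :=
  if k.1 is Some i then koszul (z 0 1) (jacobian f z) (fun r => 'D_(bv r) m (f z)) i l k.2
  else jacobian f z l k.2.

Lemma jet_derive f m l k (z : V) : z 0 1 != 0 -> isometric_at f m z ->
  'D_(bv l) (jet f k) z = jet_rhs f m l k z.
Proof.
move=> y0 [tdf dm mT conf]; case: k => [[i|] p]; rewrite /jet /jet_rhs /=.
  exact: second_derivative.
have [df _] := tdf.
by rewrite -jacobian_entry//; exact: (nbhs_singleton df).
Qed.

Lemma jet_dist_ge f g k z : `|jet f k z - jet g k z| <= jet_dist f g z.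
Proof.
by rewrite /jet_dist (bigD1 k)//= lerDl sumr_ge0.
Qed.

Lemma jet_dist_ge0 f g z : 0 <= jet_dist f g z.
Proof. by rewrite sumr_ge0. Qed.

Lemma card_jet : #|{: option 'I_2 * 'I_2}| = 6%N.
Proof. by rewrite card_prod card_option !card_ord. Qed.

Lemma jet_dist_continuous f g z : twice_diff f z -> twice_diff g z ->
  {for z, continuous (jet_dist f g)}.
Proof.
move=> df dg; rewrite /jet_dist.
rewrite /continuous_at; apply: (@cvg_big _ _ _ _ _ _ _ (nbhs z)) => //= [|k _]; first exact: add_continuous.
apply: (@cvg_norm _ _ _ (nbhs z)); apply: (@cvgB _ _ _ (nbhs z)).
  exact: (differentiable_continuous (jet_differentiable k df)).
exact: (differentiable_continuous (jet_differentiable k dg)).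
Qed.

Definition metric_deriv_close (m m0 : V -> 'M[R]_2) (eta : R) (x : V) :=
  forall r p q, `|'D_(bv r) m x p q - 'D_(bv r) m0 x p q| <= eta.

(** The right-hand side is a polynomial in the first derivatives of the map, in
    those of the metric, and in [y] and [y^-1], all of which stay bounded near
    [z1]. *)
Lemma jet_rhs_lipschitz (f0 : V -> V) (m0 : V -> 'M[R]_2) (z1 : V) (sigma : R) :
  0 < z1 0 1 -> (\forall w \near z1, isometric_at f0 m0 w) ->
  (forall r p q, exists2 C : R, 0 <= C & forall x y : V,
     `|x - f0 z1| <= sigma -> `|y - f0 z1| <= sigma ->
     `|'D_(bv r) m0 x p q| <= C /\
     `|'D_(bv r) m0 x p q - 'D_(bv r) m0 y p q| <= C * `|x - y|) ->
  0 < sigma ->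
  exists rho K, [/\ 0 < rho, 1 <= K,
    forall w : V, `|w - z1| <= rho ->
      [/\ isometric_at f0 m0 w, 0 < w 0 1 & `|f0 w - f0 z1| <= sigma] &
    forall (f : V -> V) (m : V -> 'M[R]_2) (eta : R) (w : V) l k, `|w - z1| <= rho -> 0 <= eta -> eta <= 1 ->
      `|f w - f0 z1| <= sigma -> jet_dist f f0 w <= 1 ->
      metric_deriv_close m m0 eta (f w) ->
      `|jet_rhs f m l k w - jet_rhs f0 m0 l k w| <= K * (jet_dist f f0 w + eta)].
Proof.
move=> y1 iso0 lipm s0.
have [tdf0 _ _ _] := nbhs_singleton iso0.
have jc k : {for z1, continuous (jet f0 k)}.
  exact/differentiable_continuous/jet_differentiable.
have /nbhs_ballP[rho1 /= rho10 hrho] : nbhs z1 [set w : V |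
    [/\ isometric_at f0 m0 w, z1 0 1 / 2 <= w 0 1 <= 2 * z1 0 1, `|f0 w - f0 z1| <= sigma &
      forall k, `|jet f0 k w - jet f0 k z1| <= 1] ].
  have h1 : nbhs z1 [set w : V | z1 0 1 / 2 <= w 0 1 <= 2 * z1 0 1].
    have cy : {for z1, continuous (fun w : V => w 0 1)} by exact: coord_continuous.
    have a : nbhs z1 [set w : V | z1 0 1 / 2 < w 0 1] by apply: (cvgr_gt _ cy); lra.
    have b : nbhs z1 [set w : V | w 0 1 < 2 * z1 0 1] by apply: (cvgr_lt _ cy); lra.
    by apply: filterS2 a b => w /= /ltW a' /ltW b'; rewrite a' b'.
  have h2 : \forall w \near z1, `|f0 w - f0 z1| <= sigma.
    have df : {for z1, continuous f0}.
      apply: differentiable_continuous; have [df _] := tdf0; exact: (nbhs_singleton df).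
    by have /cvgr_dist_le/(_ _ s0) := df; apply: filterS => w; rewrite distrC.
  have h3 : nbhs z1 [set w | forall k, `|jet f0 k w - jet f0 k z1| <= 1].
    have h3' k : nbhs z1 [set w | `|jet f0 k w - jet f0 k z1| <= 1].
      by have /cvgr_dist_le/(_ _ ltr01) := jc k; apply: filterS => w /=; rewrite distrC.
    exact: (@filter_forall _ _ _ (nbhs z1) _ h3').
  by apply: filterS3 (filterI iso0 h1) h2 h3 => w [].
pose I : Type := ((V -> V) * (V -> 'M[R]_2) * R * V)%type.
pose rho := rho1 / 2.
have rho0 : 0 < rho by rewrite divr_gt0.
have hrho' (w : V) : `|w - z1| <= rho -> [/\ isometric_at f0 m0 w,
    z1 0 1 / 2 <= w 0 1 <= 2 * z1 0 1, `|f0 w - f0 z1| <= sigma &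
      forall k, `|jet f0 k w - jet f0 k z1| <= 1].
  by move=> wz; apply: hrho; rewrite -ball_normE/= distrC /rho in wz *; lra.
pose ff (i : I) := i.1.1.1; pose mm (i : I) := i.1.1.2.
pose ee (i : I) := i.1.2; pose ww (i : I) := i.2.
pose D : set I := [set i : I |
  [/\ `|ww i - z1| <= rho, 0 <= ee i <= 1, `|ff i (ww i) - f0 z1| <= sigma,
    jet_dist (ff i) f0 (ww i) <= 1 & metric_deriv_close (mm i) m0 (ee i) (ff i (ww i))] ].
pose d (i : I) := jet_dist (ff i) f0 (ww i) + ee i.
have d0 i : D i -> 0 <= d i.
  by move=> [_ /andP[e0 _] _ _ _]; rewrite /d addr_ge0// jet_dist_ge0.
have Ljet k : lipbd D d (fun i => jet (ff i) k (ww i)) (fun i => jet f0 k (ww i)).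
  exists (`|jet f0 k z1| + 2); first by rewrite addr_ge0.
  move=> i [/hrho'[_ _ _ h] /andP[e0 _] _ h1 _].
  have hk := h k; have hf := jet_dist_ge (ff i) f0 k (ww i).
  have a : `|jet f0 k (ww i)| <= `|jet f0 k z1| + 1.
    rewrite -[jet f0 k (ww i)](subrK (jet f0 k z1)) addrC.
    by rewrite (le_trans (ler_normD _ _))// lerD2l.
  split; last 2 first.
  - by apply: le_trans a _; rewrite lerD2l; lra.
  - rewrite /d; apply: (@le_trans _ _ (1 * (jet_dist (ff i) f0 (ww i) + ee i))).
      by rewrite mul1r; apply: le_trans hf _; rewrite lerDl.
    rewrite ler_wpM2r// ?addr_ge0 ?jet_dist_ge0//.
    by apply: (@le_trans _ _ 2); [lra|rewrite lerDr].
  rewrite -[jet (ff i) k (ww i)](subrK (jet f0 k (ww i))) (le_trans (ler_normD _ _))//.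
  by have := le_trans hf h1; lra.
have Ldm r p q : lipbd D d (fun i => 'D_(bv r) (mm i) (ff i (ww i)) p q)
    (fun i => 'D_(bv r) m0 (f0 (ww i)) p q).
  have [C C0 hC] := lipm r p q; exists (2 * C + 1); first by rewrite addr_ge0// mulr_ge0.
  move=> i [/hrho'[_ _ f0w h] /andP[e0 e1] fw h1 mc].
  have [c1 c2] := hC _ _ fw f0w; have [c3 _] := hC _ _ f0w fw; have mcr := mc r p q.
  have ff0 : `|ff i (ww i) - f0 (ww i)| <= jet_dist (ff i) f0 (ww i).
    apply: norm_le_entries => [|a j]; first exact: jet_dist_ge0.
    by rewrite ord1 !mxE; exact: (jet_dist_ge (ff i) f0 (None, j) (ww i)).
  have split3 (a b c : R) : a - c = (a - b) + (b - c) by ring.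
  split.
  - rewrite -['D_(bv r) (mm i) _ p q](subrK ('D_(bv r) m0 (ff i (ww i)) p q)).
    by apply: le_trans (ler_normD _ _) _; lra.
  - by apply: le_trans c3 _; lra.
  - rewrite /d; apply: (@le_trans _ _ (ee i + C * jet_dist (ff i) f0 (ww i))).
      rewrite (split3 _ ('D_(bv r) m0 (ff i (ww i)) p q)).
      apply: le_trans (ler_normD _ _) _; rewrite lerD//.
      by apply: le_trans c2 _; rewrite ler_wpM2l.
    have := jet_dist_ge0 (ff i) f0 (ww i); move: (jet_dist _ _ _) => j j0.
    by move: (ee i) e0 e1 => e e0 e1; nra.
have Lrhs (lk : 'I_2 * (option 'I_2 * 'I_2)) :
    lipbd D d (fun i => jet_rhs (ff i) (mm i) lk.1 lk.2 (ww i))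
    (fun i => jet_rhs f0 m0 lk.1 lk.2 (ww i)).
  case: lk => l [[a|] p]; last exact: (Ljet (Some l, p)).
  have y20 : 0 < z1 0 1 / 2 by rewrite divr_gt0.
  apply: (@lipbd_koszul R I D d (fun i => ww i 0 1) (fun i => jacobian (ff i) (ww i))
    (fun i => jacobian f0 (ww i)) (fun i r => 'D_(bv r) (mm i) (ff i (ww i)))
    (fun i r => 'D_(bv r) m0 (f0 (ww i))) _ (2 * z1 0 1) d0 y20 _ _ Ldm).
    by move=> i [/hrho'[]].
  by move=> b c; exact: (Ljet (Some b, c)).
have /choice[K hK] : forall lk, exists K, 0 <= K /\ forall i, D i ->
    `|jet_rhs (ff i) (mm i) lk.1 lk.2 (ww i) - jet_rhs f0 m0 lk.1 lk.2 (ww i)| <= K * d i.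
  by move=> lk; have [K K0 hK] := Lrhs lk; exists K; split => // i /hK[].
have K0 lk : 0 <= K lk by have [] := hK lk.
exists rho, (1 + \sum_lk K lk); split => //.
- by rewrite lerDl sumr_ge0.
- move=> w /hrho'[h1 /andP[h2 _] h3 _]; split => //.
  by apply: lt_le_trans h2; rewrite divr_gt0.
move=> f m eta w l k wz e0 e1 fw jd mc.
have [_ h] := hK (l, k); have Di : D (f, m, eta, w) by split => //; rewrite e0 e1.
apply: le_trans (h _ Di) _; rewrite ler_wpM2r ?(d0 _ Di)//.
by rewrite (bigD1 (l, k))//= addrCA lerDl addr_ge0 ?sumr_ge0.
Qed.

(** Two isometric maps that are defined along a short segment and take values
    in a common region stay close together in the C^1 sense: by the Koszul
    formula, their 1-jets satisfy differential equations with close right-hand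
    sides. The segment is so short that the growth of the difference is at most
    half of its maximum, which replaces the Gronwall inequality. *)
Lemma jet_comparison (f0 : V -> V) (m0 : V -> 'M[R]_2) (z1 : V) (sigma : R) :
  0 < z1 0 1 -> (\forall w \near z1, isometric_at f0 m0 w) ->
  (forall r p q, exists2 C : R, 0 <= C & forall x y : V,
     `|x - f0 z1| <= sigma -> `|y - f0 z1| <= sigma ->
     `|'D_(bv r) m0 x p q| <= C /\
     `|'D_(bv r) m0 x p q - 'D_(bv r) m0 y p q| <= C * `|x - y|) ->
  0 < sigma ->
  exists2 rho, 0 < rho & forall (f : V -> V) (m : V -> 'M[R]_2) (eta : R) (z2 e : V), 0 <= eta -> eta <= 1 ->
    (forall s, 0 <= s -> s <= 1 -> let w := z2 + s *: e in
      [/\ `|w - z1| <= rho, isometric_at f m w, `|f w - f0 z1| <= sigma,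
        jet_dist f f0 w <= 1 & metric_deriv_close m m0 eta (f w)]) ->
    jet_dist f f0 (z2 + e) <= 2 * jet_dist f f0 z2 + eta.
Proof.
move=> y1 iso0 lipm s0.
have [rho1 [K [rho10 K1 hrho hK]]] := jet_rhs_lipschitz y1 iso0 lipm s0.
pose rho := Num.min rho1 (48 * K)^-1.
have rho0 : 0 < rho by rewrite lt_min rho10 invr_gt0 mulr_gt0//; lra.
have rho_rho1 : rho <= rho1 by rewrite ge_min lexx.
have rhoK : rho * (48 * K) <= 1.
  by rewrite -ler_pdivlMr ?mulr_gt0//; [rewrite mul1r ge_min lexx orbT|lra].
exists rho => // f m eta z2 e e0 e1 hseg.
pose c (s : R) : V := z2 + s *: e.
have en : `|e| <= 2 * rho.
  have [a _ _ _ _] := hseg 0 (lexx _) ler01; have [b _ _ _ _] := hseg 1 ler01 (lexx _).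
  rewrite scale0r addr0 scale1r in a b.
  have -> : e = (z2 + e - z1) - (z2 - z1) by rewrite opprB addrA subrK addrAC subrr add0r.
  by apply: le_trans (ler_normB _ _) _; lra.
have reg s : 0 <= s -> s <= 1 -> [/\ twice_diff f (c s), twice_diff f0 (c s),
    isometric_at f m (c s), isometric_at f0 m0 (c s) & 0 < c s 0 1].
  move=> s0' s1'; have [wz isf _ _ _] := hseg s s0' s1'.
  have [isf0 wy _] := hrho _ (le_trans wz rho_rho1).
  have [tf _ _ _] := isf; have [tf0 _ _ _] := isf0.
  by split; [exact: tf|exact: tf0|exact: isf|exact: isf0|exact: wy].
have cont : {within `[0, 1], continuous (fun s => jet_dist f f0 (c s))}.
  apply: continuous_in_subspaceT => s; rewrite inE/= in_itv/= => /andP[a b].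
  have [tf tf0 _ _ _] := reg s a b.
  apply: (@continuous_comp _ _ _ c (jet_dist f f0)); last exact: jet_dist_continuous.
  apply: cvgD; first exact: cvg_cst.
  by apply: cvgZr_tmp; exact: cvg_id.
have [s sI smax] := EVT_max ler01 cont; set D := jet_dist f f0 (c s) in smax.
have D0 : 0 <= D := jet_dist_ge0 _ _ _.
move: sI; rewrite in_itv/= => /andP[sge0 s1].
have growth k : `|(jet f k (c s) - jet f0 k (c s)) - (jet f k z2 - jet f0 k z2)|
    <= (12)^-1 * (D + eta).
  have [->|sn0] := eqVneq s 0.
    by rewrite /c scale0r addr0 subrr normr0 mulr_ge0 ?invr_ge0 ?addr_ge0.
  have spos : 0 < s by rewrite lt_neqAle eq_sym sn0.
  pose g w := jet f k w - jet f0 k w.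
  have dg t : 0 <= t -> t <= 1 -> differentiable g (c t).
    move=> t0 t1; have [tf tf0 _ _ _] := reg t t0 t1.
    by apply: differentiableB; exact: jet_differentiable.
  have [|t] := @increment_line R V g z2 e s spos.
    by move=> t; rewrite in_itv/= => /andP[t0 ts]; apply: dg => //; exact: le_trans s1.
  rewrite in_itv/= => /andP[/ltW t0 /ltW ts]; rewrite -/(c t) -/(c s) /g => ->.
  have t1 : t <= 1 := le_trans ts s1.
  have [tf tf0 isf isf0 wy] := reg t t0 t1.
  have [wz _ fw jd mc] := hseg t t0 t1.
  rewrite derive_basis; last exact: dg.
  have Dl l : `|'D_(bv l) g (c t)| <= K * (D + eta).
    rewrite /g deriveB; last 2 first.
    - by apply: diff_derivable; exact: jet_differentiable.
    - by apply: diff_derivable; exact: jet_differentiable.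
    rewrite (@jet_derive f m) ?gt_eqF// (@jet_derive f0 m0) ?gt_eqF//.
    have := hK f m eta (c t) l k (le_trans wz rho_rho1) e0 e1 fw jd mc.
    move=> /le_trans; apply; rewrite ler_wpM2l//; first by lra.
    rewrite lerD2r; apply: smax; by rewrite in_itv/= t0 t1.
  have KD : 0 <= K * (D + eta) by rewrite mulr_ge0 ?addr_ge0//; lra.
  have n0 : `|e 0 0| <= 2 * rho := le_trans (entry_le_norm _ _ _) en.
  have n1 : `|e 0 1| <= 2 * rho := le_trans (entry_le_norm _ _ _) en.
  rewrite normrM (ger0_norm sge0); apply: (@le_trans _ _ (4 * rho * (K * (D + eta)) * 1)).
    apply: ler_pM => //.
    apply: le_trans (ler_normD _ _) _; rewrite /GRing.scale/= !normrM.
    have -> : 4 * rho * (K * (D + eta)) = 2 * rho * (K * (D + eta)) + 2 * rho * (K * (D + eta)).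
      by ring.
    by rewrite lerD// ler_pM.
  rewrite mulr1 mulrA ler_wpM2r ?addr_ge0//.
  move: rhoK; lra.
have DE : D <= jet_dist f f0 z2 + (D + eta) / 2.
  have -> : (D + eta) / 2 = \sum_(k : option 'I_2 * 'I_2) ((12)^-1 * (D + eta)).
    by rewrite sumr_const card_jet -mulr_natr; field.
  have Dle : D <= \sum_k `|jet f k (c s) - jet f0 k (c s)| by [].
  apply: le_trans Dle _; rewrite -[jet_dist f f0 z2]/(\sum_k `|jet f k z2 - jet f0 k z2|).
  rewrite -big_split/=; apply: ler_sum => k _.
  rewrite -[X in `|X| <= _](subrK (jet f k z2 - jet f0 k z2)).
  by apply: le_trans (ler_normD _ _) _; rewrite [leRHS]addrC lerD2r; exact: growth.
have : jet_dist f f0 (c 1) <= D by apply: smax; rewrite in_itv/= ler01 lexx.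
rewrite /c scale1r => /le_trans; apply; lra.
Qed.

End JetComparison.

(** * The leaf topology and smooth families *)

Section LeafTopology.
Context {R : realType} (L : lamination R).
Local Notation V := 'rV[R]_2.
Local Notation chart_index := (chart_index L).

Lemma open_open_disk (c : V) (r : R) : open (open_disk c r).
Proof.
rewrite (_ : open_disk c r = (fun x : V => (x 0 0 - c 0 0) ^+ 2 + (x 0 1 - c 0 1) ^+ 2)
  @^-1` [set t | t < r ^+ 2])//.
apply: open_comp; last exact: open_lt.
move=> x _; apply: (@cvgD _ _ _ (nbhs x)); rewrite !expr2;
  under eq_fun do rewrite expr2;
  apply: (@cvgM _ _ (nbhs x)); apply: (@cvgB _ _ _ (nbhs x)); try exact: cvg_cst;
  exact: coord_continuous.
Qed.

Lemma open_plaque_dom (a : chart_index) :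
  open (chart_disk a `*` [set: transverse_space a]).
Proof.
rewrite openE => -[x t] [xa _]; exists (chart_disk a, setT) => //.
by split; [apply: open_nbhs_nbhs; split => //; exact: open_open_disk|exact: filterT].
Qed.

Lemma chart_in (a : chart_index) p : chart_dom a p -> chart_disk a (chart a p).1.
Proof. by move=> pa; have [/(_ _ pa)[[]]] := chart_homeo a. Qed.

Lemma chartK (a : chart_index) p : chart_dom a p -> chart_inv (chart a p) = p.
Proof. by move=> pa; have [/(_ _ pa)[]] := chart_homeo a. Qed.

Lemma chart_inv_dom (a : chart_index) (z : V * transverse_space a) :
  chart_disk a z.1 -> chart_dom a (chart_inv z).
Proof. by move=> za; have [_ /(_ z (conj za I))[]] := chart_homeo a. Qed.

Lemma chart_invK (a : chart_index) (z : V * transverse_space a) :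
  chart_disk a z.1 -> chart a (chart_inv z) = z.
Proof. by move=> za; have [_ /(_ z (conj za I))[]] := chart_homeo a. Qed.

Lemma chart_continuous (a : chart_index) p : chart_dom a p -> {for p, continuous (chart a)}.
Proof.
move=> pa; have [_ _ ca _] := chart_homeo a.
move: ca; rewrite continuous_open_subspace; last exact: chart_dom_open.
by apply; exact: mem_set.
Qed.

Lemma chart_inv_continuous (a : chart_index) z : chart_disk a z.1 ->
  {for z, continuous (@chart_inv R L a)}.
Proof.
move=> za; have [_ _ _ ca] := chart_homeo a.
move: ca; rewrite continuous_open_subspace; last exact: open_plaque_dom.
by apply; exact: mem_set.
Qed.

Lemma near_chart_dom (a : chart_index) p : chart_dom a p -> \forall q \near p, chart_dom a q.
Proof. by move=> pa; apply: open_nbhs_nbhs; split => //; exact: chart_dom_open. Qed.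

Lemma leaf_open_nbhs (W : set (leaf_space L)) (p : leaf_space L) :
  leaf_open W -> W p -> nbhs p W.
Proof. by move=> oW Wp; apply: open_nbhs_nbhs; split. Qed.

Lemma pair_continuous (T U : topologicalType) (x : T) (t : U) :
  {for x, continuous (fun y : T => (y, t))}.
Proof. by apply: (@cvg_pair _ _ _ (nbhs x)); [exact: cvg_id|exact: cvg_cst]. Qed.

Lemma plaque_continuous (a : chart_index) (x : V) t : chart_disk a x ->
  {for x, continuous (fun y : V => @chart_inv R L a (y, t))}.
Proof.
move=> xa W hW; have hW' := @chart_inv_continuous a (x, t) xa W hW.
exact: (pair_continuous hW').
Qed.

Lemma nbhs_leaf_space (W : set (leaf_space L)) (p : L) :
  nbhs (p : L) W -> nbhs (p : leaf_space L) W.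
Proof.
rewrite nbhsE => -[B [oB Bp] BW].
have lB : leaf_open (B : set (leaf_space L)).
  move=> q Bq a qa; have c := plaque_continuous (t := (chart a q).2) (chart_in qa).
  by apply: c; rewrite /= -surjective_pairing chartK//; exact: open_nbhs_nbhs.
have nB := leaf_open_nbhs lB Bp.
exact: (@filterS _ (nbhs (p : leaf_space L)) _ (B : set (leaf_space L)) W BW nB).
Qed.

(** In another chart, the coordinate [t] is a function of the transverse
    coordinate only, so that it is constant on a neighborhood in the leaf. *)
Lemma plaque_leaf_open (a : chart_index) (A : set V) t : open A -> A `<=` chart_disk a ->
  leaf_open [set p | [/\ chart_dom a p, (chart a p).2 = t & A (chart a p).1] ].
Proof.
move=> oA Aa p [pa pt Ap] b pb.
have [tau htau] := transition_tau a b.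
have pin := chart_in pb.
pose g (x : V) : L := chart_inv (x, (chart b p).2).
have cg : {for ((chart b p).1 : V), continuous g} by exact: plaque_continuous.
have gp : g (chart b p).1 = p by rewrite /g -surjective_pairing chartK.
have n0 : nbhs (p : L) [set q | chart_dom a q /\ A (chart a q).1].
  have h1 : nbhs (p : L) [set q : L | A (chart a q).1].
    have h0 : nbhs (chart a p) [set z : V * transverse_space a | A z.1].
      by apply: cvg_fst; apply: open_nbhs_nbhs.
    exact: (chart_continuous pa h0).
  exact: (filterI (near_chart_dom pa) h1).
have n1 : nbhs ((chart b p).1 : V) [set x | chart_dom a (g x) /\ A (chart a (g x)).1].
  have n0' : nbhs (g (chart b p).1) [set q : L | chart_dom a q /\ A (chart a q).1].
    by rewrite gp.
  exact: (cg _ n0').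
have n3 : nbhs ((chart b p).1 : V) (chart_disk b).
  by apply: open_nbhs_nbhs; split => //; exact: open_open_disk.
have tE : tau (chart b p).2 = t.
  have gpa : chart_dom a (chart_inv (chart b p)) by rewrite chartK.
  by rewrite -pt -(htau _ pin gpa) chartK.
apply: filterS2 n1 n3 => x [ga Ag] xb; split => //.
by rewrite htau.
Qed.

(** The plaques are open in the leaf topology, so that the transverse
    coordinate is locally constant along a leafwise continuous map. *)
Lemma near_plaque (T : topologicalType) (Phi : T -> leaf_space L) (z : T)
    (a : chart_index) : {for z, continuous Phi} -> chart_dom a (Phi z) ->
  nbhs z [set w | chart_dom a (Phi w) /\ (chart a (Phi w)).2 = (chart a (Phi z)).2].
Proof.
move=> cPhi za.
pose P : set (leaf_space L) := [set p | [/\ chart_dom a p,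
  (chart a p).2 = (chart a (Phi z)).2 & chart_disk a (chart a p).1] ].
have oP : leaf_open P.
  by apply: plaque_leaf_open; [exact: open_open_disk|exact: subset_refl].
have Pz : P (Phi z) by split => //; exact: chart_in.
have nP : nbhs z [set w | P (Phi w)] := cPhi _ (leaf_open_nbhs oP Pz).
by apply: filterS nP => w [].
Qed.

Lemma leafwise_continuous (T : topologicalType) (Phi : T -> leaf_space L) (z : T) :
  {for z, continuous Phi} -> {for z, continuous (fun w => Phi w : L)}.
Proof. move=> cPhi W hW; exact: (cPhi _ (nbhs_leaf_space hW)). Qed.

Lemma coord_map_continuous (T : topologicalType) (Phi : T -> leaf_space L) (z : T)
    (a : chart_index) : {for z, continuous Phi} -> chart_dom a (Phi z) ->
  {for z, continuous (fun w => (chart a (Phi w)).1)}.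
Proof.
move=> /leafwise_continuous cPhi za W hW.
have h1 : nbhs (Phi z : L) [set q : L | W (chart a q).1].
  have h0 : nbhs (chart a (Phi z)) [set z : V * transverse_space a | W z.1].
    exact: cvg_fst.
  exact: (chart_continuous za h0).
exact: (cPhi _ h1).
Qed.

Lemma transition_dom_chart (a b : chart_index) p : chart_dom a p -> chart_dom b p ->
  transition_dom a (chart b p).
Proof. by move=> pa pb; split; [exact: chart_in | rewrite /= chartK]. Qed.

Lemma transitionE (a b : chart_index) p : chart_dom b p ->
  transition a (chart b p) = chart a p.
Proof. by move=> pb; rewrite /transition chartK. Qed.

Lemma open_transition_dom (a b : chart_index) : open (transition_dom a (b := b)).
Proof.
rewrite openE => z [zb za].
have n1 : nbhs z [set w | chart_dom a (chart_inv w)] :=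
  chart_inv_continuous zb (near_chart_dom za).
have n2 : nbhs z (chart_disk b `*` [set: transverse_space b]).
  by apply: open_nbhs_nbhs; split => //; exact: open_plaque_dom.
by apply: filterS2 n1 n2 => w /= ? [].
Qed.

End LeafTopology.

Section SmoothFamilies.
Context {R : realType}.
Local Notation V := 'rV[R]_2.

Lemma open_cball (A : set V) x : open A -> A x ->
  exists2 r, 0 < r & [set y | `|y - x| <= r] `<=` A.
Proof.
move=> oA Ax; have /nbhs_ballP[e /= e0 eA] : nbhs x A by exact: open_nbhs_nbhs.
exists (e / 2); first by rewrite divr_gt0.
by move=> y /= yx; apply: eA; rewrite -ball_normE/= distrC; lra.
Qed.

Lemma open_slice (T U : topologicalType) (A : set (T * U)) t : open A -> open [set x | A (x, t)].
Proof.
move=> oA; apply: (@open_comp _ _ (fun x => (x, t)) A) => // x _.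
by apply: cvg_pair; [exact: cvg_id|exact: cvg_cst].
Qed.

(** Continuity in [x] for the parameter [t0] is combined with the uniform
    convergence, on a closed ball about [x0], when [t] tends to [t0]. *)
Lemma smooth_family_continuous (T : topologicalType) (W : normedModType R)
    (A : set (V * T)) (f : V * T -> W) (s : seq 'I_2) z : open A -> A z ->
  smooth_family A f ->
  {for z, continuous (fun z : V * T => partial s (fun x => f (x, z.2)) z.1)}.
Proof.
case: z => x0 t0 oA Az [sm unif].
have [r r0 rA] := open_cball (open_slice t0 oA) Az.
have cx : {for x0, continuous (partial s (fun x => f (x, t0)))}.
  by apply: differentiable_continuous; exact: sm.
apply/cvgrPdist_lt => e e0 /=.
have e2 : 0 < e / 2 by rewrite divr_gt0.
have h1 := unif t0 _ (@compact_cball R x0 r) rA s _ e2.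
have h2 : \forall x \near x0, `|partial s (fun x => f (x, t0)) x0
    - partial s (fun x => f (x, t0)) x| < e / 2.
  by have /cvgrPdist_lt/(_ _ e2) := cx.
have h3 : nbhs (x0 : V) [set x : V | `|x - x0| <= r].
  apply/nbhs_ballP; exists r => // x; rewrite -ball_normE/= distrC => /ltW; exact.
exists ([set x : V | `|partial s (fun x => f (x, t0)) x0
    - partial s (fun x => f (x, t0)) x| < e / 2 /\ `|x - x0| <= r],
  [set t | forall x, `|x - x0| <= r -> `|partial s (fun y => f (y, t)) x
         - partial s (fun y => f (y, t0)) x| < e / 2]).
  by split => //=; exact: filterI.
move=> [x t] [/= [a xr] b].
set A0 := partial _ _ x0; set B := partial s (fun y => f (y, t0)) x in a *.
rewrite -[A0](subrK B) -addrA; apply: le_lt_trans (ler_normD _ _) _.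
have := b x xr; rewrite distrC => b'.
by rewrite (splitr e) ltrD.
Qed.

End SmoothFamilies.

(** * The unit tangent bundle *)

Lemma ultra_fmap (T U : Type) (f : T -> U) (F : set_system T) :
  UltraFilter F -> UltraFilter (f @ F).
Proof.
move=> UF; split; first exact: fmap_proper_filter.
move=> G GP FG; apply/seteqP; split; last exact: FG.
move=> A GA; have [//|FnA] := in_ultra_setVsetC (f @^-1` A) UF.
have GnA : G (~` A) by apply: FG.
by have [x []] := filter_ex (filterI GA GnA).
Qed.

Lemma continuous_near_eq (T U : topologicalType) (f g : T -> U) z :
  nbhs z [set w | g w = f w] -> {for z, continuous g} -> {for z, continuous f}.
Proof.
move=> E c W hW; have hW' : nbhs (g z) W by have e : g z = f z := nbhs_singleton E; rewrite e.
by apply: filterS2 E (c W hW') => w /= ->.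
Qed.

Lemma continuous_at_comp (T U W : topologicalType) (f : T -> U) (g : U -> W) z :
  {for z, continuous f} -> {for f z, continuous g} -> {for z, continuous (fun x => g (f x))}.
Proof. by move=> cf cg A hA; exact: (cf _ (cg _ hA)). Qed.

Lemma derive_compose (R : realType) (f T : 'rV[R]_2 -> 'rV[R]_2) z u :
  differentiable f z -> differentiable T (f z) ->
  'D_u (T \o f) z = u *m jacobian f z *m jacobian T (f z).
Proof.
move=> df dT; rewrite deriveE; last exact: differentiable_comp.
by rewrite diff_comp// /jacobian !mul_rV_lin1.
Qed.

Lemma jacobian_unique (R : realType) (f : 'rV[R]_2 -> 'rV[R]_2) z (M : 'M[R]_2) :
  differentiable f z -> (forall u, 'D_u f z = u *m M) -> jacobian f z = M.
Proof.
by move=> df Df; apply/row_matrixP => i; rewrite !rowE -Df deriveEjacobian.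
Qed.

Section TransitionJacobians.
Context {R : realType} (L : lamination R).
Local Notation V := 'rV[R]_2.
Local Notation chart_index := (chart_index L).

Lemma plaque_leaf_continuous (a : chart_index) (x : V) t : chart_disk a x ->
  {for x, continuous (fun y : V => @chart_inv R L a (y, t) : leaf_space L)}.
Proof.
move=> xa W; rewrite nbhsE => -[B [oB Bp] BW].
have pa : chart_dom a (@chart_inv R L a (x, t)) by exact: chart_inv_dom.
have lB : leaf_open B by [].
have hB := lB _ Bp a pa; rewrite chart_invK//= in hB.
by apply: filterS hB => y /BW.
Qed.

Lemma transition_differentiable (a b : chart_index) (z : V * transverse_space b) :
  transition_dom a z -> differentiable (fun x => (transition a (x, z.2)).1) z.1.
Proof.
case: z => x t za; have [sm _] := transition_smooth a b.
exact: (sm t [::] x za).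
Qed.

Lemma transition_jacobian_continuous (a b : chart_index) (z : V * transverse_space b) :
  transition_dom a z -> {for z, continuous (@transition_jacobian R L a b)}.
Proof.
move=> za; apply: (@cvg_mx R _ (nbhs z)) => i j.
have oT := @open_transition_dom R L a b.
have ci := smooth_family_continuous (s := [:: i]) oT za (transition_smooth a b).
have nT : nbhs z (transition_dom a (b := b)) by exact: open_nbhs_nbhs.
have E w : transition_dom a w -> @transition_jacobian R L a b w i j =
    partial [:: i] (fun x => (chart a (chart_inv (x, w.2))).1) w.1 0 j.
  by move=> wa; rewrite /transition_jacobian jacobianE//; exact: transition_differentiable.
have c2 : {for z, continuous (fun w : V * transverse_space b =>
    partial [:: i] (fun x => (chart a (chart_inv (x, w.2))).1) w.1 0 j)}.
  by apply: (cvg_entry (FF := nbhs_filter z)); exact: ci.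
suff c3 : {for z, continuous (fun w => @transition_jacobian R L a b w i j)} by exact: c3.
by apply: continuous_near_eq c2; apply: filterS nT => w wa; rewrite /= E.
Qed.

(** A leafwise continuous map stays in one plaque, so that its expressions in
    two charts differ by a transition map with the transverse variable
    fixed. *)
Lemma jacobian_change (Phi : V -> leaf_space L) (z : V) (a b : chart_index) :
  {for z, continuous Phi} -> chart_dom a (Phi z) -> chart_dom b (Phi z) ->
  differentiable (fun w => (chart b (Phi w)).1) z ->
  differentiable (fun w => (chart a (Phi w)).1) z /\
  jacobian (fun w => (chart a (Phi w)).1) z =
    jacobian (fun w => (chart b (Phi w)).1) z *m transition_jacobian a (chart b (Phi z)).
Proof.
move=> cPhi za zb db; set t := (chart b (Phi z)).2.
pose T (x : V) := (transition a (x, t)).1.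
have nb := near_plaque cPhi zb.
have E : nbhs z [set w : V | (T \o (fun w => (chart b (Phi w)).1)) w = (chart a (Phi w)).1].
  apply: filterS nb => w /= [wb wt].
  by rewrite /T /t -wt -surjective_pairing transitionE.
have dT : differentiable T (chart b (Phi z)).1.
  exact: (transition_differentiable (transition_dom_chart za zb)).
have dc : differentiable (T \o (fun w => (chart b (Phi w)).1)) z.
  exact: differentiable_comp.
have da : differentiable (fun w => (chart a (Phi w)).1) z.
  exact: near_eq_differentiable E dc.
split => //.
have De u : 'D_u (fun w => (chart a (Phi w)).1) z =
    u *m jacobian (fun w => (chart b (Phi w)).1) z *m jacobian T (chart b (Phi z)).1.
  by rewrite -(near_eq_derive u E); exact: derive_compose.
by apply: (jacobian_unique da) => u; rewrite De mulmxA.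
Qed.

Lemma transition_cocycle (a b c : chart_index) p :
  chart_dom a p -> chart_dom b p -> chart_dom c p ->
  transition_jacobian a (chart c p) =
    transition_jacobian b (chart c p) *m transition_jacobian a (chart b p).
Proof.
move=> pa pb pc.
pose Phi (x : V) : leaf_space L := @chart_inv R L c (x, (chart c p).2).
have E : Phi (chart c p).1 = p by rewrite /Phi -surjective_pairing chartK.
have cPhi : {for (chart c p).1, continuous Phi}.
  by apply: plaque_leaf_continuous; exact: chart_in.
have [|||_] := @jacobian_change Phi (chart c p).1 a b cPhi; rewrite ?E//.
by apply: (transition_differentiable (z := chart c p)); exact: transition_dom_chart.
Qed.

End TransitionJacobians.

Section UnitTangent.
Context {R : realType} (L : hyperbolic_lamination R).
Local Notation V := 'rV[R]_2.
Local Notation T1 := (unit_tangent L).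
Local Notation chart_index := (chart_index L).

Lemma transition_jacobian_id (a : chart_index) p : chart_dom a p ->
  transition_jacobian a (chart a p) = 1%:M.
Proof.
move=> pa; have JJ := transition_cocycle pa pa pa.
have Ju : transition_jacobian a (chart a p) \in unitmx.
  by rewrite unitmxE unitfE gt_eqF//; apply: hyp_oriented; exact: transition_dom_chart.
by have := congr1 (mulmx (invmx (transition_jacobian a (chart a p)))) JJ;
  rewrite mulKmx// mulVmx.
Qed.

Definition metric_at (a : chart_index) (p : L) : 'M[R]_2 := riemannian_metric L a (chart a p).

Lemma metric_change (a b : chart_index) p : chart_dom a p -> chart_dom b p ->
  metric_at b p = transition_jacobian a (chart b p) *m metric_at a p *m
    (transition_jacobian a (chart b p))^T.
Proof.
move=> pa pb; rewrite {1}/metric_at (riemannian_compat (transition_dom_chart pa pb))/=.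
by rewrite (transitionE a pb).
Qed.

Lemma unit_tangent_eq (a : chart_index) (xi eta : T1) : chart_dom a (foot xi) ->
  foot xi = foot eta -> vec xi a = vec eta a -> xi = eta.
Proof.
move=> xa fE vE; have ve : vec xi = vec eta.
  apply/functional_extensionality_dep => b.
  have [xb|xb] := pselect (chart_dom b (foot xi)); last first.
    by rewrite !vec_out// -fE.
  have eb : chart_dom b (foot eta) by rewrite -fE.
  have ea : chart_dom a (foot eta) by rewrite -fE.
  by rewrite (vec_compat xb xa) (vec_compat eb ea) vE fE.
move: fE ve; clear; case: xi eta => [p v a b c] [p' v' a' b' c'] /= pE vE.
by subst p' v'; congr UnitTangent; exact: Prop_irrelevance.
Qed.

Lemma unit_tangent_exists (a : chart_index) (p : L) (v : V) : chart_dom a p ->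
  (v *m metric_at a p *m v^T) 0 0 = 1 -> exists xi : T1, foot xi = p /\ vec xi a = v.
Proof.
move=> pa v1.
pose w b : V := if pselect (chart_dom b p) then v *m transition_jacobian b (chart a p) else 0.
have wE b : chart_dom b p -> w b = v *m transition_jacobian b (chart a p).
  by rewrite /w; case: pselect.
have w_out b : ~ chart_dom b p -> w b = 0 by rewrite /w; case: pselect.
have w_compat b c : chart_dom b p -> chart_dom c p ->
    w b = w c *m transition_jacobian b (chart c p).
  by move=> pb pc; rewrite (wE b pb) (wE c pc) -mulmxA -(transition_cocycle pb pc pa).
have w_unit b : chart_dom b p -> (w b *m riemannian_metric L b (chart b p) *m (w b)^T) 0 0 = 1.
  by move=> pb; rewrite -v1 (metric_change pb pa) (wE b pb) trmx_mul !mulmxA /metric_at.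
exists (UnitTangent w_out w_compat w_unit); split => //=.
by rewrite (wE a pa) (transition_jacobian_id pa) mulmx1.
Qed.

Lemma metric_at_continuous (a : chart_index) p : chart_dom a p ->
  {for p, continuous (metric_at a)}.
Proof.
move=> pa W hW.
have op := @open_plaque_dom R L a.
have inp : (chart_disk a `*` [set: transverse_space a]) (chart a p).
  by split => //; exact: chart_in.
have c := smooth_family_continuous (s := [::]) op inp (@riemannian_smooth R L a).
have hW' : nbhs (chart a p) [set z : V * transverse_space a | W (riemannian_metric L a (z.1, z.2))].
  by apply: c; rewrite /partial /= -surjective_pairing.
have h : nbhs p [set q | W (riemannian_metric L a ((chart a q).1, (chart a q).2))] :=
  chart_continuous pa hW'.
apply: filterS h => q.
by rewrite /= -surjective_pairing.
Qed.

Lemma unit_tangent_base (a : chart_index) (Q : set L) (U : set V) :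
  open Q -> open U -> Q `<=` chart_dom a ->
  open ([set eta | Q (foot eta) /\ U (vec eta a)] : set T1).
Proof.
move=> oQ oU Qa; change (unit_tangent_open [set eta : T1 | Q (foot eta) /\ U (vec eta a)]).
move=> eta /= [Qe Ue] b eb.
have ea := Qa _ Qe.
have nQ : \forall q \near foot eta, Q q /\ chart_dom b q.
  apply: filterI; first exact: open_nbhs_nbhs.
  exact: near_chart_dom.
have cT : (fun qw : L * V => qw.2 *m transition_jacobian a (chart b qw.1))
    @ (nbhs (foot eta, vec eta b)) --> vec eta b *m transition_jacobian a (chart b (foot eta)).
  apply: cvg_mulmx; first exact: cvg_snd.
  have c1 : {for chart b (foot eta), continuous (@transition_jacobian R L a b)}.
    by apply: transition_jacobian_continuous; exact: transition_dom_chart.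
  have c2 : {for foot eta, continuous (fun q => transition_jacobian a (chart b q))}.
    exact: (continuous_at_comp (chart_continuous eb) c1).
  by move=> W hW; exact: (@near_pair1 _ _ (nbhs (foot eta)) (nbhs (vec eta b)) _ _
    [set q | W (transition_jacobian a (chart b q))] (c2 _ hW)).
rewrite -vec_compat// in cT.
have nU : nbhs (foot eta, vec eta b)
    [set qw : L * V | U (qw.2 *m transition_jacobian a (chart b qw.1))] :=
  cT U (open_nbhs_nbhs (conj oU Ue)).
have nQ' : nbhs (foot eta, vec eta b) [set qw : L * V | Q qw.1 /\ chart_dom b qw.1].
  exact: (near_pair1 nQ).
apply: filterS2 nU nQ' => -[q w] /= Uw [Qq qb] zeta zq zw; split; first by rewrite zq.
by rewrite (vec_compat (a := a) (b := b)) ?zq ?zw//; exact: Qa.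
Qed.

(** The topology is defined by all the charts, but the changes of charts are
    continuous, so that one chart around the foot is enough. *)
Lemma near_unit_tangent (a : chart_index) (xi : T1) (W : set T1) : chart_dom a (foot xi) ->
  (nbhs xi W <-> \forall q \near foot xi & v \near vec xi a,
      forall eta : T1, foot eta = q -> vec eta a = v -> W eta).
Proof.
move=> xa; split.
  rewrite nbhsE => -[B [oB Bxi] BW].
  have oB' : unit_tangent_open B by [].
  by apply: filterS (oB' xi Bxi a xa) => -[q v] /= h eta e1 e2; apply: BW; exact: h.
move=> [[Q U] /= [nQ nU] QUW].
have nQa : nbhs (foot xi) [set q | Q q /\ chart_dom a q] .
  by apply: filterI => //; exact: near_chart_dom.
move: nQa; rewrite nbhsE => -[Q' [oQ' Q'x] Q'Q].
move: nU; rewrite nbhsE => -[U' [oU' U'x] U'U].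
have oB := @unit_tangent_base a Q' U' oQ' oU' (fun q h => (Q'Q q h).2).
rewrite nbhsE; exists [set eta : T1 | Q' (foot eta) /\ U' (vec eta a)].
  by split.
move=> eta /= [Qe Ue]; apply: (QUW (foot eta, vec eta a)) => //.
by split; [exact: (Q'Q _ Qe).1|exact: U'U].
Qed.

Lemma foot_continuous (xi : T1) : {for xi, continuous (@foot R L)}.
Proof.
have [a xa] := chart_dom_cover (foot xi).
move=> W hW; apply/(near_unit_tangent _ xa).
by apply: filterS (near_pair1 hW) => -[q v] /= Wq eta -> _.
Qed.

Lemma vec_continuous (a : chart_index) (xi : T1) : chart_dom a (foot xi) ->
  {for xi, continuous (fun eta : T1 => vec eta a)}.
Proof.
move=> xa W hW; apply/(near_unit_tangent _ xa).
by apply: filterS (near_pair2 hW) => -[q v] /= Wq eta _ ->.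
Qed.

Lemma cvg_unit_tangent (T : Type) (F : set_system T) {FF : Filter F} (f : T -> T1)
    (xi : T1) (a : chart_index) : chart_dom a (foot xi) ->
  (fun t => foot (f t)) @ F --> foot xi -> (fun t => vec (f t) a) @ F --> vec xi a ->
  f @ F --> xi.
Proof.
move=> xa c1 c2 W /(near_unit_tangent _ xa) [[Q U] /= [nQ nU] QUW].
have h1 : F [set t | Q (foot (f t))] := c1 _ nQ.
have h2 : F [set t | U (vec (f t) a)] := c2 _ nU.
suff h : F [set t | W (f t)] by exact: h.
apply: filterS2 h1 h2 => t Qt Ut.
by apply: (QUW (foot (f t), vec (f t) a)).
Qed.

(** When the determinant is positive, this bounds the Euclidean norm of the
    vectors that are of norm 1 for [m]. *)
Lemma trace_det_identity (m : 'M[R]_2) (v : V) : m^T = m ->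
  (m 0 0 + m 1 1) * (v *m m *m v^T) 0 0
  = (m 0 0 * m 1 1 - m 0 1 * m 1 0) * (v 0 0 ^+ 2 + v 0 1 ^+ 2)
    + ((v *m m) 0 0 ^+ 2 + (v *m m) 0 1 ^+ 2).
Proof.
move=> mT; have m01 : m 1 0 = m 0 1 by rewrite -{1}mT mxE.
by rewrite !mxE !big_ord2 !mxE !big_ord2 m01; ring.
Qed.

Lemma posdef_entries (m : 'M[R]_2) : m^T = m ->
  (forall v : V, v != 0 -> 0 < (v *m m *m v^T) 0 0) ->
  0 < m 0 0 + m 1 1 /\ 0 < m 0 0 * m 1 1 - m 0 1 * m 1 0.
Proof.
move=> mT pos; have m01 : m 1 0 = m 0 1 by rewrite -{1}mT mxE.
have vn (x y : R) : (x != 0) || (y != 0) -> 0 < x ^+ 2 * m 0 0 + 2 * x * y * m 0 1 + y ^+ 2 * m 1 1.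
  move=> xy; have := pos (x *: bv 0 + y *: bv 1).
  have -> : (x *: bv 0 + y *: bv 1 : V) != 0.
    apply/eqP => /matrixP e; have := e 0 0; have := e 0 1.
    by rewrite !mxE/= !(mulr0, mulr1, addr0, add0r) => y0 x0; rewrite x0 y0 eqxx in xy.
  move=> /(_ isT); rewrite !mxE !big_ord2 !mxE !big_ord2 !mxE/= m01.
  by congr (0 < _); ring.
have m00 : 0 < m 0 0 by have := vn 1 0; rewrite oner_eq0 => /(_ isT); lra.
have m11 : 0 < m 1 1 by have := vn 0 1; rewrite oner_eq0 orbT => /(_ isT); lra.
split; first exact: addr_gt0.
have := vn (- m 0 1) (m 0 0); rewrite (gt_eqF m00) orbT => /(_ isT).
have -> : (- m 0 1) ^+ 2 * m 0 0 + 2 * - m 0 1 * m 0 0 * m 0 1 + m 0 0 ^+ 2 * m 1 1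
   = m 0 0 * (m 0 0 * m 1 1 - m 0 1 * m 1 0) by rewrite m01; ring.
by rewrite pmulr_rgt0.
Qed.

Lemma metric_at_pos (a : chart_index) p : chart_dom a p ->
  let m := metric_at a p in
  [/\ m^T = m, 0 < m 0 0 + m 1 1 & 0 < m 0 0 * m 1 1 - m 0 1 * m 1 0].
Proof.
move=> pa m; have pin := chart_in pa.
have mT : m^T = m by exact: riemannian_sym.
by have [] := posdef_entries mT (@riemannian_posdef R L a _ pin).
Qed.

Lemma unit_vectors_bounded (a : chart_index) p : chart_dom a p ->
  exists C : R, \forall q \near p, forall v : V,
    (v *m metric_at a q *m v^T) 0 0 = 1 -> `|v| <= C.
Proof.
move=> pa; have [mT tr0 det0] := metric_at_pos pa.
set m := metric_at a p in mT tr0 det0.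
pose t := m 0 0 + m 1 1 + 1; pose d := (m 0 0 * m 1 1 - m 0 1 * m 1 0) / 2.
have d0 : 0 < d by rewrite divr_gt0.
have t0 : 0 < t by rewrite ltr_wpDl// ltW.
have cm i j : (fun q => metric_at a q i j) @ (nbhs p) --> metric_at a p i j.
  by apply: (cvg_entry (FF := nbhs_filter p)); exact: metric_at_continuous.
have n1 : \forall q \near p, metric_at a q 0 0 + metric_at a q 1 1 < t.
  have c : (fun q => metric_at a q 0 0 + metric_at a q 1 1) @ (nbhs p) --> m 0 0 + m 1 1.
    by apply: (@cvgD _ _ _ (nbhs p)); exact: cm.
  by apply: (cvgr_lt _ c); rewrite /t ltrDl.
have n2 : \forall q \near p, d < metric_at a q 0 0 * metric_at a q 1 1
    - metric_at a q 0 1 * metric_at a q 1 0.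
  have c : (fun q => metric_at a q 0 0 * metric_at a q 1 1 -
      metric_at a q 0 1 * metric_at a q 1 0) @ (nbhs p) --> m 0 0 * m 1 1 - m 0 1 * m 1 0.
    by apply: (@cvgB _ _ _ (nbhs p)); apply: (@cvgM _ _ (nbhs p)); exact: cm.
  apply: (cvgr_gt _ c); rewrite /d; have det0' := det0; lra.
exists (1 + t / d); apply: filterS3 n1 n2 (near_chart_dom pa) => q q1 q2 qa v v1.
have [qT _ _] := metric_at_pos qa.
have := trace_det_identity v qT; rewrite v1 mulr1.
set D := _ - _ in q2 *; set S := _ + _ in q1 *; set X := (v *m _) 0 0; set Y := (v *m _) 0 1.
move=> E.
have X2 : 0 <= X ^+ 2 := sqr_ge0 _; have Y2 : 0 <= Y ^+ 2 := sqr_ge0 _.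
have s2 : v 0 0 ^+ 2 + v 0 1 ^+ 2 <= t / d.
  rewrite ler_pdivlMr//.
  have : (v 0 0 ^+ 2 + v 0 1 ^+ 2) * d <= (v 0 0 ^+ 2 + v 0 1 ^+ 2) * D.
    by rewrite ler_wpM2l ?addr_ge0 ?sqr_ge0// ltW.
  lra.
have td0 : 0 <= t / d by rewrite divr_ge0// ltW.
have le (x : R) : x ^+ 2 <= t / d -> `|x| <= 1 + t / d.
  by rewrite -real_normK ?num_real// => x2; have : 0 <= `|x| by []; nra.
apply: norm_le_entries; first by rewrite addr_ge0.
move=> i; rewrite ord1; elim/ord2P; apply: le; apply: le_trans s2.
  by rewrite lerDl sqr_ge0.
by rewrite lerDr sqr_ge0.
Qed.

(** The feet of an ultrafilter of unit vectors converge, and in a chart around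
    their limit the vectors are bounded. *)
Lemma unit_tangent_compact : compact [set: T1].
Proof.
rewrite compact_ultra => F UF _.
have [p [_ cp]] : [set: L] `&` [set p | (@foot R L @ F) --> p] !=set0.
  by have := @lam_compact R L; rewrite compact_ultra; apply; [exact: ultra_fmap|exact: (@filterT _ F _)].
have [a pa] := chart_dom_cover p.
have [C nC] := unit_vectors_bounded pa.
have Fa : F [set eta | chart_dom a (foot eta)] by exact: cp (near_chart_dom pa).
have FC : F [set eta | `|vec eta a| <= C].
  have h : F [set eta | forall v : V, (v *m metric_at a (foot eta) *m v^T) 0 0 = 1 -> `|v| <= C].
    exact: cp nC.
  by apply: filterS2 Fa h => eta ea; apply; exact: vec_unit.
have [v [_ cv]] : [set M : V | forall i j, `|M i j| <= C] `&`
    [set v | ((fun eta : T1 => vec eta a) @ F) --> v] !=set0.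
  have := @compact_entries_le R 1 2 C; rewrite compact_ultra; apply; first exact: ultra_fmap.
  suff h : F [set eta | forall i j, `|vec eta a i j| <= C] by exact: h.
  by apply: filterS FC => eta /= h i j; exact: le_trans (entry_le_norm _ _ _) h.
have v1 : (v *m metric_at a p *m v^T) 0 0 = 1.
  have cm : (fun eta : T1 => metric_at a (foot eta)) @ F --> metric_at a p.
    by move=> W hW; exact: (cp _ (metric_at_continuous pa hW)).
  have c1 : (fun eta : T1 => (vec eta a *m metric_at a (foot eta) *m (vec eta a)^T) 0 0) @ F
      --> (v *m metric_at a p *m v^T) 0 0.
    by apply: cvg_entry; apply: cvg_mulmx; [exact: cvg_mulmx|exact: cvg_trmx].
  apply: (cvg_unique _ c1) => //.
  apply: cvg_near_cst; apply: filterS Fa => eta ea; exact: vec_unit.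
have [xi [xp xv]] := unit_tangent_exists pa v1.
exists xi; split => //.
have xa : chart_dom a (foot xi) by rewrite xp.
by apply: (@cvg_unit_tangent _ F _ id xi a xa); rewrite ?xp ?xv.
Qed.

Lemma unit_tangent_hausdorff : hausdorff_space T1.
Proof.
move=> xi eta cl.
have hL : hausdorff_space L by exact: metric_hausdorff.
have hV : hausdorff_space V by exact: norm_hausdorff.
have fE : foot xi = foot eta.
  apply: hL => A B nA nB.
  have [z [Az Bz]] := cl _ _ (foot_continuous nA) (foot_continuous nB).
  by exists (foot z).
have [a xa] := chart_dom_cover (foot xi).
have ea : chart_dom a (foot eta) by rewrite -fE.
apply: (unit_tangent_eq xa fE); apply: hV => A B nA nB.
have [z [Az Bz]] := cl _ _ (vec_continuous xa nA) (vec_continuous ea nB).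
by exists (vec z a).
Qed.

End UnitTangent.

(** * Moebius transformations *)

Section Moebius.
Context {R : realType}.
Local Notation V := 'rV[R]_2.
Local Notation H := (@half_plane R).

(** The real and imaginary parts of the denominator [c z + d], and the square
    of its modulus. *)
Definition den_re (g : 'M[R]_2) (z : V) := g 1 0 * z 0 0 + g 1 1.
Definition den_im (g : 'M[R]_2) (z : V) := g 1 0 * z 0 1.
Definition den_sq (g : 'M[R]_2) (z : V) := den_re g z ^+ 2 + den_im g z ^+ 2.

Lemma moebius_re (g : 'M[R]_2) (z : V) : moebius g z 0 0 =
  ((g 0 0 * z 0 0 + g 0 1) * den_re g z + g 0 0 * z 0 1 * den_im g z) / den_sq g z.
Proof.
rewrite /moebius /of_complex mxE /= /to_complex; simpc => /=.
by rewrite -/(den_re g z) -/(den_im g z) -/(den_sq g z) [RHS]mulrDl !mulrA.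
Qed.

Lemma moebius_im (g : 'M[R]_2) (z : V) : moebius g z 0 1 =
  (g 0 0 * g 1 1 - g 0 1 * g 1 0) * z 0 1 / den_sq g z.
Proof.
rewrite /moebius /of_complex mxE /= /to_complex; simpc => /=.
rewrite -/(den_re g z) -/(den_im g z) -/(den_sq g z) !mulrA -mulNr -mulrDl.
by congr (_ / _); rewrite /den_re /den_im; ring.
Qed.

Lemma den_sq_gt0 (g : 'M[R]_2) (z : V) : SL2 g -> H z -> 0 < den_sq g z.
Proof.
move=> /SL2P dg z0; rewrite /den_sq lt_neqAle addr_ge0 ?sqr_ge0// andbT eq_sym.
rewrite paddr_eq0 ?sqr_ge0// !sqrf_eq0; apply/negP => /andP[/eqP D0 /eqP E0].
have c0 : g 1 0 = 0 by move: E0 => /eqP; rewrite mulf_eq0 (gt_eqF z0) orbF => /eqP.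
move: D0; rewrite /den_re c0 mul0r add0r => d0.
by move: dg; rewrite c0 d0 !mulr0 subrr => /eqP; rewrite eq_sym oner_eq0.
Qed.

Lemma moebius_imE (g : 'M[R]_2) (z : V) : SL2 g -> moebius g z 0 1 = z 0 1 / den_sq g z.
Proof. by move=> /SL2P dg; rewrite moebius_im dg mul1r. Qed.

Lemma half_plane_moebius (g : 'M[R]_2) (z : V) : SL2 g -> H z -> H (moebius g z).
Proof. by move=> sg zH; rewrite /half_plane/= moebius_imE// divr_gt0// den_sq_gt0. Qed.

Lemma to_complex_inj (z w : V) : to_complex z = to_complex w -> z = w.
Proof. by move=> [e0 e1]; apply/rowP; elim/ord2P. Qed.

Lemma to_complexK (w : R[i]) : to_complex (of_complex w) = w.
Proof. by case: w => x y; rewrite /to_complex /of_complex !mxE. Qed.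

Lemma moebius_complex (g : 'M[R]_2) (z : V) : to_complex (moebius g z) =
  ((g 0 0)%:C%C * to_complex z + (g 0 1)%:C%C) / ((g 1 0)%:C%C * to_complex z + (g 1 1)%:C%C).
Proof. exact: to_complexK. Qed.

Lemma moebius_den (g : 'M[R]_2) (z : V) : SL2 g -> H z ->
  (g 1 0)%:C%C * to_complex z + (g 1 1)%:C%C != 0.
Proof.
move=> sg zH; apply/eqP; rewrite /to_complex; simpc => -[D0 E0].
by have := den_sq_gt0 sg zH; rewrite /den_sq /den_re /den_im D0 E0 expr0n addr0 ltxx.
Qed.

Lemma moebiusM (g h : 'M[R]_2) (z : V) : SL2 g -> SL2 h -> H z ->
  moebius (g * h) z = moebius g (moebius h z).
Proof.
move=> sg sh zH; apply: to_complex_inj; rewrite !moebius_complex.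
have n1 := moebius_den sh zH; have n2 := moebius_den sg (half_plane_moebius sh zH).
have n3 := moebius_den (SL2M sg sh) zH.
rewrite moebius_complex in n2.
move: n1 n2 n3; rewrite !mxE !big_ord2.
have cD (x y : R) : (x + y)%:C%C = x%:C%C + y%:C%C by rewrite raddfD.
have cM (x y : R) : (x * y)%:C%C = x%:C%C * y%:C%C by rewrite rmorphM.
rewrite !cD !cM.
move: (to_complex z) (g 0 0)%:C%C (g 0 1)%:C%C (g 1 0)%:C%C (g 1 1)%:C%C
  (h 0 0)%:C%C (h 0 1)%:C%C (h 1 0)%:C%C (h 1 1)%:C%C => w a b c d a' b' c' d' n1 n2 n3.
have n2' : c * (a' * w + b') + d * (c' * w + d') != 0.
  move: n2; rewrite (_ : _ + d = (c * (a' * w + b') + d * (c' * w + d')) / (c' * w + d')).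
    by rewrite mulf_eq0 negb_or => /andP[].
  by field.
by field; rewrite n1 n2'.
Qed.

Lemma moebius1 (z : V) : moebius 1 z = z.
Proof.
apply: to_complex_inj; rewrite moebius_complex !mxE /=.
by rewrite mul1r mul0r add0r addr0 divr1.
Qed.

Lemma moebiusN (g : 'M[R]_2) (z : V) : moebius (- g) z = moebius g z.
Proof.
apply: to_complex_inj; rewrite !moebius_complex !mxE.
have cN (x : R) : (- x)%:C%C = - x%:C%C by rewrite raddfN.
by rewrite !cN !mulNr -!opprD invrN mulrNN.
Qed.

(** In the row-vector convention, multiplication by the derivative
    [1 / (c z + d)^2]. *)
Definition moebius_jacobian (g : 'M[R]_2) (z : V) : 'M[R]_2 :=
  let p := (den_re g z ^+ 2 - den_im g z ^+ 2) / den_sq g z ^+ 2 in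
  let q := - 2 * den_re g z * den_im g z / den_sq g z ^+ 2 in
  mx2 p q (- q) p.

Lemma is_derive_inv (U : normedModType R) (f : U -> R) x v df : f x != 0 ->
  is_derive x v f df -> is_derive x v (fun w => (f w)^-1) (- (f x) ^- 2 * df).
Proof.
move=> fx D; have der := @ex_derive _ _ _ _ _ _ _ D.
apply: DeriveDef; first exact: derivableV.
by rewrite deriveV// derive_val.
Qed.

Lemma is_derive_add (U : normedModType R) (f g : U -> R) x v df dg :
  is_derive x v f df -> is_derive x v g dg ->
  is_derive x v (fun w => f w + g w) (df + dg).
Proof. exact: is_deriveD. Qed.

Lemma is_derive_affine (a b : R) (z v : V) i :
  is_derive z v (fun w : V => a * w 0 i + b) (a * v 0 i).
Proof.
have h := is_derive_add (is_derive_mul (is_derive_cst a z v) (is_derive_coord v z i))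
  (is_derive_cst b z v).
by apply: is_derive_eq h _; rewrite mulr0 !addr0.
Qed.

Lemma is_derive_moebius (g : 'M[R]_2) (z : V) i j : SL2 g -> H z ->
  is_derive z (bv i) (fun w => moebius g w 0 j) (moebius_jacobian g z i j).
Proof.
move=> sg zH; have N0 := den_sq_gt0 sg zH; have dg := sg; rewrite SL2P in dg.
have N0' : den_sq g z != 0 by rewrite gt_eqF.
have dD := is_derive_affine (g 1 0) (g 1 1) z (bv i) 0.
have dE : is_derive z (bv i : V) (den_im g) (g 1 0 * (bv i : V) 0 1).
  have := is_derive_affine (g 1 0) 0 z (bv i) 1.
  by rewrite (_ : (fun w : V => _) = den_im g)//; apply/funext => w; rewrite addr0.
have dA := is_derive_affine (g 0 0) (g 0 1) z (bv i) 0.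
have dY : is_derive z (bv i : V) (fun w : V => g 0 0 * w 0 1) (g 0 0 * (bv i : V) 0 1).
  have := is_derive_affine (g 0 0) 0 z (bv i) 1.
  by rewrite (_ : (fun w : V => _) = (fun w : V => g 0 0 * w 0 1))//; apply/funext => w; rewrite addr0.
have dN := is_derive_inv N0' (is_derive_add (is_derive_mul dD dD) (is_derive_mul dE dE)).
move: j; elim/ord2P.
- have := is_derive_mul (is_derive_add (is_derive_mul dA dD) (is_derive_mul dY dE)) dN.
  rewrite (_ : (fun w : V => _ * _) = (fun w => moebius g w 0 0)); last first.
    by apply/funext => w; rewrite moebius_re /den_sq !expr2.
  move=> h; apply: is_derive_eq h _; rewrite !bvE.
  rewrite -[RHS]mul1r -[X in _ = X * _]dg.
  move: N0'; rewrite /moebius_jacobian /den_sq /den_re /den_im => N0'.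
  move: i {dD dE dA dY dN}; elim/ord2P; rewrite mx2E /=; field; exact: N0'.
- have := is_derive_mul (is_derive_affine 1 0 z (bv i) 1) dN.
  rewrite (_ : (fun w : V => _ * _) = (fun w => moebius g w 0 1)); last first.
    by apply/funext => w; rewrite moebius_imE// mul1r addr0.
  move=> h; apply: is_derive_eq h _; rewrite !bvE.
  move: N0'; rewrite /moebius_jacobian /den_sq /den_re /den_im => N0'.
  by move: i {dD dE dA dY dN}; elim/ord2P; rewrite mx2E /=; field; exact: N0'.
Qed.

Lemma differentiable_rowP (U : normedModType R) (f : U -> V) x :
  (forall j, differentiable (fun w => f w 0 j) x) -> differentiable f x.
Proof.
move=> df; rewrite (_ : f = fun w => f w 0 0 *: (bv 0 : V) + f w 0 1 *: (bv 1 : V)).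
  by apply: differentiableD; apply: differentiableZl.
by apply/funext => w; exact: rV2_basis.
Qed.

Lemma differentiable_mul (U : normedModType R) (f g : U -> R) x :
  differentiable f x -> differentiable g x -> differentiable (fun w => f w * g w) x.
Proof. exact: differentiableM. Qed.

Lemma differentiable_add (U : normedModType R) (f g : U -> R) x :
  differentiable f x -> differentiable g x -> differentiable (fun w => f w + g w) x.
Proof. exact: differentiableD. Qed.

Lemma differentiable_opp (U : normedModType R) (f : U -> R) x :
  differentiable f x -> differentiable (fun w => - f w) x.
Proof. exact: differentiableN. Qed.

Lemma near_half_plane (z : V) : H z -> nbhs z H.
Proof.
move=> z0; have c : (fun w : V => w 0 1) @ nbhs z --> z 0 1 by exact: coord_continuous.
exact: (cvgr_gt _ c).
Qed.

Lemma den_differentiable (g : 'M[R]_2) (z : V) :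
  [/\ differentiable (den_re g) z, differentiable (den_im g) z & differentiable (den_sq g) z].
Proof.
have dc j : differentiable (fun w : V => w 0 j) z by exact: differentiable_coord.
have dk k : differentiable (fun _ : V => k : R) z by exact: differentiable_cst.
have dD : differentiable (den_re g) z.
  by apply: differentiable_add => //; exact: differentiable_mul.
have dE : differentiable (den_im g) z by exact: differentiable_mul.
split => //; rewrite (_ : den_sq g = fun w => den_re g w * den_re g w + den_im g w * den_im g w).
  by apply: differentiable_add; exact: differentiable_mul.
by apply/funext => w; rewrite /den_sq !expr2.
Qed.

Lemma moebius_differentiable (g : 'M[R]_2) (z : V) : SL2 g -> H z ->
  differentiable (moebius g) z.
Proof.
move=> sg zH; have [dD dE dN] := den_differentiable g z.
have N0 : den_sq g z != 0 by rewrite gt_eqF// den_sq_gt0.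
have dc j : differentiable (fun w : V => w 0 j) z by exact: differentiable_coord.
have dk k : differentiable (fun _ : V => k : R) z by exact: differentiable_cst.
have dV : differentiable (fun w => (den_sq g w)^-1) z by exact: differentiableV.
apply: differentiable_rowP; elim/ord2P.
  rewrite (_ : (fun w => _) = fun w : V => ((g 0 0 * w 0 0 + g 0 1) * den_re g w
    + g 0 0 * w 0 1 * den_im g w) * (den_sq g w)^-1); last first.
    by apply/funext => w; exact: moebius_re.
  apply: differentiable_mul => //; apply: differentiable_add; apply: differentiable_mul => //.
    by apply: differentiable_add => //; exact: differentiable_mul.
  exact: differentiable_mul.
rewrite (_ : (fun w => _) = fun w : V => w 0 1 * (den_sq g w)^-1); last first.
  by apply/funext => w; exact: moebius_imE.
exact: differentiable_mul.
Qed.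

Lemma jacobian_moebius (g : 'M[R]_2) (z : V) : SL2 g -> H z ->
  jacobian (moebius g) z = moebius_jacobian g z.
Proof.
move=> sg zH; apply/matrixP => i j; rewrite jacobian_entry; last exact: moebius_differentiable.
by have D := is_derive_moebius i j sg zH; rewrite derive_val.
Qed.

Lemma moebius_twice_diff (g : 'M[R]_2) (z : V) : SL2 g -> H z -> twice_diff (moebius g) z.
Proof.
move=> sg zH; have nH := near_half_plane zH; split.
  by apply: filterS nH => w; exact: moebius_differentiable.
move=> i j; have [dD dE dN] := den_differentiable g z.
have N0 : den_sq g z != 0 by rewrite gt_eqF// den_sq_gt0.
have dV : differentiable (fun w => (den_sq g w)^-1) z by exact: differentiableV.
have dk k : differentiable (fun _ : V => k : R) z by exact: differentiable_cst.
have E : nbhs z [set w | moebius_jacobian g w i j = jacobian (moebius g) w i j].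
  by apply: filterS nH => w wH; rewrite /= jacobian_moebius.
apply: near_eq_differentiable E _.
have dp : differentiable (fun w => (den_re g w * den_re g w - den_im g w * den_im g w)
    * ((den_sq g w)^-1 * (den_sq g w)^-1)) z.
  apply: differentiable_mul; last exact: differentiable_mul.
  apply: differentiable_add; first exact: differentiable_mul.
  by apply: differentiable_opp; exact: differentiable_mul.
have dq : differentiable (fun w => - 2 * den_re g w * den_im g w
    * ((den_sq g w)^-1 * (den_sq g w)^-1)) z.
  apply: differentiable_mul; last exact: differentiable_mul.
  by apply: differentiable_mul => //; exact: differentiable_mul.
have pE w : (den_re g w ^+ 2 - den_im g w ^+ 2) / den_sq g w ^+ 2 =
    (den_re g w * den_re g w - den_im g w * den_im g w) * ((den_sq g w)^-1 * (den_sq g w)^-1).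
  by rewrite !expr2 invfM.
have qE w : - 2 * den_re g w * den_im g w / den_sq g w ^+ 2 =
    - 2 * den_re g w * den_im g w * ((den_sq g w)^-1 * (den_sq g w)^-1).
  by rewrite expr2 invfM.
rewrite /moebius_jacobian; under eq_fun do rewrite pE qE.
move: i j; elim/ord2P; elim/ord2P; under eq_fun do rewrite mx2E;
  [exact: dp|exact: dq| |exact: dp].
exact: (differentiable_opp dq).
Qed.

Lemma moebius_jacobian_conformal (g : 'M[R]_2) (z : V) : SL2 g -> H z ->
  moebius_jacobian g z *m (moebius_jacobian g z)^T = ((den_sq g z ^- 2)%:M : 'M[R]_2).
Proof.
move=> sg zH; have N0 : den_sq g z != 0 by rewrite gt_eqF// den_sq_gt0.
move: N0; rewrite /moebius_jacobian /den_sq; move: (den_re _ _) (den_im _ _) => D E N0.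
by apply: mx2P; rewrite !mxE !big_ord2 !mxE /= !(mulr1n, mulr0n); field.
Qed.

Lemma det_moebius_jacobian (g : 'M[R]_2) (z : V) : SL2 g -> H z ->
  0 < \det (moebius_jacobian g z).
Proof.
move=> sg zH; have N0 := den_sq_gt0 sg zH.
rewrite det_mx2 (_ : _ - _ = den_sq g z ^- 2) ?invr_gt0 ?exprn_gt0//.
have {N0} : den_sq g z != 0 by rewrite gt_eqF.
rewrite /den_sq; move: (den_re _ _) (den_im _ _) => D E N0.
by field.
Qed.

Lemma moebius_isometry (g : 'M[R]_2) (z : V) : SL2 g -> H z ->
  moebius_jacobian g z *m hyperbolic_metric (moebius g z) *m (moebius_jacobian g z)^T
  = hyperbolic_metric z.
Proof.
move=> sg zH; rewrite /hyperbolic_metric mul_mx_scalar -scalemxAl moebius_jacobian_conformal//.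
rewrite scale_scalar_mx moebius_imE//; congr (_%:M).
have N0 : den_sq g z != 0 by rewrite gt_eqF// den_sq_gt0.
have z0 : z 0 1 != 0 by rewrite gt_eqF.
by field; rewrite ?N0 ?z0.
Qed.

Lemma cvg_moebius (T : Type) (F : set_system T) {FF : Filter F} (G : T -> 'M[R]_2)
    (Z : T -> V) g z : SL2 g -> H z -> G @ F --> g -> Z @ F --> z ->
  (fun t => moebius (G t) (Z t)) @ F --> moebius g z /\
  (fun t => moebius_jacobian (G t) (Z t)) @ F --> moebius_jacobian g z.
Proof.
move=> sg zH cG cZ; have N0 : den_sq g z != 0 by rewrite gt_eqF// den_sq_gt0.
have cg i j : (fun t => G t i j) @ F --> g i j by exact: cvg_entry.
have cz j : (fun t => Z t 0 j) @ F --> z 0 j by exact: cvg_entry.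
have cD : (fun t => den_re (G t) (Z t)) @ F --> den_re g z.
  by apply: (@cvgD _ _ _ F) => //; exact: (@cvgM _ _ F).
have cE : (fun t => den_im (G t) (Z t)) @ F --> den_im g z.
  by apply: (@cvgM _ _ F).
have cN : (fun t => den_sq (G t) (Z t)) @ F --> den_sq g z.
  rewrite /den_sq expr2 (expr2 (den_im g z)); under eq_fun do rewrite expr2 (expr2 (den_im _ _)).
  by apply: (@cvgD _ _ _ F); apply: (@cvgM _ _ F).
have cV : (fun t => (den_sq (G t) (Z t))^-1) @ F --> (den_sq g z)^-1 by exact: cvgV.
split.
  apply: cvg_mx => i; rewrite ord1; elim/ord2P.
    rewrite moebius_re; under eq_fun do rewrite moebius_re.
    apply: (@cvgM _ _ F) => //; apply: (@cvgD _ _ _ F); apply: (@cvgM _ _ F) => //.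
      by apply: (@cvgD _ _ _ F) => //; exact: (@cvgM _ _ F).
    exact: (@cvgM _ _ F).
  rewrite moebius_im; under eq_fun do rewrite moebius_im.
  apply: (@cvgM _ _ F) => //; apply: (@cvgM _ _ F) => //.
  by apply: (@cvgB _ _ _ F); exact: (@cvgM _ _ F).
have cp : (fun t => (den_re (G t) (Z t) ^+ 2 - den_im (G t) (Z t) ^+ 2) / den_sq (G t) (Z t) ^+ 2)
    @ F --> (den_re g z ^+ 2 - den_im g z ^+ 2) / den_sq g z ^+ 2.
  rewrite !expr2 invfM; under eq_fun do rewrite !expr2 invfM.
  apply: (@cvgM _ _ F); last exact: (@cvgM _ _ F).
  by apply: (@cvgB _ _ _ F); exact: (@cvgM _ _ F).
have cq : (fun t => - 2 * den_re (G t) (Z t) * den_im (G t) (Z t) / den_sq (G t) (Z t) ^+ 2)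
    @ F --> - 2 * den_re g z * den_im g z / den_sq g z ^+ 2.
  rewrite !expr2 invfM; under eq_fun do rewrite !expr2 invfM.
  apply: (@cvgM _ _ F); last exact: (@cvgM _ _ F).
  apply: (@cvgM _ _ F) => //; apply: (@cvgM _ _ F) => //; exact: cvg_cst.
by apply: cvg_mx2 => //; exact: cvgN.
Qed.

Local Notation i0 := (bv 1 : V).

Lemma half_plane_i0 : H i0.
Proof. by rewrite /half_plane/= mxE/=. Qed.

Lemma den_sq_i0 (g : 'M[R]_2) : den_sq g i0 = g 1 1 ^+ 2 + g 1 0 ^+ 2.
Proof. by rewrite /den_sq /den_re /den_im !mxE/= mulr0 add0r mulr1. Qed.

Lemma moebius_i0 (g : 'M[R]_2) : SL2 g ->
  moebius g i0 0 0 = (g 0 1 * g 1 1 + g 0 0 * g 1 0) / den_sq g i0 /\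
  moebius g i0 0 1 = (den_sq g i0)^-1.
Proof.
move=> sg; rewrite moebius_re moebius_imE// /den_re /den_im !mxE /=.
by rewrite !(mulr0, add0r, mulr1) mul1r.
Qed.

Lemma moebius_jacobian_i0 (g : 'M[R]_2) :
  (i0 *m moebius_jacobian g i0) 0 0 = 2 * g 1 1 * g 1 0 / den_sq g i0 ^+ 2 /\
  (i0 *m moebius_jacobian g i0) 0 1 = (g 1 1 ^+ 2 - g 1 0 ^+ 2) / den_sq g i0 ^+ 2.
Proof.
rewrite -rowE !mxE /= /den_re /den_im !mxE /= !(mulr0, add0r, mulr1).
by split => //; rewrite !mulNr opprK.
Qed.

(** The bottom row [(c, d)] is given by a complex square root, since the
    derivative at [i] is [1 / (c i + d)^2]; the top row is then determined by
    the image of [i]. *)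
Lemma moebius_frame (z u : V) : H z -> u 0 0 ^+ 2 + u 0 1 ^+ 2 = z 0 1 ^+ 2 ->
  exists g, [/\ SL2 g, moebius g i0 = z & i0 *m moebius_jacobian g i0 = u].
Proof.
move=> z0 uu; set x := z 0 0; set y := z 0 1 in uu; have y0 : 0 < y by [].
have := sqr_sqrtc (Complex (u 0 1 / y ^+ 2) (u 0 0 / y ^+ 2)).
case: (sqrtc _) => d c; rewrite expr2; simpc => -[e1 e2].
have yn : y != 0 by rewrite gt_eqF.
have N2 : (d ^+ 2 + c ^+ 2) ^+ 2 = y^-1 ^+ 2.
  have -> : (d ^+ 2 + c ^+ 2) ^+ 2 = (d * d - c * c) ^+ 2 + (d * c + c * d) ^+ 2 by ring.
  have -> : (d * c + c * d) = u 0 0 / y ^+ 2 by rewrite -e2.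
  rewrite e1 !expr_div_n -mulrDl addrC uu; by field.
have N : d ^+ 2 + c ^+ 2 = y^-1.
  apply/eqP; rewrite -(@eqrXn2 _ 2) ?N2// ?addr_ge0 ?sqr_ge0 ?invr_ge0// ltW//.
pose a := d * y + x * c; pose b := - c * y + x * d.
have sg : SL2 (mx2 a b c d).
  apply/SL2_mx2; rewrite /a /b.
  have -> : (d * y + x * c) * d - (- c * y + x * d) * c = (d ^+ 2 + c ^+ 2) * y by ring.
  by rewrite N mulVf.
exists (mx2 a b c d); split => //.
  have [h0 h1] := moebius_i0 sg; rewrite den_sq_i0 !mx2E N invrK in h0 h1.
  apply/rowP; elim/ord2P => //; rewrite h0 /a /b.
  have -> : (- c * y + x * d) * d + (d * y + x * c) * c = x * (d ^+ 2 + c ^+ 2) by ring.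
  by rewrite N mulfVK.
have [h0 h1] := moebius_jacobian_i0 (mx2 a b c d); rewrite den_sq_i0 !mx2E N in h0 h1.
apply/rowP; elim/ord2P; rewrite ?h0 ?h1.
  have -> : 2 * d * c = u 0 0 / y ^+ 2 by rewrite -e2; ring.
  by field.
have -> : d ^+ 2 - c ^+ 2 = u 0 1 / y ^+ 2 by rewrite -e1; ring.
by field.
Qed.

(** The image of the vector determines [c d] and [d^2 - c^2], hence [(c, d)] up
    to sign; the image of [i] then determines [(a, b)]. *)
Lemma moebius_frame_unique (g h : 'M[R]_2) : SL2 g -> SL2 h ->
  moebius g i0 = moebius h i0 ->
  i0 *m moebius_jacobian g i0 = i0 *m moebius_jacobian h i0 -> g = h \/ g = - h.
Proof.
move=> sg sh mE jE.
have [g0 g1] := moebius_i0 sg; have [h0 h1] := moebius_i0 sh.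
have [jg0 jg1] := moebius_jacobian_i0 g; have [jh0 jh1] := moebius_jacobian_i0 h.
have Ng := den_sq_gt0 sg half_plane_i0; have Nh := den_sq_gt0 sh half_plane_i0.
rewrite mE jE in g0 g1 jg0 jg1.
have NE : den_sq g i0 = den_sq h i0 by apply: invr_inj; rewrite -g1 -h1.
have N0 : den_sq h i0 != 0 by rewrite gt_eqF.
have N2 : den_sq h i0 ^+ 2 != 0 by rewrite expf_neq0.
rewrite {}g0 NE in h0; rewrite {}jg0 NE in jh0; rewrite {}jg1 NE in jh1.
have {h0}eb := mulIf (invr_neq0 N0) h0; have {jh0}ep := mulIf (invr_neq0 N2) jh0.
have {jh1}em := mulIf (invr_neq0 N2) jh1.
have sg' := sg; have sh' := sh; rewrite SL2P in sg'; rewrite SL2P in sh'.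
rewrite !den_sq_i0 in NE N0.
suff : mx2 (g 0 0) (g 0 1) (g 1 0) (g 1 1) = mx2 (h 0 0) (h 0 1) (h 1 0) (h 1 1) \/
    mx2 (g 0 0) (g 0 1) (g 1 0) (g 1 1) = - mx2 (h 0 0) (h 0 1) (h 1 0) (h 1 1).
  by rewrite -!mx2_eta.
rewrite mx2N; move: eb ep em sg' sh' NE N0.
move: (g 0 0) (g 0 1) (g 1 0) (g 1 1) (h 0 0) (h 0 1) (h 1 0) (h 1 1) => a b c d a' b' c' d'.
clear => eb ep em sg sh NE N0.
have d2 : (d - d') * (d + d') = 0 by nra.
have c2 : (c - c') * (c + c') = 0 by nra.
have dc : d * c = d' * c' by nra.
have key : (d = d' /\ c = c') \/ (d = - d' /\ c = - c').
  move/eqP: d2; rewrite mulf_eq0 subr_eq0 addr_eq0 => /orP[]/eqP ed;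
  move/eqP: c2; rewrite mulf_eq0 subr_eq0 addr_eq0 => /orP[]/eqP ec; subst c d.
  - by left.
  - have : d' * c' = 0 by lra.
    by move/eqP; rewrite mulf_eq0 => /orP[]/eqP ->; [right|left]; rewrite ?oppr0.
  - have : d' * c' = 0 by lra.
    by move/eqP; rewrite mulf_eq0 => /orP[]/eqP ->; [left|right]; rewrite ?oppr0.
  - by right.
have solve (p q r t : R) : p * t - q * r = 1 ->
    p * (t ^+ 2 + r ^+ 2) = t + (q * t + p * r) * r /\
    q * (t ^+ 2 + r ^+ 2) = - r + (q * t + p * r) * t.
  move=> e; have et : t = t * (p * t - q * r) by rewrite e mulr1.
  have er : r = r * (p * t - q * r) by rewrite e mulr1.
  by split; [rewrite [X in _ = X + _]et|rewrite [X in _ = - X + _]er]; ring.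
have [aE bE] := solve _ _ _ _ sg; have [aE' bE'] := solve _ _ _ _ sh.
rewrite NE in aE bE; rewrite -eb in aE' bE'.
case: key => -[ed ec]; [left|right]; congr mx2 => //; apply: (mulIf N0).
- by rewrite aE aE' ed ec.
- by rewrite bE bE' ed ec.
- transitivity (- (a' * (d' ^+ 2 + c' ^+ 2))); last by ring.
  by rewrite aE aE' ed ec; ring.
- transitivity (- (b' * (d' ^+ 2 + c' ^+ 2))); last by ring.
  by rewrite bE bE' ed ec; ring.
Qed.

End Moebius.

(** * Developing maps *)

Lemma mulmx2E (R : realType) (A B : 'M[R]_2) i j :
  (A *m B) i j = A i 0 * B 0 j + A i 1 * B 1 j.
Proof. by rewrite mxE big_ord2. Qed.

Lemma differentiable_compose (R : realType) (f : 'rV[R]_2 -> 'rV[R]_2) (h : 'rV[R]_2 -> R) z :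
  differentiable f z -> differentiable h (f z) -> differentiable (fun w => h (f w)) z.
Proof. exact: differentiable_comp. Qed.

Section DevelopingMaps.
Context {R : realType} (L : hyperbolic_lamination R).
Local Notation V := 'rV[R]_2.
Local Notation H := (@half_plane R).
Local Notation chart_index := (chart_index L).

Definition in_chart (a : chart_index) (Phi : V -> leaf_space L) (w : V) : V :=
  (chart a (Phi w)).1.

(** [Phi] is a local isometry, preserving the orientation, from the hyperbolic
    plane to a leaf. *)
Definition developing_at (Phi : V -> leaf_space L) (z : V) :=
  {for z, continuous Phi} /\ forall a, chart_dom a (Phi z) ->
  [/\ twice_diff (in_chart a Phi) z, 0 < \det (jacobian (in_chart a Phi) z) &
    jacobian (in_chart a Phi) z *m metric_at a (Phi z) *m (jacobian (in_chart a Phi) z)^T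
      = hyperbolic_metric z].

Definition developing (Phi : V -> leaf_space L) := forall z, H z -> developing_at Phi z.

Lemma open_half_plane : open H.
Proof. by rewrite openE => z zH; exact: near_half_plane. Qed.

Lemma uniformizes_continuous l G pi z : uniformizes (riemannian_metric L) l G pi -> H z ->
  {for z, continuous pi}.
Proof.
move=> [_ cpi _ _ _] zH; move: cpi.
rewrite continuous_open_subspace; last exact: open_half_plane.
by apply; exact: mem_set.
Qed.

Lemma uniformizes_developing l G pi : uniformizes (riemannian_metric L) l G pi -> developing pi.
Proof.
move=> U z zH; have cpi := uniformizes_continuous U zH; split => //.
move=> a za; have [_ _ _ _ /(_ a)[sm loc]] := U.
have [detJ isoJ] := loc z (conj zH za).
pose O' := interior (H `&` [set w | chart_dom a (pi w)]).
have nO : nbhs z (H `&` [set w | chart_dom a (pi w)]).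
  apply: filterI; first exact: near_half_plane.
  by apply: filterS (near_plaque cpi za) => w [].
split => //; apply: (@smooth_twice_diff R O'); first exact: open_interior.
  exact: nO.
by move=> s x /interior_subset; exact: sm.
Qed.

Lemma twice_diff_comp (f mu : V -> V) z : twice_diff mu z -> twice_diff f (mu z) ->
  twice_diff (f \o mu) z /\
  jacobian (f \o mu) z = jacobian mu z *m jacobian f (mu z).
Proof.
move=> [dmu dJmu] [df dJf].
have cmu : {for z, continuous mu} by exact/differentiable_continuous/(nbhs_singleton dmu).
have df' : nbhs z [set w | differentiable f (mu w)] := cmu _ df.
have J w : differentiable mu w -> differentiable f (mu w) ->
    jacobian (f \o mu) w = jacobian mu w *m jacobian f (mu w).
  move=> d1 d2; apply: jacobian_unique; first exact: differentiable_comp.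
  by move=> u; rewrite derive_compose// mulmxA.
have Jz := J z (nbhs_singleton dmu) (nbhs_singleton df).
split; last exact: Jz.
split.
  by apply: filterS2 dmu df' => w d1 d2; exact: differentiable_comp.
move=> i j.
have E : nbhs z [set w | jacobian mu w i 0 * jacobian f (mu w) 0 j
    + jacobian mu w i 1 * jacobian f (mu w) 1 j = jacobian (f \o mu) w i j].
  by apply: filterS2 dmu df' => w d1 d2; rewrite /= (J w d1 d2) mulmx2E.
apply: near_eq_differentiable E _.
have dc k : differentiable (fun w => jacobian f (mu w) k j) z.
  exact: (differentiable_compose (h := fun x => jacobian f x k j) (nbhs_singleton dmu) (dJf k j)).
by apply: differentiable_add; apply: differentiable_mul; [exact: dJmu|exact: dc|exact: dJmu|exact: dc].
Qed.

Lemma moebius_continuous (g : 'M[R]_2) z : SL2 g -> H z -> {for z, continuous (moebius g)}.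
Proof. by move=> sg zH; exact/differentiable_continuous/moebius_differentiable. Qed.

Lemma developing_moebius_jacobian Phi (g : 'M[R]_2) z a : developing Phi -> SL2 g -> H z ->
  chart_dom a (Phi (moebius g z)) ->
  twice_diff (in_chart a (Phi \o moebius g)) z /\
  jacobian (in_chart a (Phi \o moebius g)) z =
    moebius_jacobian g z *m jacobian (in_chart a Phi) (moebius g z).
Proof.
move=> dPhi sg zH za; have gH := half_plane_moebius sg zH.
have [_ /(_ a za)[tf _ _]] := dPhi _ gH.
have [t E] := twice_diff_comp (moebius_twice_diff sg zH) tf.
by split; [exact: t|rewrite -jacobian_moebius].
Qed.

Lemma developing_moebius Phi (g : 'M[R]_2) : developing Phi -> SL2 g ->
  developing (Phi \o moebius g).
Proof.
move=> dPhi sg z zH; have gH := half_plane_moebius sg zH.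
have [cPhi loc] := dPhi _ gH; split.
  by apply: continuous_at_comp; [exact: moebius_continuous|exact: cPhi].
move=> a za; have [tf detf isof] := loc a za.
have [t E] := developing_moebius_jacobian dPhi sg zH za.
split; first exact: t.
  by rewrite E det_mulmx mulr_gt0//; exact: det_moebius_jacobian.
by rewrite E -(moebius_isometry sg zH) -isof trmx_mul !mulmxA.
Qed.

Lemma developing_plaque Phi z a : developing Phi -> H z -> chart_dom a (Phi z) ->
  nbhs z [set w | chart_dom a (Phi w) /\ (chart a (Phi w)).2 = (chart a (Phi z)).2].
Proof. by move=> dPhi zH za; apply: near_plaque => //; have [] := dPhi z zH. Qed.

Lemma developing_isometric Phi z a : developing Phi -> H z -> chart_dom a (Phi z) ->
  isometric_at (in_chart a Phi) (fun x => riemannian_metric L a (x, (chart a (Phi z)).2)) z.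
Proof.
move=> dPhi zH za; have [_ /(_ a za)[tf _ _]] := dPhi z zH.
have zin := chart_in za; split => //.
- have [sm _] := @riemannian_smooth R L a.
  exact: (sm (chart a (Phi z)).2 [::] (chart a (Phi z)).1).
- by apply: riemannian_sym.
- apply: filterS2 (developing_plaque dPhi zH za) (near_half_plane zH) => w [wa wt] wH.
  have [_ /(_ a wa)[_ _ <-]] := dPhi w wH.
  by rewrite /metric_at /in_chart -wt -surjective_pairing.
Qed.

Lemma metric_deriv_lipschitz (a : chart_index) t (x1 : V) (sigma : R) :
  [set x | `|x - x1| <= sigma] `<=` chart_disk a -> forall r p q,
  exists2 C : R, 0 <= C & forall x y : V, `|x - x1| <= sigma -> `|y - x1| <= sigma ->
    let m := fun x => riemannian_metric L a (x, t) in
     `|'D_(bv r) m x p q| <= C /\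
     `|'D_(bv r) m x p q - 'D_(bv r) m y p q| <= C * `|x - y|.
Proof.
move=> sub r p q; have [sm _] := @riemannian_smooth R L a.
have inA x : chart_disk a x -> (chart_disk a `*` [set: transverse_space a]) (x, t) by [].
pose m x := riemannian_metric L a (x, t).
have dD s x : chart_disk a x -> differentiable (partial s m) x by move=> xa; exact: sm.
apply: (@lipschitz_cball R (fun x => 'D_(bv r) m x p q)).
  by move=> x /sub xa; apply: differentiable_entry; exact: (dD [:: r]).
move=> i x /sub xa.
apply: near_eq_differentiable (differentiable_entry p q (dD [:: i; r] x xa)).
have nx : nbhs x (chart_disk a) by apply: open_nbhs_nbhs; split => //; exact: open_open_disk.
apply: filterS nx => y ya; rewrite /partial /= derive_mx ?mxE//.
by apply: diff_derivable; exact: (dD [:: r]).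
Qed.

Lemma metric_deriv_near (a : chart_index) t0 (x1 : V) (sigma : R) (eta : R) :
  [set x | `|x - x1| <= sigma] `<=` chart_disk a -> 0 < eta ->
  \forall t \near t0, forall x : V, `|x - x1| <= sigma ->
    metric_deriv_close (fun x => riemannian_metric L a (x, t))
      (fun x => riemannian_metric L a (x, t0)) eta x.
Proof.
move=> sub eta0; have [_ cl] := @riemannian_smooth R L a.
have h r := cl t0 _ (@compact_cball R x1 sigma) (fun x hx => conj (sub x hx) I) [:: r] eta eta0.
have h' : nbhs t0 [set t | forall r, forall x : V, `|x - x1| <= sigma ->
  `|partial [:: r] (fun y => riemannian_metric L a (y, t)) x
         - partial [:: r] (fun y => riemannian_metric L a (y, t0)) x| < eta].
  exact: (@filter_forall _ _ _ (nbhs t0) _ h).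
apply: filterS h' => t ht x xs r p q.
apply: le_trans (ltW (ht r x xs)); rewrite /partial/=.
have E (A B : 'M[R]_2) : A p q - B p q = (A - B) p q by rewrite !mxE.
by rewrite E; exact: entry_le_norm.
Qed.

End DevelopingMaps.

(** * Convergence of developing maps *)

Section Comparison.
Context {R : realType} (L : hyperbolic_lamination R).
Local Notation V := 'rV[R]_2.
Local Notation H := (@half_plane R).
Local Notation chart_index := (chart_index L).

Lemma cvg_comp_at (T : Type) (U W : topologicalType) (K : set_system T) (f : T -> U)
    (g : U -> W) (y : U) : f @ K --> y -> {for y, continuous g} -> (fun t => g (f t)) @ K --> g y.
Proof. by move=> fy gy A hA; exact: (fy _ (gy _ hA)). Qed.

Lemma cvg_near_eq (T : Type) (U : topologicalType) (K : set_system T) {FK : Filter K}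
    (f g : T -> U) (y : U) : K [set t | f t = g t] -> f @ K --> y -> g @ K --> y.
Proof.
move=> fg fy A hA; have h : K [set t | A (f t)] := fy _ hA.
suff h' : K [set t | A (g t)] by exact: h'.
by apply: filterS2 fg h => t /= ->.
Qed.

Lemma left_limit_closed (T : topologicalType) (h : R -> T) (s : R) (C : set T) :
  0 < s -> {for s, continuous h} -> closed C ->
  (forall t, 0 <= t -> t < s -> C (h t)) -> C (h s).
Proof.
move=> s0 ch cC hC; apply: contrapT => nC.
have nbC : nbhs (h s) (~` C) by apply: open_nbhs_nbhs; split => //; rewrite openC.
have /nbhs_ballP[e /= e0 he] : nbhs s [set t | (~` C) (h t)] := ch _ nbC.
pose d := Num.min (e / 2) s.
have d0 : 0 < d by rewrite lt_min s0 divr_gt0.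
have d1 : d <= e / 2 by rewrite ge_min lexx.
have d2 : d <= s by rewrite ge_min lexx orbT.
have bd : ball s e (s - d).
  by rewrite -ball_normE/= opprB addrC subrK gtr0_norm//; lra.
by apply: (he _ bd); apply: hC; lra.
Qed.

Lemma developing_line Phi (z e : V) (s : R) : developing (L := L) Phi -> H (z + s *: e) ->
  {for s, continuous (fun t : R => Phi (z + t *: e))}.
Proof.
move=> dPhi sH; apply: (@continuous_at_comp _ _ _ (fun t : R => z + t *: e) Phi s); last first.
  by have [] := dPhi _ sH.
apply: (@cvgD _ _ _ (nbhs s)); first exact: cvg_cst.
by apply: (@cvgZr_tmp _ _ _ (nbhs s)); exact: cvg_id.
Qed.

(** The image of a closed ball of a plaque is compact, hence closed, so that a
    path that leaves the domain of the chart must first leave the ball. *)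
Lemma plaque_limit Phi (z e : V) (s : R) (a : chart_index) t (x1 : V) (sigma : R) :
  developing (L := L) Phi -> 0 < s -> H (z + s *: e) ->
  [set x | `|x - x1| <= sigma] `<=` chart_disk a ->
  (forall u, 0 <= u -> u < s -> [/\ chart_dom a (Phi (z + u *: e)),
    (chart a (Phi (z + u *: e))).2 = t & `|in_chart a Phi (z + u *: e) - x1| <= sigma]) ->
  [/\ chart_dom a (Phi (z + s *: e)),
    (chart a (Phi (z + s *: e))).2 = t & `|in_chart a Phi (z + s *: e) - x1| <= sigma].
Proof.
move=> dPhi s0 sH sub before.
pose K := [set x : V | `|x - x1| <= sigma].
pose g (x : V) : L := @chart_inv R L a (x, t).
have cK : compact (g @` K).
  apply: continuous_compact; last exact: compact_cball.
  apply: continuous_in_subspaceT => x; rewrite inE => /sub xa.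
  exact: plaque_continuous.
have clK : closed (g @` K) by apply: compact_closed => //; exact: metric_hausdorff.
have ch : {for s, continuous (fun u : R => Phi (z + u *: e) : L)}.
  by apply: (leafwise_continuous (L := L)); exact: developing_line.
have [x Kx gx] : (g @` K) (Phi (z + s *: e)).
  apply: (left_limit_closed s0 ch clK) => u u0 us; have [ua ut uK] := before u u0 us.
  by exists (in_chart a Phi (z + u *: e)) => //; rewrite /g /in_chart -ut -surjective_pairing chartK.
have xa : chart_disk a x by exact: sub.
rewrite /in_chart -gx /g; split; first exact: chart_inv_dom.
  by rewrite chart_invK.
by rewrite chart_invK.
Qed.

Section Family.
Context (I : Type) (F : set_system I) {FF : ProperFilter F}.
Context (Ph : I -> V -> leaf_space L) (Phi0 : V -> leaf_space L).
Hypotheses (dPh : forall i, developing (Ph i)) (dPhi0 : developing Phi0).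

(** A bootstrap along the segment from [z2] to [w]. As long as the 1-jets are
    at distance at most [eps], the map stays in a compact part of its plaque,
    on which the metrics of close leaves are close; [jet_comparison] then makes
    the inequality strict, and it extends further along the segment. *)
Lemma local_convergence (z1 : V) (a : chart_index) : H z1 -> chart_dom a (Phi0 z1) ->
  exists rho, [/\ 0 < rho, (forall w : V, `|w - z1| <= rho -> [/\ H w, chart_dom a (Phi0 w) &
    (chart a (Phi0 w)).2 = (chart a (Phi0 z1)).2]) &
  forall z2 : V, `|z2 - z1| <= rho ->
    (fun i => Ph i z2 : L) @ F --> (Phi0 z2 : L) ->
    (fun i => jacobian (in_chart a (Ph i)) z2) @ F --> jacobian (in_chart a Phi0) z2 ->
    forall eps, 0 < eps -> F [set i | forall w : V, `|w - z1| <= rho ->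
      [/\ chart_dom a (Ph i w), (chart a (Ph i w)).2 = (chart a (Ph i z2)).2 &
        jet_dist (in_chart a (Ph i)) (in_chart a Phi0) w <= eps] ] ].
Proof.
move=> z1H z1a; set f0 := in_chart a Phi0; set t0 := (chart a (Phi0 z1)).2.
have [sigma sigma0 sub] := open_cball (@open_open_disk R _ _) (chart_in z1a).
have plaque0 := developing_plaque dPhi0 z1H z1a.
have iso0 : \forall w \near z1, isometric_at f0 (fun x => riemannian_metric L a (x, t0)) w.
  apply: filterS2 plaque0 (near_half_plane z1H) => w [wa wt] wH.
  by have := developing_isometric dPhi0 wH wa; rewrite wt.
have lip := metric_deriv_lipschitz t0 sub.
have [rho0 rho00 comp] := jet_comparison z1H iso0 lip sigma0.
have cf0 : {for z1, continuous f0}.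
  by apply: coord_map_continuous => //; have [] := dPhi0 z1H.
have [r r0 hr] : exists2 r, 0 < r & forall w : V, `|w - z1| <= r ->
    [/\ H w, chart_dom a (Phi0 w), (chart a (Phi0 w)).2 = t0 & `|f0 w - f0 z1| <= sigma / 2].
  have n1 : nbhs z1 [set w : V | `|f0 w - f0 z1| <= sigma / 2].
    have s2 : 0 < sigma / 2 by rewrite divr_gt0.
    by have /cvgr_dist_le/(_ _ s2) := cf0; apply: filterS => w; rewrite /= distrC.
  have n2 : nbhs z1 [set w | [/\ H w, chart_dom a (Phi0 w), (chart a (Phi0 w)).2 = t0 &
      `|f0 w - f0 z1| <= sigma / 2] ].
    by apply: filterS3 plaque0 (near_half_plane z1H) n1 => w [].
  have /nbhs_ballP[r /= r0 hr] := n2.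
  exists (r / 2); first by rewrite divr_gt0.
  move=> w wr; have bw : ball z1 r w by rewrite -ball_normE/= distrC; lra.
  exact: hr w bw.
pose rho := Num.min r rho0.
have rhor : rho <= r by rewrite ge_min lexx.
have rhorho0 : rho <= rho0 by rewrite ge_min lexx orbT.
exists rho; split; first by rewrite lt_min r0.
  by move=> w wz; have [] := hr w (le_trans wz rhor).
move=> z2 z2r cvP cvJ eps0 eps00.
pose eps := Num.min eps0 (Num.min (1 / 2) (sigma / 2)).
have eps_gt0 : 0 < eps by rewrite !lt_min eps00 !divr_gt0.
have epsle : eps <= eps0 by rewrite ge_min lexx.
have eps1 : eps <= 1 / 2 by rewrite !ge_min lexx !orbT.
have epss : eps <= sigma / 2 by rewrite !ge_min lexx !orbT.
have [z2H z2a z2t _] := hr z2 (le_trans z2r rhor).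
have eta0 : 0 < eps / 4 by rewrite divr_gt0.
have Fa : F [set i | chart_dom a (Ph i z2)] := cvP _ (near_chart_dom z2a).
have cc : (fun i => chart a (Ph i z2)) @ F --> chart a (Phi0 z2).
  by move=> W hW; exact: (cvP _ (chart_continuous z2a hW)).
have ct : (fun i => (chart a (Ph i z2)).2) @ F --> t0.
  rewrite -z2t => W hW.
  have h : nbhs (chart a (Phi0 z2)) [set x : V * transverse_space a | W x.2] by exact: cvg_snd.
  exact: (cc _ h).
have cx : (fun i => in_chart a (Ph i) z2) @ F --> f0 z2.
  move=> W hW.
  have h : nbhs (chart a (Phi0 z2)) [set x : V * transverse_space a | W x.1] by exact: cvg_fst.
  exact: (cc _ h).
have Ft : F [set i | forall x : V, `|x - f0 z1| <= sigma ->
    metric_deriv_close (fun x => riemannian_metric L a (x, (chart a (Ph i z2)).2))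
      (fun x => riemannian_metric L a (x, t0)) (eps / 4) x].
  exact: (ct _ (metric_deriv_near t0 sub eta0)).
have Fj : F [set i | jet_dist (in_chart a (Ph i)) f0 z2 <= eps / 4].
  have cj k : (fun i => jet (in_chart a (Ph i)) k z2) @ F --> jet f0 k z2.
    case: k => [[i|] p]; rewrite /jet/=; first by exact: cvg_entry.
    exact: cvg_entry.
  have e24 : 0 < eps / 24 by rewrite divr_gt0.
  have h : F [set i | forall k, `|jet (in_chart a (Ph i)) k z2 - jet f0 k z2| <= eps / 24].
    have h1 k : F [set i | `|jet (in_chart a (Ph i)) k z2 - jet f0 k z2| <= eps / 24].
      by have /cvgr_dist_le/(_ _ e24) := cj k; apply: filterS => i; rewrite /= distrC.
    exact: (@filter_forall _ _ _ F _ h1).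
  apply: filterS h => i hi.
  rewrite /= /jet_dist (@le_trans _ _ (\sum_(k : option 'I_2 * 'I_2) eps / 24))//.
    by apply: ler_sum => k _; exact: hi.
  by rewrite sumr_const card_jet -mulr_natr; lra.
apply: filterS3 Fa Ft Fj => i ia it ij w wz.
set f := in_chart a (Ph i) in ij *; set t := (chart a (Ph i z2)).2 in it *.
have {}ij : jet_dist f f0 z2 <= eps / 4 by exact: ij.
pose c (s : R) : V := z2 + s *: (w - z2).
have cr s : 0 <= s -> s <= 1 -> `|c s - z1| <= rho by move=> ? ?; exact: cball_segment.
have f0r s : 0 <= s -> s <= 1 -> [/\ H (c s), chart_dom a (Phi0 (c s)) &
    `|f0 (c s) - f0 z1| <= sigma / 2].
  by move=> s0 s1; have [] := hr (c s) (le_trans (cr s s0 s1) rhor).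
pose P s := [/\ chart_dom a (Ph i (c s)), (chart a (Ph i (c s))).2 = t & jet_dist f f0 (c s) <= eps].
have near_f0 s : 0 <= s -> s <= 1 -> P s -> `|f (c s) - f0 z1| <= sigma.
  move=> s0 s1 [_ _ jd]; have [_ _ fs] := f0r s s0 s1.
  have d : `|f (c s) - f0 (c s)| <= eps.
    apply: norm_le_entries => [|p q]; first exact: ltW.
    by rewrite ord1 !mxE; apply: le_trans jd; exact: (jet_dist_ge f f0 (None, q) (c s)).
  have -> : f (c s) - f0 z1 = (f (c s) - f0 (c s)) + (f0 (c s) - f0 z1) by rewrite addrA subrK.
  by apply: le_trans (ler_normD _ _) _; lra.
have tdf s : 0 <= s -> s <= 1 -> chart_dom a (Ph i (c s)) ->
    twice_diff f (c s) /\ twice_diff f0 (c s).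
  move=> s0 s1 sa; have [sH s0a _] := f0r s s0 s1.
  have [_ /(_ a sa)[h _ _]] := dPh i sH; have [_ /(_ a s0a)[h' _ _]] := dPhi0 sH.
  by split; [exact: h|exact: h'].
have cc' s : 0 <= s -> s <= 1 -> chart_dom a (Ph i (c s)) ->
    {for s, continuous (fun u => jet_dist f f0 (c u))}.
  move=> s0 s1 sa; have [h h'] := tdf s s0 s1 sa.
  apply: (@continuous_at_comp _ _ _ c (jet_dist f f0) s); last exact: jet_dist_continuous.
  apply: (@cvgD _ _ _ (nbhs s)); first exact: cvg_cst.
  by apply: (@cvgZr_tmp _ _ _ (nbhs s)); exact: cvg_id.
have all_P : forall s, 0 <= s -> s <= 1 -> P s.
  apply: real_induction.
  - by rewrite /P /c scale0r addr0; split => //; apply: le_trans ij _; lra.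
  - move=> s s0 s1 Pt; have [sH _ _] := f0r s (ltW s0) s1.
    have lt1 u : u < s -> u <= 1 by move=> us; exact: le_trans (ltW us) s1.
    have [|sa st _] := @plaque_limit (Ph i) z2 (w - z2) s a t (f0 z1) sigma (dPh i) s0 sH sub.
      move=> u u0 us; have Pu := Pt u u0 us; have [ua ut _] := Pu.
      by split => //; exact: near_f0 (lt1 u us) Pu.
    split => //.
    apply: (left_limit_closed (C := [set x | x <= eps]) s0 (cc' s (ltW s0) s1 sa)).
      exact: closed_le.
    by move=> u u0 us; have [] := Pt u u0 us.
  - move=> s s0 s1 Pt.
    have Ps := Pt s s0 (lexx _); have [sa st _] := Ps.
    have [sH _ _] := f0r s s0 (ltW s1).
    have js : jet_dist f f0 (c s) < eps.
      suff h : jet_dist f f0 (c s) <= 2 * jet_dist f f0 z2 + eps / 4.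
        by apply: le_lt_trans h _; move: ij eps_gt0; lra.
      apply: (@comp f (fun x => riemannian_metric L a (x, t)) (eps / 4) z2 (s *: (w - z2))).
      + exact: ltW.
      + by move: eps1 eps_gt0; lra.
      + move=> u u0 u1; rewrite scalerA.
        have us0 : 0 <= u * s by rewrite mulr_ge0.
        have uss : u * s <= s by rewrite ler_piMl.
        have us1 : u * s <= 1 by apply: le_trans uss (ltW s1).
        have Pu := Pt _ us0 uss; have [ua ut uj] := Pu.
        have fu := near_f0 _ us0 us1 Pu; have [uH _ _] := f0r _ us0 us1.
        split => //.
        * exact: le_trans (cr _ us0 us1) rhorho0.
        * by have := developing_isometric (dPh i) uH ua; rewrite ut.
        * by apply: le_trans uj _; lra.
        * exact: it.
    have n1 : nbhs s [set u | jet_dist f f0 (c u) < eps].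
      by apply: (cvgr_lt _ (cc' s s0 (ltW s1) sa)).
    have n2 : nbhs s [set u | chart_dom a (Ph i (c u)) /\
        (chart a (Ph i (c u))).2 = (chart a (Ph i (c s))).2].
      apply: (@near_plaque R L R (fun u => Ph i (c u)) s a) => //.
      exact: developing_line.
    by apply: filterS2 n1 n2 => u /ltW ju [ua ut]; split => //; rewrite ut.
have [wa wt wj] := all_P 1 ler01 (lexx _).
by move: wa wt wj; rewrite /c scale1r subrKC => wa wt wj; split => //; exact: le_trans epsle.
Qed.

Lemma jacobian_cvg_charts (T : Type) (K : set_system T) {FK : Filter K}
    (Ps : T -> V -> leaf_space L) (w : T -> V) (z : V) (a : chart_index) :
  (forall t, developing (Ps t)) -> K [set t | H (w t)] -> H z -> chart_dom a (Phi0 z) ->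
  (fun t => Ps t (w t) : L) @ K --> (Phi0 z : L) ->
  (fun t => jacobian (in_chart a (Ps t)) (w t)) @ K --> jacobian (in_chart a Phi0) z ->
  forall b, chart_dom b (Phi0 z) ->
  (fun t => jacobian (in_chart b (Ps t)) (w t)) @ K --> jacobian (in_chart b Phi0) z.
Proof.
move=> dPs wH zH za cP cJ b zb.
have change Phi x : developing (L := L) Phi -> H x -> chart_dom a (Phi x) -> chart_dom b (Phi x) ->
    jacobian (in_chart b Phi) x = jacobian (in_chart a Phi) x *m transition_jacobian b (chart a (Phi x)).
  move=> dP xH xa xb; have [cPhi /(_ a xa)[[df _] _ _]] := dP x xH.
  by have [] := jacobian_change cPhi xb xa (nbhs_singleton df).
have Ka : K [set t | chart_dom a (Ps t (w t))] := cP _ (near_chart_dom za).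
have Kb : K [set t | chart_dom b (Ps t (w t))] := cP _ (near_chart_dom zb).
have cT : (fun t => transition_jacobian b (chart a (Ps t (w t)))) @ K -->
    transition_jacobian b (chart a (Phi0 z)).
  have c1 : {for (Phi0 z : L), continuous (fun q : L => transition_jacobian b (chart a q))}.
    apply: (continuous_at_comp (chart_continuous za)).
    by apply: transition_jacobian_continuous; exact: transition_dom_chart.
  exact: (cvg_comp_at cP c1).
rewrite (change _ _ dPhi0 zH za zb).
apply: (cvg_near_eq _ (cvg_mulmx cJ cT)).
by apply: filterS3 wH Ka Kb => t xH xa xb; exact: (esym (change _ _ (dPs t) xH xa xb)).
Qed.

Definition jet_cvg z := (fun i => Ph i z : L) @ F --> (Phi0 z : L) /\
  forall a, chart_dom a (Phi0 z) ->
    (fun i => jacobian (in_chart a (Ph i)) z) @ F --> jacobian (in_chart a Phi0) z.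

Lemma local_jet_cvg (z1 : V) : H z1 -> exists2 rho, 0 < rho &
  forall z2 : V, `|z2 - z1| <= rho -> jet_cvg z2 ->
  forall (T : Type) (K : set_system T) (i : T -> I) (w : T -> V) (z : V), Filter K ->
    `|z - z1| <= rho -> (forall A, F A -> K (i @^-1` A)) -> w @ K --> z ->
    K [set t | `|w t - z1| <= rho] ->
  (fun t => Ph (i t) (w t) : L) @ K --> (Phi0 z : L) /\ forall a, chart_dom a (Phi0 z) ->
    (fun t => jacobian (in_chart a (Ph (i t))) (w t)) @ K --> jacobian (in_chart a Phi0) z.
Proof.
move=> z1H; have [a z1a] := chart_dom_cover (Phi0 z1).
have [rho [rho0 reg unif]] := local_convergence z1H z1a.
exists rho => // z2 z2r [cP2 cJ2] T K i w z FK zr iF wz Kr.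
have [z2H z2a z2t] := reg z2 z2r; have [zH za zt] := reg z zr.
have U := unif z2 z2r cP2 (cJ2 a z2a).
have UK eps : 0 < eps -> K [set t | [/\ chart_dom a (Ph (i t) (w t)),
    (chart a (Ph (i t) (w t))).2 = (chart a (Ph (i t) z2)).2 &
    jet_dist (in_chart a (Ph (i t))) (in_chart a Phi0) (w t) <= eps] ].
  by move=> e0; apply: filterS2 (iF _ (U eps e0)) Kr => t ht wt; exact: ht.
have [_ /(_ a za)[tdf0 _ _]] := dPhi0 zH.
have cj k : (fun t => jet (in_chart a (Ph (i t))) k (w t)) @ K --> jet (in_chart a Phi0) k z.
  have c0 : {for z, continuous (jet (in_chart a Phi0) k)}.
    exact/differentiable_continuous/jet_differentiable.
  apply/cvgrPdist_le => e e0; have e2 : 0 < e / 2 by rewrite divr_gt0.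
  have K1 : K [set t | `|jet (in_chart a Phi0) k z - jet (in_chart a Phi0) k (w t)| <= e / 2].
    by have /cvgrPdist_le/(_ _ e2) h := c0; exact: (wz _ h).
  apply: filterS2 K1 (UK _ e2) => t h1 [_ _ h2].
  have h3 := le_trans (jet_dist_ge _ _ k _) h2.
  rewrite -[X in `|X - _|](subrK (jet (in_chart a Phi0) k (w t))) -addrA.
  apply: le_trans (ler_normD _ _) _; rewrite (splitr e) lerD//.
  by rewrite distrC.
have cx : (fun t => in_chart a (Ph (i t)) (w t)) @ K --> in_chart a Phi0 z.
  by apply: cvg_mx => r j; rewrite ord1; exact: (cj (None, j)).
have ct : (fun t => (chart a (Ph (i t) (w t))).2) @ K --> (chart a (Phi0 z)).2.
  have c2 : (fun k => (chart a (Ph k z2)).2) @ F --> (chart a (Phi0 z)).2.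
    rewrite zt -z2t => W hW.
    have h : nbhs (chart a (Phi0 z2)) [set x : V * transverse_space a | W x.2] by exact: cvg_snd.
    exact: (cP2 _ (chart_continuous z2a h)).
  move=> W hW; have h : K [set t | W (chart a (Ph (i t) z2)).2] := iF _ (c2 W hW).
  suff h' : K [set t | W (chart a (Ph (i t) (w t))).2] by exact: h'.
  by apply: filterS2 (UK 1 ltr01) h => t [_ e _]; rewrite /= e.
have cP : (fun t => Ph (i t) (w t) : L) @ K --> (Phi0 z : L).
  have ci : {for chart a (Phi0 z), continuous (@chart_inv R L a)}.
    by apply: chart_inv_continuous; exact: chart_in.
  move=> W hW; have hW' : nbhs (chart_inv (chart a (Phi0 z))) W by rewrite chartK.
  have [[A B] /= [nA nB] AB] := ci _ hW'.
  have hA : K [set t | A (in_chart a (Ph (i t)) (w t))] := cx _ nA.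
  have hB : K [set t | B (chart a (Ph (i t) (w t))).2] := ct _ nB.
  suff h : K [set t | W (Ph (i t) (w t) : L)] by exact: h.
  apply: filterS3 (UK 1 ltr01) hA hB => t [ta _ _] tA tB.
  have e := chartK ta; rewrite /= -e; exact: AB.
split => // b zb.
apply: (@jacobian_cvg_charts T K FK (fun t => Ph (i t)) w z a) => //.
  by apply: filterS Kr => t /reg[].
by apply: cvg_mx => r j; exact: (cj (Some r, j)).
Qed.

Lemma half_plane_convex (y z : V) (s : R) : H y -> H z -> 0 <= s -> s <= 1 ->
  H (y + s *: (z - y)).
Proof.
rewrite /half_plane/= => y0 z0 s0 s1; rewrite !mxE.
have -> : y 0 1 + s * (z 0 1 - y 0 1) = (1 - s) * y 0 1 + s * z 0 1 by ring.
have [->|sn] := eqVneq s 0; first by rewrite mul0r addr0 subr0 mul1r.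
have sp : 0 < s by rewrite lt_neqAle eq_sym sn.
by rewrite ltr_wpDl ?mulr_gt0// mulr_ge0// ?subr_ge0// ltW.
Qed.

Lemma jet_cvg_propagates (y z : V) : H y -> H z -> jet_cvg y -> jet_cvg z.
Proof.
move=> yH zH cy; pose c (s : R) : V := y + s *: (z - y).
have cc s : {for s, continuous c}.
  apply: (@cvgD _ _ _ (nbhs s)); first exact: cvg_cst.
  by apply: (@cvgZr_tmp _ _ _ (nbhs s)); exact: cvg_id.
have local s : 0 <= s -> s <= 1 -> exists2 rho, 0 < rho & forall t u,
    `|c t - c s| <= rho -> `|c u - c s| <= rho -> jet_cvg (c t) -> jet_cvg (c u).
  move=> s0 s1; have [rho r0 h] := local_jet_cvg (half_plane_convex yH zH s0 s1).
  exists rho => // t u tr ur ct.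
  apply: (h _ tr ct I F id (fun=> c u) (c u)) => //; first exact: cvg_cst.
  exact: filterE.
suff : jet_cvg (c 1) by rewrite /c scale1r subrKC.
apply: (@real_induction R (fun s => jet_cvg (c s)) _ _ _ 1 ler01 (lexx _)).
- by rewrite /c scale0r addr0.
- move=> s s0 s1 before; have [rho r0 h] := local s (ltW s0) s1.
  apply: contrapT => nc.
  pose C := [set x : V | rho <= `|x - c s|].
  have clC : closed C.
    apply: (@closed_comp _ _ (fun x : V => `|x - c s|) [set r | rho <= r]); last exact: closed_ge.
    move=> x _; apply: (@cvg_norm _ _ _ (nbhs x)).
    by apply: (@cvgB _ _ _ (nbhs x)); [exact: cvg_id|exact: cvg_cst].
  have : C (c s).
    apply: (left_limit_closed s0 (cc s) clC) => t t0 ts.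
    rewrite /C /= leNgt; apply/negP => lt; apply: nc.
    by apply: h (ltW lt) _ (before t t0 ts); rewrite subrr normr0 ltW.
  by rewrite /C/= subrr normr0 leNgt r0.
- move=> s s0 s1 before; have [rho r0 h] := local s s0 (ltW s1).
  have n : nbhs s [set t | `|c t - c s| <= rho].
    by have /cvgr_dist_le/(_ _ r0) := cc s; apply: filterS => t; rewrite /= distrC.
  apply: filterS n => t tr.
  by apply: h _ tr (before s s0 (lexx _)); rewrite subrr normr0 ltW.
Qed.

(** The convergence of the 1-jets propagates along the segment from [y] to [z];
    it is uniform near [z], which allows the point to vary with the map. *)
Theorem developing_convergence (y z : V) (T : Type) (K : set_system T) (i : T -> I) (w : T -> V) :
  Filter K -> H y -> jet_cvg y -> H z -> (forall A, F A -> K (i @^-1` A)) -> w @ K --> z ->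
  (fun t => Ph (i t) (w t) : L) @ K --> (Phi0 z : L) /\ forall a, chart_dom a (Phi0 z) ->
    (fun t => jacobian (in_chart a (Ph (i t))) (w t)) @ K --> jacobian (in_chart a Phi0) z.
Proof.
move=> FK yH cy zH iF wz; have cz := jet_cvg_propagates yH zH cy.
have [rho r0 h] := local_jet_cvg zH.
have zz : `|z - z| <= rho by rewrite subrr normr0 ltW.
apply: (h z zz cz T K i w z) => //.
have /cvgr_dist_le/(_ _ r0) n := wz; by apply: filterS n => t; rewrite /= distrC.
Qed.

End Family.
End Comparison.

(** * Orthonormal frames *)

Section FrameMatrix.
Context {R : realType}.
Local Notation V := 'rV[R]_2.
Local Notation i0 := (bv 1 : V).

(** The matrix whose rows are a direct orthonormal frame, for the metric [m],
    with last vector [v]. *)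
Definition frame_mx (m : 'M[R]_2) (v : V) : 'M[R]_2 :=
  let d := (Num.sqrt (m 0 0 * m 1 1 - m 0 1 * m 1 0))^-1 in
  mx2 (d * (v *m m) 0 1) (- (d * (v *m m) 0 0)) (v 0 0) (v 0 1).

Lemma frame_solve (p q r s a b c d : R) :
  p * a * p + p * b * q + (q * c * p + q * d * q) = 1 ->
  p * a * r + p * b * s + (q * c * r + q * d * s) = 0 ->
  r * a * r + r * b * s + (s * c * r + s * d * s) = 1 ->
  r * a * p + r * b * q + (s * c * p + s * d * q) = 0 -> 0 < p * s - q * r ->
  p = (Num.sqrt (a * d - b * c))^-1 * (r * b + s * d) /\
  q = - ((Num.sqrt (a * d - b * c))^-1 * (r * a + s * c)).
Proof.
move=> e00 e01 e11 e10 D0; set D := p * s - q * r in D0.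
have D2 : D ^+ 2 * (a * d - b * c) = 1.
  have <- : (p * a * p + p * b * q + (q * c * p + q * d * q)) *
    (r * a * r + r * b * s + (s * c * r + s * d * s)) -
    (p * a * r + p * b * s + (q * c * r + q * d * s)) *
    (r * a * p + r * b * q + (s * c * p + s * d * q)) = 1.
    by rewrite e00 e01 e11 e10; ring.
  by rewrite /D; ring.
have -> : (Num.sqrt (a * d - b * c))^-1 = D.
  have -> : a * d - b * c = D^-1 ^+ 2.
    by rewrite exprVn -[RHS]mulr1 -D2 mulKf// expf_neq0// gt_eqF.
  by rewrite sqrtr_sqr gtr0_norm ?invr_gt0// invrK.
split.
  transitivity (p * (r * a * r + r * b * s + (s * c * r + s * d * s))
    - r * (r * a * p + r * b * q + (s * c * p + s * d * q))); last by rewrite /D; ring.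
  by rewrite e11 e10; ring.
transitivity (q * (r * a * r + r * b * s + (s * c * r + s * d * s))
    - s * (r * a * p + r * b * q + (s * c * p + s * d * q))); last by rewrite /D; ring.
by rewrite e11 e10; ring.
Qed.

(** An isometry that preserves the orientation has its whole differential
    determined by the image of one vector. *)
Lemma frame_mxE (J m : 'M[R]_2) : J *m m *m J^T = 1%:M -> 0 < \det J ->
  J = frame_mx m (i0 *m J).
Proof.
move=> JmJ; rewrite (mx2_eta J) det_mx2 -rowE => detJ.
have e00 := congr1 (fun M : 'M[R]_2 => M 0 0) JmJ.
have e01 := congr1 (fun M : 'M[R]_2 => M 0 1) JmJ.
have e11 := congr1 (fun M : 'M[R]_2 => M 1 1) JmJ.
move: e00 e01 e11; rewrite !mulmx3E !big_ord2 !mxE /= => e00 e01 e11.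
have e10 := congr1 (fun M : 'M[R]_2 => M 1 0) JmJ.
rewrite mulmx3E !big_ord2 !mxE /= in e10.
rewrite /frame_mx; congr mx2; rewrite ?mulmx2E ?mxE ?big_ord2 ?mxE ?mx2E //=; move: e00 e01 e11 e10 detJ.
- move: (J 0 0) (J 0 1) (J 1 0) (J 1 1) (m 0 0) (m 0 1) (m 1 0) (m 1 1) => p q r s a b c d.
  by move=> e00 e01 e11 e10 detJ; have [] := frame_solve e00 e01 e11 e10 detJ.
- move: (J 0 0) (J 0 1) (J 1 0) (J 1 1) (m 0 0) (m 0 1) (m 1 0) (m 1 1) => p q r s a b c d.
  by move=> e00 e01 e11 e10 detJ; have [] := frame_solve e00 e01 e11 e10 detJ.
Qed.

Lemma cvg_frame_mx (T : Type) (F : set_system T) {FF : Filter F} (m : T -> 'M[R]_2)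
    (v : T -> V) (m0 : 'M[R]_2) (v0 : V) : 0 < m0 0 0 * m0 1 1 - m0 0 1 * m0 1 0 ->
  m @ F --> m0 -> v @ F --> v0 -> (fun t => frame_mx (m t) (v t)) @ F --> frame_mx m0 v0.
Proof.
move=> D0 cm cv.
have ce i j : (fun t => m t i j) @ F --> m0 i j by exact: cvg_entry.
have cD : (fun t => m t 0 0 * m t 1 1 - m t 0 1 * m t 1 0) @ F
    --> m0 0 0 * m0 1 1 - m0 0 1 * m0 1 0.
  by apply: (@cvgB _ _ _ F); apply: (@cvgM _ _ F).
have cS : (fun t => (Num.sqrt (m t 0 0 * m t 1 1 - m t 0 1 * m t 1 0))^-1) @ F
    --> (Num.sqrt (m0 0 0 * m0 1 1 - m0 0 1 * m0 1 0))^-1.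
  apply: (@cvgV _ _ F); first by rewrite gt_eqF// sqrtr_gt0.
  exact: (cvg_comp_at cD (@sqrt_continuous R _)).
have cq j : (fun t => (v t *m m t) 0 j) @ F --> (v0 *m m0) 0 j.
  by apply: cvg_entry; exact: cvg_mulmx.
apply: cvg_mx2; try by apply: cvg_entry.
  exact: (@cvgM _ _ F).
by apply: (@cvgN _ _ _ F); exact: (@cvgM _ _ F).
Qed.

End FrameMatrix.

(** * The action by right translations *)

Lemma mulmx_congruence (R : realType) (u : 'rV[R]_2) (J m : 'M[R]_2) :
  u *m J *m m *m (u *m J)^T = u *m (J *m m *m J^T) *m u^T.
Proof. by rewrite trmx_mul !mulmxA. Qed.

Lemma scalar_form (R : realType) (u : 'rV[R]_2) (k : R) :
  (u *m k%:M *m u^T) 0 0 = k * (u 0 0 ^+ 2 + u 0 1 ^+ 2).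
Proof. by rewrite mul_mx_scalar -scalemxAl !mxE big_ord2 !mxE !expr2. Qed.

Lemma derive_jacobian (R : realType) (f : 'rV[R]_2 -> 'rV[R]_2) z u : differentiable f z ->
  'D_u f z = u *m jacobian f z.
Proof. exact: deriveEjacobian. Qed.

Lemma near_eq_jacobian (R : realType) (f g : 'rV[R]_2 -> 'rV[R]_2) z : differentiable f z ->
  differentiable g z -> nbhs z [set w | f w = g w] -> jacobian f z = jacobian g z.
Proof.
move=> df dg E; apply: (jacobian_unique df) => u.
by rewrite -deriveEjacobian//; exact: near_eq_derive.
Qed.

Section Action.
Context {R : realType} (L : hyperbolic_lamination R).
Local Notation V := 'rV[R]_2.
Local Notation H := (@half_plane R).
Local Notation T1 := (unit_tangent L).
Local Notation chart_index := (chart_index L).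
Local Notation i0 := (bv 1 : V).

(** The unit vector [xi] is the image of the upward unit vector at [i0] under
    the differential of [Psi]. *)
Definition frames (Psi : V -> leaf_space L) (xi : T1) :=
  foot xi = Psi i0 /\ forall a, chart_dom a (foot xi) ->
    vec xi a = i0 *m jacobian (in_chart a Psi) i0.

Lemma developing_differentiable Psi z a : developing (L := L) Psi -> H z ->
  chart_dom a (Psi z) -> differentiable (in_chart a Psi) z.
Proof. by move=> dPsi zH za; have [_ /(_ a za)[[df _] _ _]] := dPsi z zH; exact: (nbhs_singleton df). Qed.

Lemma developing_change Psi z a b : developing (L := L) Psi -> H z ->
  chart_dom a (Psi z) -> chart_dom b (Psi z) ->
  jacobian (in_chart b Psi) z = jacobian (in_chart a Psi) z *m
    transition_jacobian b (chart a (Psi z)).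
Proof.
move=> dPsi zH za zb; have df := developing_differentiable dPsi zH za.
by have [cPsi _] := dPsi z zH; have [] := jacobian_change cPsi zb za df.
Qed.

Lemma represents_frames pi (g : 'M[R]_2) (xi : T1) : developing (L := L) pi -> SL2 g ->
  represents pi g xi <-> frames (pi \o moebius g) xi.
Proof.
move=> dpi sg; have dg := developing_moebius dpi sg.
have E a : chart_dom a (pi (moebius g i0)) ->
    'D_i0 (fun z => (chart a (pi (moebius g z))).1) i0
    = i0 *m jacobian (in_chart a (pi \o moebius g)) i0.
  move=> ga; have df := developing_differentiable dg (@half_plane_i0 R) ga.
  exact: (derive_jacobian i0 df).
split => -[e h]; (split; first exact: e) => a xa;
  have ga : chart_dom a (pi (moebius g i0)) by have := xa; rewrite e.
  by rewrite (h a xa); exact: E.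
by rewrite (h a xa); exact: (esym (E a ga)).
Qed.

Lemma frames_one_chart (Psi : V -> leaf_space L) (xi : T1) a : developing Psi ->
  foot xi = Psi i0 -> chart_dom a (foot xi) ->
  vec xi a = i0 *m jacobian (in_chart a Psi) i0 -> frames Psi xi.
Proof.
move=> dPsi e xa va; split; first exact: e.
move=> b xb; rewrite (vec_compat xb xa) va e -mulmxA.
have xa' : chart_dom a (Psi i0) by rewrite -e.
have xb' : chart_dom b (Psi i0) by rewrite -e.
exact: (esym (congr1 (mulmx i0) (developing_change dPsi (@half_plane_i0 R) xa' xb'))).
Qed.

Lemma frames_exists (Psi : V -> leaf_space L) : developing Psi -> exists xi, frames Psi xi.
Proof.
move=> dPsi; have [a ia] := chart_dom_cover (Psi i0).
have [_ /(_ a ia)[_ _ iso]] := dPsi _ (@half_plane_i0 R).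
have [|xi [e ve]] := @unit_tangent_exists R L a (Psi i0)
  (i0 *m jacobian (in_chart a Psi) i0) ia.
  rewrite mulmx_congruence.
  rewrite iso /hyperbolic_metric scalar_form !mxE /=.
  by rewrite expr0n expr1n add0r invr1 mulr1.
by exists xi; apply: (@frames_one_chart _ _ a) => //; rewrite e.
Qed.

Lemma frames_unique (Psi : V -> leaf_space L) (xi eta : T1) :
  frames Psi xi -> frames Psi eta -> xi = eta.
Proof.
move=> [e h] [e' h']; have [a xa] := chart_dom_cover (foot xi).
have ea : chart_dom a (foot eta) by rewrite e' -e.
by apply: (unit_tangent_eq xa); [rewrite e e'|rewrite h// h'].
Qed.

Lemma frames_jacobian (Psi : V -> leaf_space L) (xi : T1) a : developing Psi -> frames Psi xi ->
  chart_dom a (foot xi) ->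
  jacobian (in_chart a Psi) i0 = frame_mx (metric_at a (foot xi)) (vec xi a).
Proof.
move=> dPsi [e h] xa; rewrite (h a xa).
have xa' : chart_dom a (Psi i0) by rewrite -e.
have [_ /(_ a xa')[_ detJ iso]] := dPsi _ (@half_plane_i0 R).
apply: frame_mxE => //; rewrite e iso /hyperbolic_metric mxE /=.
by rewrite expr1n invr1.
Qed.

Section FrameConvergence.
Context (I : Type) (F : set_system I) {FF : ProperFilter F}.
Context (Ph : I -> V -> leaf_space L) (Phi0 : V -> leaf_space L) (xi : I -> T1) (xi0 : T1).
Hypotheses (dPh : forall i, developing (Ph i)) (dPhi0 : developing Phi0).
Hypotheses (frPh : forall i, frames (Ph i) (xi i)) (frPhi0 : frames Phi0 xi0).

(** By [frame_mxE], the 1-jet at [i0] is a continuous function of the framed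
    vector. *)
Lemma frames_jet_cvg : xi @ F --> xi0 -> jet_cvg F Ph Phi0 i0.
Proof.
move=> cxi; have [e0 _] := frPhi0.
have cf : (fun i => foot (xi i)) @ F --> foot xi0 := cvg_comp_at cxi (@foot_continuous R L xi0).
split.
  rewrite -e0; apply: cvg_near_eq cf; apply: filterE => i.
  by have [] := frPh i.
move=> a; rewrite -e0 => xa.
rewrite (frames_jacobian dPhi0 frPhi0 xa).
have Fa : F [set i | chart_dom a (foot (xi i))] := cf _ (near_chart_dom xa).
have cm : (fun i => metric_at a (foot (xi i))) @ F --> metric_at a (foot xi0).
  exact: (cvg_comp_at cf (metric_at_continuous xa)).
have cv : (fun i => vec (xi i) a) @ F --> vec xi0 a.
  exact: (cvg_comp_at cxi (vec_continuous xa)).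
have [_ _ D0] := metric_at_pos xa.
apply: (cvg_near_eq _ (cvg_frame_mx D0 cm cv)).
by apply: filterS Fa => i ia; exact: (esym (frames_jacobian (dPh i) (frPh i) ia)).
Qed.

End FrameConvergence.

(** A constant family of developing maps converges to [Psi'] by
    [developing_convergence], hence is equal to it. *)
Lemma developing_unique (Psi Psi' : V -> leaf_space L) (xi : T1) z : developing Psi ->
  developing Psi' -> frames Psi xi -> frames Psi' xi -> H z -> Psi z = Psi' z.
Proof.
move=> d d' fr fr' zH.
pose F : set_system R := nbhs (0 : R).
have cxi : (fun _ : R => xi) @ F --> xi by exact: cvg_cst.
have jc : jet_cvg F (fun=> Psi) Psi' i0.
  exact: (@frames_jet_cvg R F _ (fun=> Psi) Psi' (fun=> xi) xi (fun=> d) d' (fun=> fr) fr' cxi).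
have cz : (fun _ : R => z) @ F --> z by exact: cvg_cst.
have [] := @developing_convergence R L R F _ (fun=> Psi) Psi' (fun=> d) d' i0 z R F
  id (fun=> z) _ (@half_plane_i0 R) jc zH (fun A FA => FA) cz.
move=> c _.
have hL : hausdorff_space L by exact: metric_hausdorff.
have c' : (fun _ : R => Psi z : L) @ F --> (Psi z : L) by exact: cvg_cst.
exact: (cvg_unique hL c' c).
Qed.

Lemma frames_eq (Psi Psi' : V -> leaf_space L) (xi : T1) : developing Psi ->
  developing Psi' -> (forall z, H z -> Psi z = Psi' z) -> frames Psi xi -> frames Psi' xi.
Proof.
move=> d d' E [e h]; split; first by rewrite e E//; exact: half_plane_i0.
move=> a xa; rewrite (h a xa).
have ia : chart_dom a (Psi i0) by rewrite -e.
have ia' : chart_dom a (Psi' i0) by rewrite -E//; exact: half_plane_i0.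
have df := developing_differentiable d (@half_plane_i0 R) ia.
have df' := developing_differentiable d' (@half_plane_i0 R) ia'.
apply: (congr1 (mulmx i0)); apply: (near_eq_jacobian df df').
by apply: filterS (near_half_plane (@half_plane_i0 R)) => w wH; rewrite /in_chart /= E.
Qed.

Lemma frames_moebius pi (l : set (leaf_space L)) G (xi : T1) :
  uniformizes (riemannian_metric L) l G pi -> l (foot xi) ->
  exists2 g, SL2 g & frames (pi \o moebius g) xi.
Proof.
move=> U lx; have dpi := uniformizes_developing U; have [_ _ im _ _] := U.
move: lx; rewrite -im => -[z zH ze].
have [a xa] := chart_dom_cover (foot xi).
have za : chart_dom a (pi z) by rewrite ze.
have [_ /(_ a za)[_ detJ iso]] := dpi z zH.
set J := jacobian (in_chart a pi) z in detJ iso.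
have uJ : J \in unitmx by rewrite unitmxE unitfE gt_eqF.
pose u := vec xi a *m invmx J.
have uE : u *m J = vec xi a by rewrite mulmxKV.
have [|g [sg gz gu]] := @moebius_frame R z u zH.
  have := vec_unit xa; rewrite -[riemannian_metric _ _ _]/(metric_at a (foot xi)) -ze -uE.
  rewrite mulmx_congruence iso /hyperbolic_metric.
  rewrite scalar_form => e; have z0 : z 0 1 ^+ 2 != 0 by rewrite expf_neq0// gt_eqF.
  by apply: (mulfI (invr_neq0 z0)); rewrite e mulVf.
exists g => //; have dg := developing_moebius dpi sg.
have ga : chart_dom a (pi (moebius g i0)) by rewrite gz.
have fE : foot xi = (pi \o moebius g) i0 by rewrite /= gz ze.
apply: (frames_one_chart dg fE xa).
have [_ E] := developing_moebius_jacobian dpi sg (@half_plane_i0 R) ga.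
by rewrite E mulmxA gu gz uE.
Qed.

Lemma uniformization (xi : T1) : exists G pi g,
  [/\ uniformizes (riemannian_metric L) (leaf (foot xi)) G pi, SL2 g & frames (pi \o moebius g) xi].
Proof.
have [G [pi U]] := leaves_hyperbolic (foot xi).
have lx : leaf (foot xi) (foot xi) by exact: connected_component_refl.
by have [g sg fr] := frames_moebius U lx; exists G, pi, g.
Qed.

Lemma developing_moebiusM (Psi : V -> leaf_space L) (g h : 'M[R]_2) : SL2 g -> SL2 h ->
  forall z, H z -> (Psi \o moebius (g * h)) z = (Psi \o moebius g \o moebius h) z.
Proof. by move=> sg sh z zH; rewrite /= moebiusM. Qed.

(** The group acts by precomposition on developing maps: by
    [developing_unique], the choices in the definition of the action do not
    matter. *)
Lemma frames_action (Psi : V -> leaf_space L) (xi : T1) (h : 'M[R]_2) : developing Psi ->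
  frames Psi xi -> SL2 h -> frames (Psi \o moebius h) (PSL2_action xi h).
Proof.
move=> d fr sh; rewrite /PSL2_action; case: xgetP => [eta _|]; last first.
  move=> no; exfalso; have [G [pi [g [U sg frg]]]] := uniformization xi.
  have dpi := uniformizes_developing U.
  have [eta fre] := frames_exists (developing_moebius dpi (SL2M sg sh)).
  apply: (no eta); exists G, pi, g; split => //.
    exact/(represents_frames _ dpi sg).
  exact/(represents_frames _ dpi (SL2M sg sh)).
move=> [G [pi [g [U sg rg rgh]]]].
have dpi := uniformizes_developing U.
move: rg rgh => /(represents_frames _ dpi sg) frg /(represents_frames _ dpi (SL2M sg sh)) frgh.
have dg := developing_moebius dpi sg.
apply: (frames_eq (developing_moebius dpi (SL2M sg sh)) (developing_moebius d sh) _ frgh).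
move=> z zH; rewrite developing_moebiusM//=.
exact: (developing_unique dg d frg fr (half_plane_moebius sh zH)).
Qed.

Lemma developing_of_vector : exists D : T1 -> V -> leaf_space L,
  forall xi, developing (D xi) /\ frames (D xi) xi.
Proof.
suff /choice[D hD] : forall xi, exists Psi : V -> leaf_space L, developing Psi /\ frames Psi xi.
  by exists D.
move=> xi; have [G [pi [g [U sg fr]]]] := uniformization xi.
exists (pi \o moebius g); split => //.
exact: developing_moebius (uniformizes_developing U) sg.
Qed.

Lemma action1 (xi : T1) : PSL2_action xi 1 = xi.
Proof.
have [D hD] := developing_of_vector; have [d fr] := hD xi.
have := frames_action d fr (@SL2_1 R).
rewrite (_ : D xi \o moebius 1 = D xi); first by move=> fr'; exact: frames_unique fr.
by apply/funext => z /=; rewrite moebius1.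
Qed.

Lemma actionM (xi : T1) (g h : 'M[R]_2) : SL2 g -> SL2 h ->
  PSL2_action (PSL2_action xi g) h = PSL2_action xi (g * h).
Proof.
move=> sg sh; have [D hD] := developing_of_vector; have [d fr] := hD xi.
have dg := developing_moebius d sg.
have fr1 := frames_action dg (frames_action d fr sg) sh.
have fr2 := frames_action d fr (SL2M sg sh).
apply: (frames_unique fr1).
apply: (frames_eq (developing_moebius d (SL2M sg sh)) (developing_moebius dg sh) _ fr2).
exact: developing_moebiusM.
Qed.

Lemma actionN (xi : T1) (g : 'M[R]_2) : SL2 g -> PSL2_action xi (- g) = PSL2_action xi g.
Proof.
move=> sg; have [D hD] := developing_of_vector; have [d fr] := hD xi.
have fr1 := frames_action d fr sg; have fr2 := frames_action d fr (SL2N sg).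
apply: (frames_unique fr2); move: fr1.
by rewrite (_ : D xi \o moebius (- g) = D xi \o moebius g)//; apply/funext => z /=; rewrite moebiusN.
Qed.

(** [developing_convergence] is applied to the family of the maps [D eta], at
    the moving point [moebius h i0]. *)
Lemma frames_cvg (D : T1 -> V -> leaf_space L) (act : T1 -> 'M[R]_2 -> T1)
    (K : set_system (T1 * 'M[R]_2)) (xi : T1) (g : 'M[R]_2) : Filter K ->
  (forall eta, developing (D eta) /\ frames (D eta) eta) ->
  (forall eta h, SL2 h -> frames (D eta \o moebius h) (act eta h)) ->
  SL2 g -> K [set p | SL2 p.2] -> (forall A, nbhs xi A -> K [set p | A p.1]) ->
  (fun p : T1 * 'M[R]_2 => p.2) @ K --> g -> (fun p => act p.1 p.2) @ K --> act xi g.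
Proof.
move=> FK hD act_fr sg KS fK sK.
have d eta : developing (D eta) by have [] := hD eta.
have fr eta : frames (D eta) eta by have [] := hD eta.
have ci0 : (fun _ : T1 * 'M[R]_2 => i0) @ K --> i0 by exact: cvg_cst.
have [cz cJ] := cvg_moebius sg (@half_plane_i0 R) sK ci0.
have jc : jet_cvg (nbhs xi) D (D xi) i0.
  by apply: (@frames_jet_cvg T1 (nbhs xi) _ D (D xi) id xi d (d xi) fr (fr xi)); exact: cvg_id.
have [cP cD] := @developing_convergence R L T1 (nbhs xi) _ D (D xi) d (d xi) i0 (moebius g i0)
  _ K fst (fun p => moebius p.2 i0) _ (@half_plane_i0 R) jc (half_plane_moebius sg (@half_plane_i0 R)) fK cz.
have [e0 v0] := act_fr xi g sg.
have [a xa] := chart_dom_cover (foot (act xi g)).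
have ga : chart_dom a (D xi (moebius g i0)) by have := xa; rewrite e0.
have E : K [set p | (D p.1 (moebius p.2 i0) : L) = foot (act p.1 p.2)].
  by apply: filterS KS => p sp; have [e _] := act_fr p.1 p.2 sp; exact: (esym e).
have cf : (fun p : T1 * 'M[R]_2 => foot (act p.1 p.2)) @ K --> foot (act xi g).
  by rewrite e0; exact: (cvg_near_eq E cP).
have Ka : K [set p | chart_dom a (foot (act p.1 p.2))] := cf _ (near_chart_dom xa).
have vE eta h : SL2 h -> chart_dom a (foot (act eta h)) ->
    vec (act eta h) a =
    i0 *m (moebius_jacobian h i0 *m jacobian (in_chart a (D eta)) (moebius h i0)).
  move=> sh ha; have [e v] := act_fr eta h sh; rewrite (v a ha).
  have ha' : chart_dom a (D eta (moebius h i0)) by have := ha; rewrite e.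
  have [_ E'] := developing_moebius_jacobian (d eta) sh (@half_plane_i0 R) ha'.
  exact: (congr1 (mulmx i0) E').
have Ev : K [set p | i0 *m (moebius_jacobian p.2 i0 *m jacobian (in_chart a (D p.1)) (moebius p.2 i0))
    = vec (act p.1 p.2) a].
  by apply: filterS2 KS Ka => p sp pa; exact: (esym (vE p.1 p.2 sp pa)).
have cv : (fun p : T1 * 'M[R]_2 => vec (act p.1 p.2) a) @ K --> vec (act xi g) a.
  rewrite (vE _ _ sg xa).
  exact: (cvg_near_eq Ev (cvg_mulmx ci0 (cvg_mulmx cJ (cD a ga)))).
exact: (cvg_unit_tangent xa cf cv).
Qed.

Lemma action_continuous (xi : T1) (g : 'M[R]_2) (W : set T1) : SL2 g ->
  nbhs (PSL2_action xi g) W -> \forall eta \near xi & h \near g, SL2 h -> W (PSL2_action eta h).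
Proof.
move=> sg hW; have [D hD] := developing_of_vector.
pose K : set_system (T1 * 'M[R]_2) := within [set p : T1 * 'M[R]_2 | SL2 p.2] (nbhs (xi, g)).
have FK : Filter K by exact: within_filter.
have KS : K [set p | SL2 p.2] by exact: withinT.
have fK A : nbhs xi A -> K [set p | A p.1].
  by move=> nA; apply: filterS (@near_pair1 _ _ (nbhs xi) (nbhs g) _ _ A nA) => p.
have sK : (fun p : T1 * 'M[R]_2 => p.2) @ K --> g.
  by move=> A nA; apply: filterS (@near_pair2 _ _ (nbhs xi) (nbhs g) _ _ A nA) => p.
have act_fr eta h : SL2 h -> frames (D eta \o moebius h) (PSL2_action eta h).
  by have [d fr] := hD eta; exact: frames_action.
have c := frames_cvg FK hD act_fr sg KS fK sK.
have h : K [set p | W (PSL2_action p.1 p.2)] := c _ hW.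
exact: h.
Qed.

End Action.

(** * Orbits and stabilizers *)

Section Orbits.
Context {R : realType} (L : hyperbolic_lamination R).
Local Notation V := 'rV[R]_2.
Local Notation H := (@half_plane R).
Local Notation T1 := (unit_tangent L).
Local Notation i0 := (bv 1 : V).

Lemma orbit_leaf (xi zeta : T1) : leaf (foot xi) (foot zeta) ->
  exists2 g, SL2 g & zeta = PSL2_action xi g.
Proof.
move=> lz; have [G [pi [g0 [U sg0 fr0]]]] := uniformization xi.
have dpi := uniformizes_developing U; have d0 := developing_moebius dpi sg0.
have [g1 sg1 fr1] := frames_moebius U lz.
have sg : SL2 (adj2 g0 * g1) by apply: SL2M => //; exact: SL2_adj.
exists (adj2 g0 * g1) => //.
apply: (frames_unique _ (frames_action d0 fr0 sg)).
apply: (frames_eq (developing_moebius dpi sg1) (developing_moebius d0 sg) _ fr1) => z zH.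
rewrite -developing_moebiusM//.
by rewrite mulrA mul_adj2// mul1r.
Qed.

(** The points of a dense leaf approach the foot of any vector, and a vector
    field normalised in a chart is continuous. *)
Lemma action_dense (xi : T1) : minimal_lamination L ->
  dense [set PSL2_action xi g | g in SL2].
Proof.
move=> min O' [eta Oeta] oO; have [a ea] := chart_dom_cover (foot eta).
have nO : nbhs eta O' by exact: open_nbhs_nbhs.
have [[Q U] /= [nQ nU] QUW] := (near_unit_tangent _ ea).1 nO.
pose v := vec eta a.
pose n (q : L) : R := (v *m metric_at a q *m v^T) 0 0.
have v1 : n (foot eta) = 1 by exact: vec_unit.
have cn : {for foot eta, continuous n}.
  apply: (cvg_entry (FF := nbhs_filter _)).
  have cv : (fun _ : L => v) @ nbhs (foot eta) --> v by exact: cvg_cst.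
  have cvT : (fun _ : L => v^T) @ nbhs (foot eta) --> v^T by exact: cvg_cst.
  exact: (cvg_mulmx (cvg_mulmx cv (metric_at_continuous ea)) cvT).
have cs : (fun q => (Num.sqrt (n q))^-1 *: v) @ nbhs (foot eta) --> v.
  rewrite -[X in _ --> X]scale1r; apply: (@cvgZr_tmp _ _ _ (nbhs (foot eta))).
  have s1 : Num.sqrt (n (foot eta)) = 1 by rewrite v1 sqrtr1.
  suff : (fun q => (Num.sqrt (n q))^-1) @ nbhs (foot eta) --> (Num.sqrt (n (foot eta)))^-1.
    by rewrite s1 invr1.
  apply: (@cvgV _ _ (nbhs (foot eta))); first by rewrite s1 oner_eq0.
  exact: (cvg_comp_at cn (@sqrt_continuous R _)).
have n0 : nbhs (foot eta) [set q | 0 < n q].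
  by apply: (cvgr_gt _ cn); rewrite v1.
have nn : nbhs (foot eta) [set q | [/\ Q q, chart_dom a q, 0 < n q & U ((Num.sqrt (n q))^-1 *: v)] ].
  have nU' : nbhs (foot eta) [set q | U ((Num.sqrt (n q))^-1 *: v)] := cs _ nU.
  by apply: filterS3 (filterI nQ nU') (near_chart_dom ea) n0 => q [].
move: nn; rewrite nbhsE => -[B [oB Beta] BP].
have [|q [Bq lq]] := min (foot xi) B _ oB; first by exists (foot eta).
have [Qq qa nq Uq] := BP q Bq.
have unit_q : (((Num.sqrt (n q))^-1 *: v) *m metric_at a q *m ((Num.sqrt (n q))^-1 *: v)^T) 0 0 = 1.
  have E (c : R) (w : V) (m : 'M[R]_2) : (c *: w *m m *m (c *: w)^T) 0 0 = c ^+ 2 * (w *m m *m w^T) 0 0.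
    by rewrite linearZ /= -!scalemxAl -scalemxAr !mxE mulrA expr2.
  by rewrite E -/(n q) exprVn sqr_sqrtr ?mulVf// ?gt_eqF// ltW.
have [zeta [zq zv]] := unit_tangent_exists qa unit_q.
exists zeta; split; first by apply: (QUW (q, (Num.sqrt (n q))^-1 *: v)).
have lz : leaf (foot xi) (foot zeta) by rewrite zq.
by have [g sg ->] := orbit_leaf lz; exists g.
Qed.

Section Stabilizer.
Context (xi : T1) (G : set 'M[R]_2) (pi : V -> leaf_space L) (g0 : 'M[R]_2).
Hypotheses (U : uniformizes (riemannian_metric L) (leaf (foot xi)) G pi) (sg0 : SL2 g0).
Hypothesis (fr0 : frames (pi \o moebius g0) xi).

Lemma deck_invariant (c : 'M[R]_2) z : G c -> H z -> pi (moebius c z) = pi z.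
Proof.
move=> Gc zH; have [[[GS _ _ _ _] _] _ _ per _] := U.
symmetry; apply/per => //; first exact: half_plane_moebius (GS _ Gc) zH.
by exists c.
Qed.

(** Some deck transformation [c] carries [moebius g0 i0] to
    [moebius (g0 * g) i0]; then [c * g0] and [g0 * g] send the vector at [i0]
    to the same vector, and are equal up to sign. *)
Lemma stabilizer_deck g : SL2 g -> PSL2_action xi g = xi -> G (g0 * g * adj2 g0).
Proof.
move=> sg st; have [[[GS _ _ _ GN] _] _ _ per _] := U.
have dpi := uniformizes_developing U; have d0 := developing_moebius dpi sg0.
have iH := @half_plane_i0 R.
have fr1 : frames (pi \o moebius (g0 * g)) xi.
  have := frames_action d0 fr0 sg; rewrite st.
  apply: frames_eq; [exact: developing_moebius|exact: developing_moebius (SL2M sg0 sg)|].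
  by move=> z zH; rewrite developing_moebiusM.
have [e0 _] := fr0; have [e1 v1] := fr1.
have [c Gc cE] : exists2 c, G c & moebius (g0 * g) i0 = moebius c (moebius g0 i0).
  apply/per; [exact: half_plane_moebius|exact: half_plane_moebius (SL2M sg0 sg) iH|].
  by have := e0; rewrite e1.
have sc := GS _ Gc.
have fr2 : frames (pi \o moebius (c * g0)) xi.
  apply: (frames_eq d0 (developing_moebius dpi (SL2M sc sg0)) _ fr0) => z zH.
  by rewrite /= moebiusM// (deck_invariant Gc (half_plane_moebius sg0 zH)).
have [e2 v2] := fr2.
have mE : moebius (g0 * g) i0 = moebius (c * g0) i0 by rewrite cE moebiusM.
have [a xa] := chart_dom_cover (foot xi).
have a1 : chart_dom a (pi (moebius (g0 * g) i0)) by have := xa; rewrite e1.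
have a2 : chart_dom a (pi (moebius (c * g0) i0)) by rewrite -mE.
have [_ J1] := developing_moebius_jacobian dpi (SL2M sg0 sg) iH a1.
have [_ J2] := developing_moebius_jacobian dpi (SL2M sc sg0) iH a2.
have [_ /(_ a a1)[_ detJ _]] := dpi _ (half_plane_moebius (SL2M sg0 sg) iH).
have jE : i0 *m moebius_jacobian (g0 * g) i0 = i0 *m moebius_jacobian (c * g0) i0.
  have e : i0 *m moebius_jacobian (g0 * g) i0 *m jacobian (in_chart a pi) (moebius (g0 * g) i0)
     = i0 *m moebius_jacobian (c * g0) i0 *m jacobian (in_chart a pi) (moebius (g0 * g) i0).
    rewrite -!mulmxA; have := v1 a xa; rewrite (v2 a xa) J1 J2 -mE => ->//.
  have uJ : jacobian (in_chart a pi) (moebius (g0 * g) i0) \in unitmx.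
    by rewrite unitmxE unitfE gt_eqF.
  by have := congr1 (mulmx^~ (invmx (jacobian (in_chart a pi) (moebius (g0 * g) i0)))) e;
    rewrite /= !mulmxK.
case: (moebius_frame_unique (SL2M sg0 sg) (SL2M sc sg0) mE jE) => ->.
  by rewrite -mulrA mul_adj2// mulr1.
by rewrite mulNr -mulrA mul_adj2// mulr1; exact: GN.
Qed.

Lemma deck_stabilizer c : G c -> PSL2_action xi (adj2 g0 * c * g0) = xi.
Proof.
move=> Gc; have [[[GS _ _ _ _] _] _ _ _ _] := U; have sc := GS _ Gc.
have dpi := uniformizes_developing U; have d0 := developing_moebius dpi sg0.
have sg : SL2 (adj2 g0 * c * g0).
  by apply: SL2M => //; apply: SL2M => //; exact: SL2_adj.
apply: (frames_unique _ fr0).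
have := frames_action d0 fr0 sg.
apply: frames_eq => //; first exact: developing_moebius.
move=> z zH; rewrite -developing_moebiusM//= !mulrA mul_adj2// mul1r moebiusM// deck_invariant//.
exact: half_plane_moebius.
Qed.

Lemma conj_adjK g : adj2 g0 * (g0 * g * adj2 g0) * g0 = g.
Proof. by rewrite !mulrA adj2_mul// mul1r -mulrA adj2_mul// mulr1. Qed.

Lemma stabilizer_discrete : exists2 e : R, 0 < e &
  forall g, SL2 g -> PSL2_action xi g = xi -> `|g - 1| < e -> g = 1.
Proof.
have [[[_ G1 _ _ _] [disc _]] _ _ _ _] := U.
have /nbhs_ballP[e /= e0 he] := disc 1 G1.
pose k : R := 4 * `|g0| * `|adj2 g0| + 1.
have k0 : 0 < k by rewrite ltr_wpDl// !mulr_ge0.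
exists (e / k); first by rewrite divr_gt0.
move=> g sg st gl; have Gc := stabilizer_deck sg st.
have c1 : g0 * g * adj2 g0 = 1.
  apply: he => //; rewrite -ball_normE/= distrC.
  have -> : g0 * g * adj2 g0 - 1 = g0 * (g - 1) * adj2 g0.
    by rewrite mulrBr mulr1 mulrBl mul_adj2.
  apply: (@le_lt_trans _ _ (k * `|g - 1|)); last by rewrite mulrC -ltr_pdivlMr.
  apply: le_trans (norm_mul2 _ _) _.
  have h := norm_mul2 g0 (g - 1).
  apply: (@le_trans _ _ (2 * (2 * (`|g0| * `|g - 1|) * `|adj2 g0|))).
    by rewrite ler_pM2l// ler_wpM2r.
  apply: (@le_trans _ _ (4 * `|g0| * `|adj2 g0| * `|g - 1|)).
    by rewrite le_eqVlt; apply/orP; left; apply/eqP; ring.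
  by rewrite /k [leRHS]mulrDl mul1r lerDl.
by rewrite -(conj_adjK g) c1 mulr1 adj2_mul.
Qed.

Lemma stabilizer_torsion_free g n : SL2 g -> PSL2_action xi g = xi -> (0 < n)%N ->
  g ^+ n = 1 -> g = 1 \/ g = -1.
Proof.
move=> sg st n0 gn; have [[_ [_ tf]] _ _ _ _] := U.
have Gc := stabilizer_deck sg st.
have cn : (g0 * g * adj2 g0) ^+ n = 1.
  have : (g0 * g * adj2 g0) ^+ n = g0 * g ^+ n * adj2 g0.
    elim: n {n0 gn} => [|n IH]; first by rewrite !expr0 mulr1 mul_adj2.
    rewrite exprSr IH -!mulrA (mulrA (adj2 g0) g0) adj2_mul// mul1r.
    by rewrite [in RHS]exprSr !mulrA.
  by rewrite gn mulr1 mul_adj2.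
case: (tf _ n Gc n0 (or_introl cn)) => c1; [left|right]; rewrite -(conj_adjK g) c1.
  by rewrite mulr1 adj2_mul.
by rewrite mulrN mulr1 mulNr adj2_mul.
Qed.

Lemma stabilizer_nontrivial : (exists c, [/\ G c, c <> 1 & c <> -1]) ->
  exists g, [/\ SL2 g, PSL2_action xi g = xi, g <> 1 & g <> -1].
Proof.
move=> [c [Gc c1 cN1]]; have [[[GS _ _ _ _] _] _ _ _ _] := U; have sc := GS _ Gc.
have cE : g0 * (adj2 g0 * c * g0) * adj2 g0 = c.
  by rewrite !mulrA mul_adj2// mul1r -mulrA mul_adj2// mulr1.
exists (adj2 g0 * c * g0); split.
- by apply: SL2M => //; apply: SL2M => //; exact: SL2_adj.
- exact: deck_stabilizer.
- by move=> e; apply: c1; rewrite -cE e mulr1 mul_adj2.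
- by move=> e; apply: cN1; rewrite -cE e mulrN mulr1 mulNr mul_adj2.
Qed.

End Stabilizer.
End Orbits.

(** * Local surjectivity *)

Section LocalSurjectivity.
Context {R : realType}.
Local Notation V := 'rV[R]_2.

Definition sq_dist (f : V -> V) (x w : V) : R :=
  (f w 0 0 - x 0 0) * (f w 0 0 - x 0 0) + (f w 0 1 - x 0 1) * (f w 0 1 - x 0 1).

Lemma sq_dist_ge0 f x w : 0 <= sq_dist f x w.
Proof. by apply: addr_ge0; rewrite -expr2 sqr_ge0. Qed.

Lemma sq_dist_differentiable f x w : differentiable f w -> differentiable (sq_dist f x) w.
Proof.
move=> df; have dj j : differentiable (fun w => f w 0 j - x 0 j) w.
  apply: differentiable_add; first exact: differentiable_entry.
  exact: differentiable_cst.
by apply: differentiable_add; apply: differentiable_mul.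
Qed.

Lemma derive_sq_dist f x w i : differentiable f w ->
  'D_(bv i) (sq_dist f x) w = 2 * ((f w 0 0 - x 0 0) * jacobian f w i 0
    + (f w 0 1 - x 0 1) * jacobian f w i 1).
Proof.
move=> df; have dj j : is_derive w (bv i : V) (fun w => f w 0 j - x 0 j) (jacobian f w i j).
  have D : is_derive w (bv i : V) (fun w => f w 0 j) (jacobian f w i j).
    apply: DeriveDef; first by apply: diff_derivable; exact: differentiable_entry.
    by rewrite jacobian_entry.
  have := is_derive_add D (is_derive_cst (- x 0 j) w (bv i : V)).
  by rewrite addr0.
have D := is_derive_add (is_derive_mul (dj 0) (dj 0)) (is_derive_mul (dj 1) (dj 1)).
by rewrite /sq_dist (@derive_val _ _ _ _ _ _ _ D); ring.
Qed.

Lemma critical_point (Q : V -> R) (z w e : V) (r : R) : `|w - z| < r ->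
  (forall u, `|u - z| <= r -> differentiable Q u) ->
  (forall u, `|u - z| <= r -> Q w <= Q u) -> 'D_e Q w = 0.
Proof.
move=> wr dQ Qmin; pose d := (r - `|w - z|) / (`|e| + 1).
have e1 : 0 < `|e| + 1 by rewrite ltr_wpDl.
have d0 : 0 < d by rewrite divr_gt0// subr_gt0.
have near_w s : s \in `](- d), d[ -> `|w + s *: e - z| <= r.
  rewrite in_itv/= -ltr_norml => sd.
  have -> : w + s *: e - z = (w - z) + s *: e by rewrite addrAC.
  apply: le_trans (ler_normD _ _) _; rewrite -lerBrDl normrZ.
  apply: (@le_trans _ _ (d * (`|e| + 1))); last by rewrite /d divfK// gt_eqF.
  by apply: ler_pM => //; [exact: ltW|rewrite lerDl].
have der s : s \in `](- d), d[ -> derivable Q (w + s *: e) e.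
  by move=> sd; apply: diff_derivable; apply: dQ; exact: near_w.
have z0 : 0 \in `](- d), d[ by rewrite in_itv/= oppr_lt0 d0.
have dd : - d <= d by rewrite ge0_cp// ltW.
have D0 : is_derive (0 : R) (1 : R) (fun s : R => Q (w + s *: e)) 0.
  refine (@derive1_at_min R (fun s : R => Q (w + s *: e)) (- d) d 0 dd _ z0 _).
    move=> s sd; have D := is_derive_line (der s sd); exact: (@ex_derive _ _ _ _ _ _ _ D).
  by move=> s sd; rewrite scale0r addr0; apply: Qmin; exact: near_w.
have D1 := is_derive_line (der 0 z0); rewrite scale0r addr0 in D1.
by rewrite -(@derive_val _ _ _ _ _ _ _ D1) (@derive_val _ _ _ _ _ _ _ D0).
Qed.

(** A point of the image is found by minimizing the distance: a critical point
    of the distance to [x] is a preimage of [x]. *)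
Lemma locally_onto (f : V -> V) (z : V) (r : R) : 0 < r ->
  (forall w : V, `|w - z| <= r -> differentiable f w /\ jacobian f w \in unitmx) ->
  (forall w : V, `|w - z| <= r -> f w = f z -> w = z) ->
  exists2 d, 0 < d & forall x : V, `|x - f z| < d -> exists2 w, `|w - z| <= r & f w = x.
Proof.
move=> r0 reg inj.
have df w : `|w - z| <= r -> differentiable f w by move=> /reg[].
have zz : `|z - z| <= r by rewrite subrr normr0 ltW.
pose B := [set w : V | `|w - z| <= r].
pose S := [set w : V | `|w - z| = r].
have cS : compact S.
  apply: (@subclosed_compact _ S B); last by move=> w; rewrite /S /B/= => ->.
    apply: (@closed_comp _ _ (fun w : V => `|w - z|) [set t | t = r]); last exact: closed_eq.
    move=> w _; apply: (@cvg_norm _ _ _ (nbhs w)).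
    by apply: (@cvgB _ _ _ (nbhs w)); [exact: cvg_id|exact: cvg_cst].
  exact: compact_cball.
have Q0 w : S w -> sq_dist f (f z) w != 0.
  move=> Sw; have wr : `|w - z| <= r by rewrite Sw.
  rewrite /sq_dist -!expr2 paddr_eq0 ?sqr_ge0// !sqrf_eq0 !subr_eq0; apply/negP => /andP[/eqP e0 /eqP e1].
  have fE : f w = f z by apply/rowP; elim/ord2P.
  have wz := inj w wr fE; move: Sw; rewrite /S/= wz subrr normr0 => e.
  by rewrite -e ltxx in r0.
have [C C0 hC] := @compact_bound R V S (fun w => (sq_dist f (f z) w)^-1) cS
  (fun w Sw => cvgV (Q0 w Sw) (differentiable_continuous
     (sq_dist_differentiable (f z) (df w (eq_ind_r (fun t => t <= r) (lexx r) Sw))))).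
have far w : S w -> (C + 1)^-1 <= sq_dist f (f z) w.
  move=> Sw; have q0 : 0 < sq_dist f (f z) w.
    by rewrite lt_neqAle eq_sym Q0//= sq_dist_ge0.
  have := hC w Sw; rewrite gtr0_norm ?invr_gt0// => h.
  have C1 : 0 < C + 1 by rewrite ltr_wpDl.
  rewrite -[leRHS]invrK lef_pV2 ?posrE ?invr_gt0//.
  by apply: le_trans h _; rewrite lerDl.
pose m := (C + 1)^-1; have m0 : 0 < m by rewrite invr_gt0 ltr_wpDl.
have m1 : m <= 1 by rewrite invf_le1 ?lerDr// ltr_wpDl.
exists (m / 64); first by rewrite divr_gt0.
move=> x xd.
have xj j : `|x 0 j - f z 0 j| < m / 64.
  by have := entry_le_norm (x - f z) 0 j; rewrite !mxE => /le_lt_trans; apply.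
have [w wB wmin] : exists2 w, w \in B & forall u, u \in B -> sq_dist f x w <= sq_dist f x u.
  apply: compact_EVT_min; [by exists z|exact: compact_cball|].
  apply: continuous_in_subspaceT => u; rewrite inE => uB.
  exact/differentiable_continuous/sq_dist_differentiable/df.
rewrite inE in wB; have {}wmin u : B u -> sq_dist f x w <= sq_dist f x u.
  by move=> uB; apply: wmin; rewrite inE.
have wr : `|w - z| < r.
  rewrite lt_neqAle wB andbT; apply/eqP => Sw; have := far w Sw; have := wmin z zz.
  have := xj 0; have := xj 1; rewrite -/m /sq_dist.
  move: (f w 0 0) (f w 0 1) (f z 0 0) (f z 0 1) (x 0 0) (x 0 1) => a b c d p q.
  rewrite !ltr_norml => /andP[h1 h2] /andP[h3 h4] h5 h6.
  have sq (t : R) : - (m / 64) < t -> t < m / 64 -> t * t <= m / 64.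
    by move=> t1 t2; have := m0; have := m1; nra.
  have cp : (c - p) * (c - p) <= m / 64 by apply: sq; lra.
  have dq : (d - q) * (d - q) <= m / 64 by apply: sq; lra.
  have par (u v t : R) : (u - v) * (u - v) <= 2 * ((u - t) * (u - t)) + 2 * ((v - t) * (v - t)).
    by have := sqr_ge0 (u + v - 2 * t); rewrite expr2; lra.
  have := par a c p; have := par b d q; have := m0.
  by move: h5 h6 cp dq; lra.
exists w => //.
have [dfw uJ] := reg w wB.
have crit i : (f w 0 0 - x 0 0) * jacobian f w i 0 + (f w 0 1 - x 0 1) * jacobian f w i 1 = 0.
  have c : 'D_(bv i) (sq_dist f x) w = 0.
    apply: (@critical_point (sq_dist f x) z w (bv i) r wr) => u ur.
      by apply: sq_dist_differentiable; exact: df.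
    exact: wmin.
  by rewrite derive_sq_dist// in c; lra.
have fx0 : (f w - x) *m (jacobian f w)^T = 0.
  apply/rowP => i; rewrite [LHS]mxE big_ord2.
  have := crit i; move: (jacobian f w) => J c; rewrite !mxE//.
have uJT : (jacobian f w)^T \in unitmx by rewrite unitmx_tr.
have := congr1 (mulmx^~ (invmx (jacobian f w)^T)) fx0.
by rewrite /= mulmxK// mul0mx => /eqP; rewrite subr_eq0 => /eqP.
Qed.

End LocalSurjectivity.

(** * Leaves with a trivial deck group *)

Section SimplyConnectedLeaf.
Context {R : realType} (L : hyperbolic_lamination R).
Local Notation V := 'rV[R]_2.
Local Notation H := (@half_plane R).
Local Notation I01 := (`[0, 1]%classic : set R).
Context (l : set (leaf_space L)) (G : set 'M[R]_2) (pi : V -> leaf_space L).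
Hypothesis (U : uniformizes (riemannian_metric L) l G pi).
Hypothesis pi_inj : forall z w, H z -> H w -> pi z = pi w -> z = w.

(** The map [pi] is locally onto in a chart, and the disks of the plaques are
    open in the leaf. *)
Lemma uniformization_open (z : V) (W : set V) : H z -> nbhs z W ->
  nbhs (pi z : leaf_space L) (pi @` (W `&` H)).
Proof.
move=> zH nW; have dpi := uniformizes_developing U.
have [a za] := chart_dom_cover (pi z).
set t := (chart a (pi z)).2; set f := in_chart a pi.
have n : nbhs z [set w | [/\ W w, H w, chart_dom a (pi w) & (chart a (pi w)).2 = t] ].
  by apply: filterS3 nW (near_half_plane zH) (developing_plaque dpi zH za) => w ? ? [].
have /nbhs_ballP[e /= e0 he] := n.
have e2 : 0 < e / 2 by rewrite divr_gt0.
have reg (w : V) : `|w - z| <= e / 2 -> [/\ W w, H w, chart_dom a (pi w) & (chart a (pi w)).2 = t].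
  move=> wz; apply: he; rewrite -ball_normE/= distrC; apply: le_lt_trans wz _.
  by rewrite ltr_pdivrMr// mulr_natr mulr2n ltrDl.
have [||d d0 onto] := @locally_onto R f z (e / 2) e2.
- move=> w /reg[_ wH wa _]; have [_ /(_ a wa)[[df _] detJ _]] := dpi w wH.
  by split; [exact: (nbhs_singleton df)|rewrite unitmxE unitfE gt_eqF].
- move=> w /reg[_ wH wa wt] fE; apply: pi_inj => //.
  by rewrite -(chartK wa) -(chartK za); congr chart_inv; apply: injective_projections.
pose A := [set x : V | `|x - f z| < d] `&` chart_disk a.
have oA : open A.
  apply: openI; last exact: open_open_disk.
  apply: (@open_comp _ _ (fun x : V => `|x - f z|) [set r | r < d]); last exact: open_lt.
  move=> x _; apply: (@cvg_norm _ _ _ (nbhs x)).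
  by apply: (@cvgB _ _ _ (nbhs x)); [exact: cvg_id|exact: cvg_cst].
have oP := @plaque_leaf_open R L a A t oA (@subIsetr _ _ _).
have Pz : [set p | [/\ chart_dom a p, (chart a p).2 = t & A (chart a p).1] ] (pi z).
  by split => //; split; [rewrite /= subrr normr0|exact: chart_in].
apply: filterS (leaf_open_nbhs oP Pz) => p [pa pt [pd _]].
have [w wr fw] := onto _ pd; have [Ww wH wa wt] := reg w wr.
exists w => //; rewrite -(chartK wa) -(chartK pa); congr chart_inv.
by apply: injective_projections => //; rewrite wt pt.
Qed.

Definition leaf_lift (p : leaf_space L) : V := xget 0 [set w | H w /\ pi w = p].

Lemma leaf_liftP p : l p -> H (leaf_lift p) /\ pi (leaf_lift p) = p.
Proof.
have [_ _ <- _ _] := U => -[w wH wp]; rewrite /leaf_lift.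
by case: xgetP => [u _ //|/(_ w)]; case.
Qed.

Lemma leaf_lift_pi w : H w -> leaf_lift (pi w) = w.
Proof.
move=> wH; have [_ _ im _ _] := U.
have lw : l (pi w) by rewrite -im; exists w.
by have [h e] := leaf_liftP lw; exact: pi_inj.
Qed.

Lemma leaf_lift_continuous (T : Type) (F : set_system T) {FF : Filter F} (c : T -> leaf_space L) p :
  l p -> c @ F --> p -> (fun t => leaf_lift (c t)) @ F --> leaf_lift p.
Proof.
move=> lp cp W nW; have [pH pE] := leaf_liftP lp.
have := uniformization_open pH nW; rewrite pE => n.
have h : F [set t | (pi @` (W `&` H)) (c t)] := cp _ n.
suff h' : F [set t | W (leaf_lift (c t))] by exact: h'.
by apply: filterS h => t [w [Ww wH] e]; rewrite /= -e leaf_lift_pi.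
Qed.

(** The map [pi] is a homeomorphism onto the leaf, so that the paths and the
    homotopies can be drawn along the segments of the half-plane. *)
Lemma leaf_simply_connected : simply_connected R l.
Proof.
have dpi := uniformizes_developing U; have [_ _ im _ _] := U.
have l_pi w : H w -> l (pi w) by move=> wH; rewrite -im; exists w.
have itvP (s : R) : I01 s -> 0 <= s /\ s <= 1.
  by rewrite /= in_itv/= => /andP[].
split; [split|].
- by exists (pi (bv 1)); apply: l_pi; exact: half_plane_i0.
- move=> p q lp lq; have [pH pE] := leaf_liftP lp; have [qH qE] := leaf_liftP lq.
  exists (fun s => pi (leaf_lift p + s *: (leaf_lift q - leaf_lift p))); split.
  + apply: continuous_in_subspaceT => s; rewrite inE => /itvP[s0 s1].
    by apply: developing_line => //; exact: half_plane_convex.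
  + move=> _ [s /itvP[s0 s1] <-]; apply: l_pi; exact: half_plane_convex.
  + by rewrite scale0r addr0.
  + by rewrite scale1r subrKC.
move=> c cc cl c01.
have lc s : I01 s -> l (c s) by move=> sI; apply: cl; exists s.
have I0 : I01 0 by rewrite /= in_itv/= lexx ler01.
have I1 : I01 1 by rewrite /= in_itv/= lexx ler01.
pose m (st : R * R) : V := leaf_lift (c st.1) + st.2 *: (leaf_lift (c 0) - leaf_lift (c st.1)).
have mH st : (I01 `*` I01) st -> H (m st).
  move=> [/lc sI /itvP[t0 t1]]; apply: half_plane_convex => //; first by have [] := leaf_liftP sI.
  by have [] := leaf_liftP (lc 0 I0).
exists (fun st => pi (m st)); split.
- apply/subspace_continuousP => -[s t] [sI tI] /=.
  pose K := within (I01 `*` I01) (nbhs (s, t)).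
  have FK : Filter K by exact: within_filter.
  have cs : (fun st : R * R => c st.1) @ K --> c s.
    move: cc => /subspace_continuousP/(_ s sI) cs W nW.
    have [A nA hA] : exists2 A, nbhs s A & forall u, A u -> I01 u -> W (c u).
      by exists [set u | I01 u -> W (c u)] => //; exact: (cs _ nW).
    suff h : K [set st | W (c st.1)] by exact: h.
    exists (A, setT); first by split => //; exact: filterT.
    by move=> -[u v] /= [Au _] [uI _]; exact: hA.
  have ct : (fun st : R * R => st.2) @ K --> t.
    move=> W nW; suff h : K [set st | W st.2] by exact: h.
    by exists (setT, W) => [|[u v] /= [_ Wv] _ //]; split => //; exact: filterT.
  have cL : (fun st : R * R => leaf_lift (c st.1)) @ K --> leaf_lift (c s).
    exact: (leaf_lift_continuous (lc s sI) cs).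
  have cm : m @ K --> m (s, t).
    have cD : (fun st : R * R => leaf_lift (c 0) - leaf_lift (c st.1)) @ K --> leaf_lift (c 0) - leaf_lift (c s).
      by apply: (@cvgB _ _ _ K) => //; exact: cvg_cst.
    exact: (cvgD cL (cvgZ ct cD)).
  have [cpi _] := dpi _ (mH (s, t) (conj sI tI)).
  exact: (cvg_comp_at cm cpi).
- move=> _ [st hst <-]; apply: l_pi; exact: mH.
- move=> s sI; rewrite /m /= scale0r addr0 scale1r subrKC.
  by split; [have [] := leaf_liftP (lc s sI)|have [] := leaf_liftP (lc 0 I0)].
- move=> t tI; rewrite /m /= -c01 subrr scaler0 addr0.
  by split; have [] := leaf_liftP (lc 0 I0).
Qed.

End SimplyConnectedLeaf.

(** * Minimality of the horocycle flow *)

Theorem theorem1 (R : realType) (L : hyperbolic_lamination R) :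
  minimal_lamination L ->
  (forall p : L, ~ simply_connected R (leaf p)) ->
  minimal_horocycle_flow L.
Proof.
move=> min nsc xi.
have E : (fun s => horocycle_flow s xi) = (fun w => PSL2_action xi (Um w)).
  apply/funext => s; rewrite /horocycle_flow; congr PSL2_action.
  by apply: mx2P; rewrite /Um mx2E !mxE /= ?mulr0 ?mulr1 ?addr0 ?add0r.
rewrite /horocycle_orbit E.
apply: (@horocycles_dense R _ (@PSL2_action R L)).
- exact: action1.
- exact: actionM.
- exact: actionN.
- exact: action_continuous.
- exact: unit_tangent_compact.
- exact: unit_tangent_hausdorff.
- by move=> x; exact: action_dense.
- move=> x; have [G [pi [g0 [U sg0 fr0]]]] := uniformization x.
  have [e e0 h] := stabilizer_discrete U sg0 fr0.
  by exists e; [exact: e0|move=> g [sg st] gl; exact: (h g sg st gl)].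
- move=> x g n [sg st]; have [G [pi [g0 [U sg0 fr0]]]] := uniformization x.
  exact: (stabilizer_torsion_free U sg0 fr0 sg st).
- move=> x; have [G [pi [g0 [U sg0 fr0]]]] := uniformization x.
  have [ex|triv] := pselect (exists c, [/\ G c, c <> 1 & c <> -1]).
    have [g [sg st g1 gN1]] := stabilizer_nontrivial U sg0 fr0 ex.
    by exists g; split; [split|exact: g1|exact: gN1].
  (* with a trivial deck group, [pi] is injective *)
  exfalso; apply: (nsc (foot x)); apply: (leaf_simply_connected U) => z w zH wH.
  have [_ _ _ per _] := U => /(per z w zH wH)[c Gc ->].
  have [->|c1] := eqVneq c 1; first by rewrite moebius1.
  have [->|cN1] := eqVneq c (-1); first by rewrite moebiusN moebius1.
  by exfalso; apply: triv; exists c; split; [exact: Gc|exact/eqP|exact/eqP].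
Qed.
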